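(* Let $n\in\mathbb N$ and $f\in\mathbb C\langle\bar X\rangle$. The following are equivalent: (i) $\tau(f(A_1,\dots,A_n))\ge 0$ for every separable $\mathrm{II}_1$-factor $\mathcal F$ with trace $\tau$ and all self-adjoint contractions $A_1,\dots,A_n\in\mathcal F$; (ii) $\varphi(f)\ge 0$ for all tracial contraction states $\varphi$ on $\mathbb C\langle\bar X\rangle$; (iii) for every real $\varepsilon>0$, $f+\varepsilon$ is cyclically equivalent to an element of $M_{\mathbb C}$.
   Context: $\mathbb C\langle\bar X\rangle$ is the free associative unital $\mathbb C$-algebra in noncommuting variables $\bar X=(X_1,\dots,X_n)$, with the involution $*$ that conjugates coefficients, satisfies $X_i^*=X_i$ and reverses words; $\langle\bar X\rangle$ is the set of all words in $X_1,\dots,X_n$ (including the empty word). Two polynomials $f,g$ are cyclically equivalent if $f-g$ is a sum of commutators $pq-qp$ in $\mathbb C\langle\bar X\rangle$. A quadratic module in $\mathbb C\langle\bar X\rangle$ is a set $M$ of symmetric elements ($g^*=g$) with $1\in M$, $M+M\subseteq M$, $g^*Mg\subseteq M$ for all $g\in\mathbb C\langle\bar X\rangle$. $M_{\mathbb C}$ is the quadratic module generated by $1-X_1^2,\dots,1-X_n^2$ in $\mathbb C\langle\bar X\rangle$. A tracial contraction state on $\mathbb C\langle\bar X\rangle$ is a $\mathbb C$-linear map $\varphi:\mathbb C\langle\bar X\rangle\to\mathbb C$ such that (a) $\varphi(fg)=\varphi(gf)$ for all $f,g$; (b) $|\varphi(w)|\le 1$ for all words $w\in\langle\bar X\rangle$;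 (c) $\varphi(f^*f)\ge 0$ for all $f$; (d) $\varphi(1)=1$; (e) $\varphi(f^* )=\varphi(f)^*$ for all $f$ (where $^*$ on $\mathbb C$ is complex conjugation). The trace of a $\mathrm{II}_1$-factor is its canonical (normalized) trace. A contraction is an element of norm at most $1$. A statement $c\ge 0$ for a complex number $c$ includes that $c$ is real. *)

(* Defs.v *)
From HB Require Import structures.
From mathcomp Require Import all_boot all_order all_algebra.
From mathcomp Require Import all_classical all_reals all_analysis.
From mathcomp Require Import complex finmap.
(* The notations of monalg clash with those of mathcomp-analysis. *)
From mathcomp Require Import -(notations) monalg.

Set Implicit Arguments.
Unset Strict Implicit.
Unset Printing Implicit Defensive.

Import GRing.Theory Num.Theory numFieldNormedType.Exports.

Local Open Scope classical_set_scope.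
Local Open Scope ring_scope.
Local Open Scope complex_scope.

Section Words.
Variable n : nat.

Definition word := seq 'I_n.

HB.instance Definition _ := Choice.on word.

Lemma word_unit (v w : word) : v ++ w = [::] -> v = [::] /\ w = [::].
Proof. by case: v => //= ->. Qed.

HB.instance Definition _ := Choice_isMonomialDef.Build word
  (@catA 'I_n) (@cat0s 'I_n) (@cats0 'I_n) word_unit.

End Words.

(* The free algebra, as the monoid algebra of the free monoid of words. *)
Notation ncpoly R n := (malg (word n) R[i]).

Section NCPolynomials.
Variables (R : realType) (n : nat).
Local Notation ncpoly := (ncpoly R n).

Definition ncword (w : word n) : ncpoly := mkmalgU w 1.

Definition ncX (i : 'I_n) : ncpoly := ncword [:: i].

Definition ncstar (f : ncpoly) : ncpoly :=
  \sum_(w <- msupp f) mkmalgU (rev w : word n) (mcoeff w f)^*.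

Definition cyc_equiv (f g : ncpoly) : Prop :=
  exists s : seq (ncpoly * ncpoly),
    f - g = \sum_(pq <- s) (pq.1 * pq.2 - pq.2 * pq.1).

Definition quadratic_module (M : set ncpoly) : Prop :=
  [/\ forall g, M g -> ncstar g = g,
      M 1,
      forall g h, M g -> M h -> M (g + h)
    & forall g h, M h -> M (ncstar g * h * g)].

Definition generated_quadratic_module (G : set ncpoly) : set ncpoly :=
  [set p | forall M, quadratic_module M -> G `<=` M -> M p].

Definition M_C : set ncpoly :=
  generated_quadratic_module [set 1 - ncX i ^+ 2 | i in [set: 'I_n]].

(* In R[i], 0 <= z means that z is real and nonnegative. *)
Definition tracial_contraction_state (phi : {scalar ncpoly}) : Prop :=
  [/\ forall f g : ncpoly, phi (f * g) = phi (g * f),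
      forall w : word n, `|phi (ncword w)| <= 1,
      forall f, 0 <= phi (ncstar f * f),
      phi 1 = 1
    & forall f, phi (ncstar f) = (phi f)^*].

End NCPolynomials.

Section Operators.
Variables (R : realType) (H : completeNormedModType R[i]).

(* Linear in the first argument, conjugate-linear in the second. *)
Variable dot : {dot H for @Num.conj R[i]}.

(* The complete norm of H is the one induced by the inner product. *)
Definition hilbert_norm : Prop := forall x : H, `|x| ^+ 2 = dot x x.

Definition separable_hilbert : Prop :=
  exists2 D : set H, countable D & dense D.

Definition bounded_op (T : H -> H) : Prop :=
  linear T /\ exists k : R[i], forall x, `|T x| <= k * `|x|.

Definition contraction_op (T : H -> H) : Prop := forall x, `|T x| <= `|x|.

Definition adjoint_op (T S : H -> H) : Prop :=
  forall x y, dot (T x) y = dot x (S y).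

Definition commutant (M : set (H -> H)) : set (H -> H) :=
  [set T | bounded_op T /\ forall S, M S -> T \o S = S \o T].

Definition von_neumann_algebra (M : set (H -> H)) : Prop :=
  [/\ M `<=` bounded_op,
      forall T, M T -> exists2 S, adjoint_op T S & M S
    & commutant (commutant M) = M].

Definition vn_factor (M : set (H -> H)) : Prop :=
  von_neumann_algebra M /\
  M `&` commutant M = [set (fun x => c *: x) | c in [set: R[i]]].

Definition projection_op (p : H -> H) : Prop := p \o p = p /\ adjoint_op p p.

(* For projections, q <= p is expressed by p \o q = q. *)
Definition minimal_projection (M : set (H -> H)) (p : H -> H) : Prop :=
  [/\ M p, projection_op p, p <> (fun=> 0)
    & forall q, M q -> projection_op q -> p \o q = q -> q = (fun=> 0) \/ q = p].

(* The projection 1 is finite in the sense of Murray and von Neumann: it is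
   not equivalent to a proper subprojection v v^*. *)
Definition finite_vna (M : set (H -> H)) : Prop :=
  forall v vs, M v -> M vs -> adjoint_op v vs -> vs \o v = id -> v \o vs = id.

Definition II1_factor (M : set (H -> H)) : Prop :=
  [/\ vn_factor M, exists x : H, x != 0, finite_vna M
    & forall p, ~ minimal_projection M p].

(* A II_1 factor has exactly one tracial state: its canonical trace, which is
   automatically faithful and normal. Values of tau outside M are irrelevant. *)
Definition canonical_trace (M : set (H -> H)) (tau : (H -> H) -> R[i]) : Prop :=
  [/\ forall c S T, M S -> M T ->
        tau (fun x => c *: S x + T x) = c * tau S + tau T,
      forall S T, M S -> M T -> tau (S \o T) = tau (T \o S),
      forall S T, M S -> M T -> adjoint_op S T -> 0 <= tau (T \o S)
    & tau id = 1].

Definition word_eval (n : nat) (A : 'I_n -> H -> H) (w : word n) : H -> H :=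
  foldr (fun i T => A i \o T) id w.

Definition nceval (n : nat) (A : 'I_n -> H -> H) (f : ncpoly R n) : H -> H :=
  fun x => \sum_(w <- msupp f) mcoeff w f *: word_eval A w x.

End Operators.

(* Main.v *)
From HB Require Import structures.
From mathcomp Require Import all_boot all_order all_algebra.
From mathcomp Require Import all_classical all_reals all_analysis.
From mathcomp Require Import complex finmap.
From mathcomp Require Import -(notations) monalg.
From mathcomp Require Import ring lra zify.
Require Import Defs.
Set Implicit Arguments.
Unset Strict Implicit.
Unset Printing Implicit Defensive.
Import Order.TTheory GRing.Theory Num.Theory numFieldNormedType.Exports.
Local Open Scope classical_set_scope.
Local Open Scope ring_scope.
Local Open Scope complex_scope.
(* Conjugation in coordinates, to which the generic one is convertible. *)
Local Notation "z ^*" := (conjc z) : ring_scope.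

(** A tracial contraction state is determined by its values on words. All that
    matters about such a function [Phi] is that it is tracial, bounded by 1 and
    has a positive definite kernel [Phi (rev w ++ v)]; [word_state] records this
    over any monoid with an involution. Boundedness on the monoid already makes
    left translations contractions of the kernel form ([q_mulc]). This one
    inequality shows that states are nonnegative on [M_C], so that certificates
    bound states from below ([state_ge0_of_certificates]), and it makes the
    letters act as contractions on the Hilbert space of a state.

    Factors and states. If the [A i] are selfadjoint contractions in a von
    Neumann algebra with tracial state [tau], then [tau (w (A))] is a state on
    words. The substantial point is that [tau] is bounded by 1 on contractions:
    [1 - T^* T] is the square of an element of the algebra ([tau_contraction]).
    In the other direction a state must be realized inside a factor of type
    II_1, whereas its own Hilbert space only carries a finite von Neumann
    algebra. The state is therefore enlarged first: a letter of square one and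
    trace zero is adjoined ([ophi]), independent copies of the result are placed
    at all integer sites ([Psi]), and the shift of the sites is adjoined as a
    group of unitaries ([cphi]). Words moved far apart become independent, so
    the vectors that commute with everything are the multiples of the trace
    vector, and the algebra is a factor ([gns_factor]); the shifts are infinitely
    many orthonormal unitaries, which excludes minimal projections
    ([gns_no_minimal]). The original state sits at site 0. The Hilbert space is
    the reproducing kernel space of the kernel: its vectors are functions on
    the monoid, so adjoints, limits and dense sequences are all computed
    pointwise.

    States and certificates. The elements [m + k + a], with [m] in [M_C], [k] a
    sum of commutators and [a] skew, form a convex cone in which 1 is an order
    unit ([cert_bound]). A polynomial outside the cone is separated from it
    ([cone_separation]) by a functional that vanishes on commutators and is real
    on selfadjoint elements, and such a functional is a tracial contraction
    state. Hence [f + eps = m + k + a] if [f] is nonnegative on states. On [a]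
    every state takes values that are both real and imaginary, so [a] is killed
    by all states, and then [a] is itself a sum of commutators
    ([cyc_equiv0_of_states]): normalized traces of words in Hermitian matrices
    are states, the resulting identities are polynomial in the entries and hold
    for all matrices, and matrix units placed along a cycle read off the sum of
    the coefficients over the rotations of a word. *)

(** * Complex numbers by coordinates *)

Section ComplexFacts.
Variable R : realType.
Local Notation C := R[i].
Implicit Types (x y z : C) (a b : R).

Definition nsq z : R := complex.Re z ^+ 2 + complex.Im z ^+ 2.

Lemma ReD x y : complex.Re (x + y) = complex.Re x + complex.Re y.
Proof. by case: x; case: y. Qed.
Lemma ImD x y : complex.Im (x + y) = complex.Im x + complex.Im y.
Proof. by case: x; case: y. Qed.
Lemma ReN x : complex.Re (- x) = - complex.Re x.
Proof. by case: x. Qed.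
Lemma ImN x : complex.Im (- x) = - complex.Im x.
Proof. by case: x. Qed.
Lemma ReM x y : complex.Re (x * y) = complex.Re x * complex.Re y - complex.Im x * complex.Im y.
Proof. by case: x; case: y. Qed.
Lemma ImM x y : complex.Im (x * y) = complex.Re x * complex.Im y + complex.Im x * complex.Re y.
Proof. by case: x => a b; case: y => c d /=; rewrite addrC. Qed.
Lemma ReJ x : complex.Re x^* = complex.Re x.
Proof. by case: x. Qed.
Lemma ImJ x : complex.Im x^* = - complex.Im x.
Proof. by case: x. Qed.
Definition Csimpl := (ReD, ImD, ReN, ImN, ReM, ImM, ReJ, ImJ).

Lemma Ceq x y : complex.Re x = complex.Re y -> complex.Im x = complex.Im y -> x = y.
Proof. by case: x => a b; case: y => c d /= -> ->. Qed.

Lemma cjD x y : (x + y)^* = x^* + y^*.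
Proof. by apply: Ceq; rewrite !Csimpl // opprD. Qed.
Lemma cjM x y : (x * y)^* = x^* * y^*.
Proof. by apply: Ceq; rewrite !Csimpl; ring. Qed.
Lemma cjN x : (- x)^* = - x^*.
Proof. by apply: Ceq; rewrite !Csimpl. Qed.
Lemma cjK x : x^*^* = x.
Proof. by apply: Ceq; rewrite !Csimpl // opprK. Qed.

Lemma Cge0 x : (0 <= x) = (complex.Im x == 0) && (0 <= complex.Re x).
Proof. by rewrite lecE /=. Qed.

Lemma Cge0P x : 0 <= x -> x = (complex.Re x)%:C /\ 0 <= complex.Re x.
Proof. by rewrite Cge0 => /andP[/eqP i0 ->]; split=> //; apply: Ceq. Qed.

Lemma Cgt0P x : 0 < x -> x = (complex.Re x)%:C /\ 0 < complex.Re x.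
Proof.
by move=> x0; have [e _] := Cge0P (ltW x0); split=> //; move: x0; rewrite e -[0]/(0%:C) ltcR.
Qed.
Lemma C_half : 2^-1 = (2^-1)%:C :> C.
Proof. by rewrite rmorphV ?unitfE ?pnatr_eq0 // rmorph_nat. Qed.
Lemma nat_above a : exists N : nat, a < N%:R.
Proof. by exists (Num.trunc a).+1; exact: truncnS_gt. Qed.
Lemma nsq_ge0 x : 0 <= nsq x.
Proof. by rewrite addr_ge0 ?sqr_ge0. Qed.

Lemma nsqM x y : nsq (x * y) = nsq x * nsq y.
Proof. rewrite /nsq !Csimpl; ring. Qed.

Lemma nsqJ x : nsq x^* = nsq x.
Proof. rewrite /nsq !Csimpl; ring. Qed.

Lemma nsq_eq0 x : nsq x = 0 -> x = 0.
Proof.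
move=> /eqP; rewrite paddr_eq0 ?sqr_ge0 // !sqrf_eq0 => /andP[/eqP a /eqP b].
exact: Ceq.
Qed.

Lemma conjM_nsq x : x^* * x = (nsq x)%:C.
Proof. by apply: Ceq; rewrite /nsq !Csimpl /=; ring. Qed.

Lemma normC_nsq x : `|x| = (Num.sqrt (nsq x))%:C.
Proof. by rewrite normc_def. Qed.

Lemma normC_le1 x : (`|x| <= 1) = (nsq x <= 1).
Proof.
by rewrite normC_nsq -[1]/(1%:C) lecR -[X in _ <= X]sqrtr1 ler_sqrt.
Qed.

Lemma realC_ge0 a : (0 <= a%:C) = (0 <= a).
Proof. by rewrite -[0]/(0%:C) lecR. Qed.

(** A nonnegative Hermitian quadratic form in two variables has nonnegative
    discriminant; every Cauchy-Schwarz inequality below is an instance. *)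
Lemma quadratic_CS (a b : R) (z : C) : 0 <= a -> 0 <= b ->
  (forall l : C, 0 <= a + 2 * complex.Re (l^* * z) + nsq l * b) ->
  nsq z <= a * b.
Proof.
move=> a0 b0 h.
have {}h (t : R) : 0 <= a - 2 * t * nsq z + t ^+ 2 * nsq z * b.
  have := h ((- t)%:C * z); congr (_ <= _); rewrite nsqM /nsq !Csimpl /=; ring.
have z0 := nsq_ge0 z.
have [b_gt0|b_le0] := ltP 0 b.
  have := h (b^-1).
  have -> : a - 2 * b^-1 * nsq z + b^-1 ^+ 2 * nsq z * b = a - nsq z / b.
    by field; apply: lt0r_neq0.
  by rewrite subr_ge0 ler_pdivrMr.
have bz : b = 0 by lra.
rewrite bz mulr0; rewrite leNgt; apply/negP => zp.
have := h ((a + 1) / (2 * nsq z)).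
rewrite bz mulr0 addr0.
have -> : a - 2 * ((a + 1) / (2 * nsq z)) * nsq z = -1.
  by field; apply: lt0r_neq0.
lra.
Qed.

Lemma le_small (a b M : R) : (forall e, 0 < e -> a <= b + M * e) -> a <= b.
Proof.
move=> h; apply/ler_addgt0Pr => d d0.
have M0 : 0 < `|M| + 1 by rewrite ltr_wpDl.
have := h (d / (`|M| + 1)) (divr_gt0 d0 M0).
have : M * (d / (`|M| + 1)) <= (`|M| + 1) * (d / (`|M| + 1)).
  by rewrite ler_wpM2r ?divr_ge0 ?(ltW d0) ?(ltW M0) //; have := ler_norm M; lra.
have -> : (`|M| + 1) * (d / (`|M| + 1)) = d by field; apply: lt0r_neq0.
lra.
Qed.
End ComplexFacts.

(** * Positive definite kernels *)
Section KernelSums.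
Variables (R : realType) (W : Type).
Local Notation C := R[i].
Local Notation comb := (seq (C * W)).
Implicit Types (s t : seq (C * W)) (h k : W -> C) (K : W -> W -> C).

(** A list of coefficients and points stands for a finite combination of points.
    The pairing [ev] is antilinear in it because it will be the inner product of
    a function with a combination of kernel vectors. *)
Definition ev h s : C := \sum_(x <- s) x.1^* * h x.2.
Definition vec K s : W -> C := fun w => \sum_(x <- s) x.1 * K x.2 w.
Definition sc (c : C) s : comb := [seq (c * x.1, x.2) | x <- s].
Definition qf K s : R := complex.Re (ev (vec K s) s).

Lemma ev_nil h : ev h [::] = 0. Proof. by rewrite /ev big_nil. Qed.
Lemma ev_cat h s t : ev h (s ++ t) = ev h s + ev h t.
Proof. by rewrite /ev big_cat. Qed.
Lemma ev_sc h c s : ev h (sc c s) = c^* * ev h s.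
Proof.
rewrite /ev /sc big_map mulr_sumr; apply: eq_bigr => x _ /=.
by rewrite rmorphM mulrA.
Qed.
Lemma ev1 h c w : ev h [:: (c, w)] = c^* * h w.
Proof. by rewrite /ev big_seq1. Qed.
Lemma evD h k s : ev (h + k) s = ev h s + ev k s.
Proof. by rewrite /ev -big_split /=; apply: eq_bigr => x _; rewrite -mulrDr. Qed.
Lemma evZ c h s : ev (c *: h) s = c * ev h s.
Proof. by rewrite /ev mulr_sumr; apply: eq_bigr => x _; rewrite mulrCA. Qed.
Lemma evN h s : ev (- h) s = - ev h s.
Proof. by rewrite -scaleN1r evZ mulN1r. Qed.

Lemma vec_nil K : vec K [::] = 0.
Proof. by apply/funext => w; rewrite /vec big_nil. Qed.
Lemma vec_cat K s t : vec K (s ++ t) = vec K s + vec K t.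
Proof. by apply/funext => w; rewrite /vec big_cat. Qed.
Lemma vec_sc K c s : vec K (sc c s) = c *: vec K s.
Proof.
apply/funext => w; rewrite /vec /sc big_map.
transitivity (c * \sum_(x <- s) x.1 * K x.2 w) => //.
by rewrite mulr_sumr; apply: eq_bigr => x _; rewrite mulrA.
Qed.
Lemma vec1 K c w : vec K [:: (c, w)] = c *: K w.
Proof. by apply/funext => v; rewrite /vec big_seq1. Qed.

Definition hermitian_kernel K := forall v w, K w v = (K v w)^*.
Definition pdkernel K := hermitian_kernel K /\ forall s, 0 <= ev (vec K s) s.

Lemma form_herm K s t : hermitian_kernel K -> ev (vec K s) t = (ev (vec K t) s)^*.
Proof.
move=> hK; rewrite /ev /vec rmorph_sum /=.
under eq_bigr do rewrite mulr_sumr.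
under [RHS]eq_bigr do rewrite rmorphM rmorph_sum /= mulr_sumr.
rewrite exchange_big /=; apply: eq_bigr => x _; apply: eq_bigr => y _.
by rewrite (hK y.2 x.2) rmorphM /= !conjcK mulrCA.
Qed.

Section Pd.
Variables (K : W -> W -> C) (pK : pdkernel K).
Let hK := pK.1.
Local Notation form s t := (ev (vec K s) t).
Local Notation q := (qf K).

Lemma qfE s : form s s = (q s)%:C.
Proof. by have [] := Cge0P (pK.2 s). Qed.
Lemma qf_ge0 s : 0 <= q s.
Proof. by have [] := Cge0P (pK.2 s). Qed.
Lemma qf_cat s t : q (s ++ t) = q s + 2 * complex.Re (form s t) + q t.
Proof.
rewrite /qf vec_cat !evD !ev_cat [form t s]form_herm // !Csimpl.
ring.
Qed.
Lemma qf_sc c s : q (sc c s) = nsq c * q s.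
Proof. by rewrite /qf vec_sc evZ ev_sc qfE /nsq !Csimpl /=; ring. Qed.
Lemma form_CS s t : nsq (form s t) <= q s * q t.
Proof.
apply: quadratic_CS; rewrite ?qf_ge0 // => l.
by have := qf_ge0 (s ++ sc l t); rewrite qf_cat ev_sc qf_sc.
Qed.
End Pd.
End KernelSums.

(** * Tracial states on monoids with involution *)
Section StarMonoids.
Variables (R : realType) (W : Type).
Local Notation C := R[i].

(** A tracial state on the monoid algebra of [W], given on [W] itself and
    bounded there by 1. The monoid laws are included so that one hypothesis
    suffices to carry out the constructions below. *)
Record word_state (op : W -> W -> W) (e : W) (st : W -> W) (phi : W -> C) := {
  ws_assoc : associative op;
  ws_1w : left_id e op;
  ws_w1 : right_id e op;
  ws_stK : involutive st;
  ws_stM : forall v w, st (op v w) = op (st w) (st v);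
  ws_tr : forall v w, phi (op v w) = phi (op w v);
  ws_st : forall w, phi (st w) = (phi w)^*;
  ws_1 : phi e = 1;
  ws_le1 : forall w, nsq (phi w) <= 1;
  ws_pos : forall s, 0 <= ev (vec (fun v w => phi (op (st w) v)) s) s }.

Section Theory.
Variables (op : W -> W -> W) (e : W) (st : W -> W) (phi : W -> C).
Hypothesis S : word_state op e st phi.
Definition sker (v w : W) := phi (op (st w) v).
Local Notation K := sker.
Local Notation "v ** w" := (op v w) (at level 40, left associativity).
Local Notation q := (qf K).

Lemma ws_st1 : st e = e.
Proof. by rewrite -{2}(ws_stK S e) -{2}(ws_1w S (st e)) (ws_stM S) (ws_stK S) (ws_1w S). Qed.

Lemma sker_pd : pdkernel K.
Proof.
split=> [v w|s]; last exact: (ws_pos S).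
by rewrite /K -(ws_st S) (ws_stM S) (ws_stK S).
Qed.

Definition mulc (u : W) (s : seq (C * W)) := [seq (x.1, u ** x.2) | x <- s].
Definition starc (s : seq (C * W)) := [seq (x.1^*, st x.2) | x <- s].

Lemma mulc_op u v s : mulc (u ** v) s = mulc u (mulc v s).
Proof.
rewrite /mulc -map_comp; apply: eq_map => x /=; by rewrite (ws_assoc S).
Qed.

Lemma form_mulc u s t :
  ev (vec K (mulc u s)) t = ev (vec K s) (mulc (st u) t).
Proof.
rewrite /ev /vec /mulc big_map; apply: eq_bigr => x _; rewrite big_map /=.
congr (_ * _); apply: eq_bigr => y _; congr (_ * _).
by rewrite /K (ws_stM S) (ws_stK S) (ws_assoc S).
Qed.

(** Traciality is what makes the involution isometric for the form. *)
Lemma q_starc s : q (starc s) = q s.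
Proof.
rewrite /qf; suff -> : ev (vec K (starc s)) (starc s) = ev (vec K s) s by [].
rewrite /ev /vec /starc big_map /=.
under eq_bigr do rewrite big_map mulr_sumr /=.
under [RHS]eq_bigr do rewrite mulr_sumr.
rewrite exchange_big /=; apply: eq_bigr => x _; apply: eq_bigr => y _.
by rewrite conjcK mulrCA; congr (_ * (_ * _)); rewrite /K (ws_stK S) (ws_tr S).
Qed.

(** The bound depends on the coefficients alone, so it is uniform along a
    sequence of translates of [s]. *)
Lemma form_bound s t : complex.Re (ev (vec K s) t) <=
  (\sum_(x <- s) (1 + nsq x.1)) * (\sum_(x <- t) (1 + nsq x.1)).
Proof.
have Re_sum (I : Type) (r : seq I) (F : I -> C) :
  complex.Re (\sum_(i <- r) F i) = \sum_(i <- r) complex.Re (F i).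
  by apply: (big_morph _ (@ReD R)).
rewrite /ev /vec Re_sum mulr_sumr; apply: ler_sum => y _.
rewrite mulr_sumr Re_sum mulr_suml; apply: ler_sum => x _.
have := ws_le1 S (op (st y.2) x.2); rewrite -/(K x.2 y.2).
set z := K _ _; move=> z1.
have : nsq (y.1^* * (x.1 * z)) <= nsq y.1 * nsq x.1.
  rewrite !nsqM nsqJ ler_wpM2l ?nsq_ge0 // -[leRHS]mulr1.
  by rewrite ler_wpM2l ?nsq_ge0.
set c := _ * (_ * z) => hc.
have : complex.Re c ^+ 2 <= nsq c by rewrite lerDl sqr_ge0.
have := nsq_ge0 x.1; have := nsq_ge0 y.1; nra.
Qed.

(** Write [x] for [u^* u] and [b m] for the form of [x^m s] against [s].
    Cauchy-Schwarz gives [b m ^2 <= b (2m) * b 0], so [b 1 > b 0] would force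
    the sequence [b (2^k)] to grow without bound, whereas it is bounded because
    [phi] is bounded on [W]. *)
Lemma q_mulc u s : q (mulc u s) <= q s.
Proof.
have pK := sker_pd.
pose x := st u ** u.
pose xs m := iter m (mulc x) s.
pose b m := complex.Re (ev (vec K (xs m)) s).
have bxx m : complex.Re (ev (vec K (xs m)) (xs m)) = b (m + m)%N.
  rewrite /b; move: {1 3}m => k.
  elim: m k => [|m ih] k; first by rewrite addn0.
  rewrite addnS -addSn -ih [xs m.+1]iterS [xs k.+1]iterS form_mulc.
  by rewrite /x (ws_stM S) (ws_stK S).
have b0 : b 0%N = q s by [].
have b1 : b 1%N = q (mulc u s).
  by rewrite /b /xs /= /x mulc_op form_mulc (ws_stK S).
have bound m : b m <= (\sum_(y <- s) (1 + nsq y.1)) ^+ 2.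
  rewrite /b; apply: (le_trans (form_bound _ _)).
  suff -> : \sum_(y <- xs m) (1 + nsq y.1) = \sum_(y <- s) (1 + nsq y.1).
    by rewrite expr2.
  rewrite /xs; elim: m => //= m ih; by rewrite /mulc big_map.
have bge0 m : 0 <= b (m + m)%N by rewrite -bxx; exact: (qf_ge0 pK).
have cs m : b m ^+ 2 <= b (m + m)%N * b 0%N.
  rewrite -bxx; apply: le_trans (form_CS pK (xs m) s).
  by rewrite /nsq lerDl sqr_ge0.
rewrite -b1 -b0 leNgt; apply/negP => lt01.
have bpos : 0 < b 0%N.
  rewrite lt_def; have := bge0 0%N; rewrite addn0 => ->; rewrite andbT.
  apply/eqP => z; have := cs 1%N; rewrite z mulr0 => h.
  have h2 : b 1%N = 0 by apply/eqP; rewrite -sqrf_eq0 eq_le h sqr_ge0.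
  by move: lt01; rewrite z h2 ltxx.
pose r := b 1%N / b 0%N - 1.
have r_gt0 : 0 < r by rewrite subr_gt0 ltr_pdivlMr // mul1r.
(* By Bernoulli, [(1 + r)^m] may be replaced by the linear bound [1 + m r]. *)
have grow k : b 0%N * (1 + r *+ 2 ^ k) <= b (2 ^ k)%N.
  elim: k => [|k ih].
    rewrite expn0 mulr1n /r addrC subrK mulrC divfK //.
    exact: lt0r_neq0.
  rewrite expnS mul2n -addnn.
  have := cs (2 ^ k)%N; set A := b (2 ^ k)%N in ih *; set B := b (_ + _)%N => h.
  rewrite mulrnDr; set t := r *+ _ in ih *.
  have t0 : 0 <= t by rewrite mulrn_wge0 // ltW.
  set c := b 0%N in bpos ih h *.
  have h2 : (c * (1 + t)) ^+ 2 <= A ^+ 2.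
    have ct0 : 0 <= c * (1 + t) by rewrite mulr_ge0 ?(ltW bpos) ?addr_ge0.
    by apply: lerXn2r => //; rewrite nnegrE //; apply: le_trans ih.
  suff : c * (c * (1 + (t + t))) <= c * B by rewrite ler_pM2l.
  nra.
set A := \sum_(y <- s) _ in bound.
have [k hk] : exists k, A ^+ 2 < b 0%N * (1 + r *+ 2 ^ k).
  have rb : 0 < r * b 0%N by rewrite mulr_gt0.
  have [k hk] := nat_above (A ^+ 2 / (r * b 0%N)).
  exists k; rewrite ltr_pdivrMr // in hk.
  have : (k%:R : R) <= (2 ^ k)%N%:R by rewrite ler_nat ltnW // ltn_expl.
  rewrite -mulr_natr; move: bpos r_gt0 hk rb; nra.
by have := le_lt_trans (le_trans (grow k) (bound _)) hk; rewrite ltxx.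
Qed.

End Theory.
End StarMonoids.

Lemma free_word_state (R : realType) (A : Type) (Phi : seq A -> R[i]) :
  (forall v w, Phi (v ++ w) = Phi (w ++ v)) -> (forall w, Phi (rev w) = (Phi w)^*) ->
  Phi [::] = 1 -> (forall w, nsq (Phi w) <= 1) ->
  (forall s, 0 <= ev (vec (fun v w => Phi (rev w ++ v)) s) s) ->
  word_state cat [::] rev Phi.
Proof.
by split=> //; [exact: catA|exact: cats0|exact: revK|exact: rev_cat].
Qed.

(** * Completeness through sequences *)
Section SequentialLimits.

(** The estimates below concern sequences; these definitions serve to translate
    completeness, which is stated with filters, into their terms. *)
Definition seq_cauchy (K : numFieldType) (V : normedModType K) (u : nat -> V) :=
  forall e : K, 0 < e -> exists N, forall m n, (N <= m)%N -> (N <= n)%N ->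
    `|u m - u n| <= e.
Definition seq_lim (K : numFieldType) (V : normedModType K) (u : nat -> V) (l : V) :=
  forall e : K, 0 < e -> exists N, forall n, (N <= n)%N -> `|u n - l| <= e.

Lemma seq_complete (K : numFieldType) (V : completeNormedModType K) (u : nat -> V) :
  seq_cauchy u -> exists l, seq_lim u l.
Proof.
move=> cu.
have : cauchy (u @ \oo).
  apply: cauchy_exP => e e0.
  have e2 : 0 < e / 2 by rewrite divr_gt0.
  have [N hN] := cu _ e2; exists (u N); exists N => // n /= Nn.
  rewrite -ball_normE /ball_ /=; apply: le_lt_trans (hN N n (leqnn _) Nn) _.
  by rewrite ltr_pdivrMr // mulr_natr mulr2n ltrDl.
move=> /cauchy_cvg cvu; exists (lim (u @ \oo)) => e e0.
have /cvgrPdist_le /(_ e e0) [N _ hN] := cvu.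
by exists N => n Nn; rewrite distrC; apply: hN.
Qed.

(** A Cauchy filter contains balls of radius [1 / n.+1], whose centres form a
    Cauchy sequence with the same limit. *)
Lemma complete_of_seq (R : realType) (V : normedModType R[i]) :
  (forall u : nat -> V, seq_cauchy u -> exists l, seq_lim u l) ->
  forall F : set_system V, ProperFilter F -> cauchy F -> cvg F.
Proof.
move=> hV F FF /cauchyP cF.
have pos (n : nat) : (0 : R[i]) < (n.+1%:R)^-1 by rewrite invr_gt0 ltr0n.
have := fun n => cF _ (pos n).
move=> /choice[x hx].
have half (e : R[i]) : 0 < e -> exists N : nat, forall n, (N <= n)%N -> n.+1%:R^-1 <= e.
  move=> /Cgt0P[ee re1].
  exists (Num.trunc (complex.Re e)^-1) => n hn.
  have : (complex.Re e)^-1 < n.+1%:R.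
    by apply: lt_le_trans (truncnS_gt _) _; rewrite ler_nat.
  move=> /ltW h1.
  have -> : (n.+1%:R^-1 : R[i]) = (n.+1%:R^-1)%:C by rewrite rmorphV ?unitfE ?pnatr_eq0 // rmorph_nat.
  by rewrite ee lecR -[X in _ <= X]invrK lef_pV2 // posrE ?invr_gt0 ?ltr0n.
have cx : seq_cauchy x.
  move=> e e0; have e2 : 0 < e / 2 by rewrite divr_gt0.
  have [N hN] := half _ e2; exists N => m n Nm Nn.
  have [y [h1 h2]] := filter_ex (filterI (hx m) (hx n)).
  rewrite -(subrKA y) (splitr e); apply: (le_trans (ler_normD _ _)).
  move: h1 h2; rewrite -!ball_normE /ball_ /= => /ltW h1 /ltW h2.
  by rewrite lerD // 1?(distrC y); [apply: (le_trans h1); exact: hN|apply: (le_trans h2); exact: hN].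
have [l hl] := hV x cx; apply/cvg_ex; exists l.
apply/cvgrPdist_le => e e0; have e2 : 0 < e / 2 by rewrite divr_gt0.
have [N hN] := half _ e2; have [M hM] := hl _ e2.
pose n := maxn N M.
apply: filterS (hx n) => y; rewrite -ball_normE /ball_ /= => /ltW h1.
rewrite -(subrKA (x n)) (splitr e); apply: (le_trans (ler_normD _ _)).
rewrite lerD //; first by rewrite distrC hM // leq_maxr.
by apply: (le_trans h1); apply: hN; rewrite leq_maxl.
Qed.
End SequentialLimits.

(** * The reproducing kernel Hilbert space *)
Section ReproducingKernelSpace.
Variables (R : realType) (W : Type) (K : W -> W -> R[i]) (pK : pdkernel K).
Local Notation C := R[i].
Local Notation q := (qf K).
Implicit Types (h k : W -> C) (s t : seq (C * W)).
Let hK := pK.1.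

(** If [h] is the pairing with a vector [x], then [rk_val h s] is
    [|x|^2 - |x - s|^2], so its supremum over [s] is the squared norm of [x].
    The space consists of the functions [h] for which this supremum is finite;
    the norm of a function is thus defined before any inner product. *)
Definition rk_val h s : R := 2 * complex.Re (ev h s) - q s.
Definition rk_bounded h (A : R) := forall s, rk_val h s <= A.

Lemma rk_bounded_ge0 h A : rk_bounded h A -> 0 <= A.
Proof. by move=> /(_ [::]); rewrite /rk_val /qf !ev_nil /= mulr0 subrr. Qed.

Lemma rk_boundedP h A : rk_bounded h A -> forall s, nsq (ev h s) <= A * q s.
Proof.
move=> hA s; apply: quadratic_CS; rewrite ?(qf_ge0 pK) ?(rk_bounded_ge0 hA) // => l.
have := hA (sc (- l) s); rewrite /rk_val ev_sc (qf_sc pK) rmorphN mulNr ReN.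
have -> : nsq (- l) = nsq l by rewrite /nsq !Csimpl !sqrrN.
lra.
Qed.

Lemma le_2Re (A b : R) (z : C) : 0 <= A -> 0 <= b -> nsq z <= A * b ->
  2 * complex.Re z - b <= A.
Proof.
move=> A0 b0 h.
have h2 : complex.Re z ^+ 2 <= A * b by apply: le_trans h; rewrite lerDl sqr_ge0.
rewrite lerBlDr leNgt; apply/negP => h3.
have : 0 < (2 * complex.Re z - (A + b)) * (2 * complex.Re z + (A + b)).
  by apply: mulr_gt0; lra.
have := sqr_ge0 (A - b); nra.
Qed.

Lemma rk_bounded_nsq h A : 0 <= A -> (forall s, nsq (ev h s) <= A * q s) ->
  rk_bounded h A.
Proof. by move=> A0 hA s; apply: le_2Re; rewrite ?(qf_ge0 pK). Qed.

Definition rk_in h : bool := `[< exists A, rk_bounded h A >].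
Definition rk_Q h : R := sup [set rk_val h s | s in setT].

Lemma rk_has_sup h : rk_in h -> has_sup [set rk_val h s | s in setT].
Proof.
move=> /asboolP[A hA]; split; first by exists (rk_val h [::]), [::].
by exists A => _ [s _ <-].
Qed.

Lemma rk_QP h : rk_in h -> rk_bounded h (rk_Q h).
Proof.
by move=> /rk_has_sup hs s; apply: (sup_upper_bound hs); exists s.
Qed.
Lemma rk_Q_le h A : rk_bounded h A -> rk_Q h <= A.
Proof.
by move=> hA; apply: ge_sup; [exists (rk_val h [::]), [::]|move=> _ [s _ <-]].
Qed.
Lemma rk_bounded_in h A : rk_bounded h A -> rk_in h.
Proof. by move=> hA; apply/asboolP; exists A. Qed.
Lemma rk_Q_ge0 h : rk_in h -> 0 <= rk_Q h.
Proof. by move/rk_QP/rk_bounded_ge0. Qed.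
Lemma rk_Q_adherent h e : rk_in h -> 0 < e -> exists s, rk_Q h - e < rk_val h s.
Proof.
by move=> hh e0; have [_ [s _ <-]] := sup_adherent e0 (rk_has_sup hh); exists s.
Qed.

Lemma rk_Re_le h s : rk_in h -> complex.Re (ev h s) <= Num.sqrt (rk_Q h) * Num.sqrt (q s).
Proof.
move=> hh; have := rk_boundedP (rk_QP hh) s => h1.
have : complex.Re (ev h s) ^+ 2 <= rk_Q h * q s.
  by apply: le_trans h1; rewrite lerDl sqr_ge0.
rewrite -sqrtrM ?rk_Q_ge0 // -ler_sqrt ?mulr_ge0 ?(qf_ge0 pK) ?rk_Q_ge0 //.
by rewrite sqrtr_sqr; apply: le_trans; exact: ler_norm.
Qed.

Lemma rk_boundedD h k : rk_in h -> rk_in k ->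
  rk_bounded (h + k) ((Num.sqrt (rk_Q h) + Num.sqrt (rk_Q k)) ^+ 2).
Proof.
move=> hh kk s; rewrite /rk_val evD ReD.
have := rk_Re_le s hh; have := rk_Re_le s kk.
have : q s = Num.sqrt (q s) ^+ 2 by rewrite sqr_sqrtr // (qf_ge0 pK).
set r := Num.sqrt (q s); set a := Num.sqrt (rk_Q h); set b := Num.sqrt (rk_Q k).
move=> ->; have := sqr_ge0 (a + b - r); nra.
Qed.

Lemma rk_boundedZ c h : rk_in h -> rk_bounded (c *: h) (nsq c * rk_Q h).
Proof.
move=> hh; apply: rk_bounded_nsq => [|s]; first by rewrite mulr_ge0 ?nsq_ge0 ?rk_Q_ge0.
by rewrite evZ nsqM -mulrA ler_wpM2l ?nsq_ge0 //; apply: rk_boundedP; exact: rk_QP.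
Qed.

Lemma rk_bounded_vec s : rk_bounded (vec K s) (q s).
Proof.
by apply: rk_bounded_nsq => [|t]; rewrite ?(qf_ge0 pK) //; exact: form_CS.
Qed.

(** The argument carries positivity of [K] into the type: closure under linear
    combinations depends on it. *)
Definition rk_mem (_ : pdkernel K) : {pred W -> C} := rk_in.

Lemma rk_submod : submod_closed (rk_mem pK).
Proof.
rewrite /rk_mem; split=> [|c h k hh kk]; rewrite -topredE /=.
  by rewrite -(vec_nil K); apply: rk_bounded_in (rk_bounded_vec _).
by apply: rk_bounded_in (rk_boundedD (rk_bounded_in (rk_boundedZ c hh)) kk).
Qed.

Record rkhs := Rkhs { rkf :> W -> C; rkf_in : rkf \in rk_mem pK }.
HB.instance Definition _ := [isSub for rkf].
HB.instance Definition _ := [Choice of rkhs by <:].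
HB.instance Definition _ := GRing.isSubmodClosed.Build _ _ (rk_mem pK) rk_submod.
HB.instance Definition _ := [SubChoice_isSubLmodule of rkhs by <:].

Lemma rkfD (x y : rkhs) : rkf (x + y) = rkf x + rkf y. Proof. by []. Qed.
Lemma rkfZ c (x : rkhs) : rkf (c *: x) = c *: rkf x. Proof. by []. Qed.
Lemma rkfN (x : rkhs) : rkf (- x) = - rkf x. Proof. by []. Qed.
Lemma rkf0 : rkf 0 = 0. Proof. by []. Qed.

Lemma rkhsP (x y : rkhs) : (forall w, x w = y w) -> x = y.
Proof. by move=> h; apply/val_inj/funext. Qed.

Definition rQ (x : rkhs) := rk_Q x.
Definition rnorm (x : rkhs) : C := (Num.sqrt (rQ x))%:C.

Lemma rQ_ge0 (x : rkhs) : 0 <= rQ x. Proof. exact: rk_Q_ge0 (rkf_in x). Qed.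
Lemma rQP (x : rkhs) s : nsq (ev x s) <= rQ x * q s.
Proof. exact: rk_boundedP (rk_QP (rkf_in x)) s. Qed.
Lemma rQ_le (x : rkhs) A : 0 <= A -> (forall s, nsq (ev x s) <= A * q s) -> rQ x <= A.
Proof. by move=> A0 h; apply/rk_Q_le/rk_bounded_nsq. Qed.

Lemma rnormD (x y : rkhs) : rnorm (x + y) <= rnorm x + rnorm y.
Proof.
rewrite /rnorm -rmorphD lecR /= -[leRHS]ger0_norm ?addr_ge0 ?sqrtr_ge0 //.
rewrite -sqrtr_sqr ler_sqrt ?sqr_ge0 //.
exact/rk_Q_le/rk_boundedD/rkf_in/rkf_in.
Qed.

Lemma rQZ c (x : rkhs) : rQ (c *: x) = nsq c * rQ x.
Proof.
have le d (y : rkhs) : rQ (d *: y) <= nsq d * rQ y by apply/rk_Q_le/rk_boundedZ/rkf_in.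
apply/le_anti; rewrite le /=.
have [->|c0] := eqVneq c 0; first by rewrite /nsq /= expr0n addr0 mul0r rQ_ge0.
have := le c^-1 (c *: x); rewrite scalerA mulVf // scale1r => h.
apply: (le_trans (ler_wpM2l (nsq_ge0 c) h)).
by rewrite mulrA -nsqM divff // /nsq /= expr0n expr1n addr0 mul1r.
Qed.

Lemma rnormZ c (x : rkhs) : rnorm (c *: x) = `|c| * rnorm x.
Proof. by rewrite /rnorm rQZ sqrtrM ?nsq_ge0 // normC_nsq -rmorphM. Qed.

Lemma rnorm0_eq0 (x : rkhs) : rnorm x = 0 -> x = 0.
Proof.
move=> /(congr1 (@complex.Re R)) /= /eqP; rewrite sqrtr_eq0 => h.
apply: rkhsP => w; have := rQP x [:: (1, w)].
rewrite ev1 rmorph1 mul1r => h2; apply: nsq_eq0; apply/le_anti.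
rewrite nsq_ge0 andbT; apply: (le_trans h2).
by rewrite mulr_le0_ge0 // (qf_ge0 pK).
Qed.

HB.instance Definition _ := Lmodule_isNormed.Build C rkhs rnormD rnormZ rnorm0_eq0.

Lemma rkhs_normE (x : rkhs) : `|x| = (Num.sqrt (rQ x))%:C. Proof. by []. Qed.

Definition kv s : rkhs := Rkhs (rk_bounded_in (rk_bounded_vec s)).
Definition rN (x : rkhs) : R := Num.sqrt (rQ x).

Lemma kv_cat s t : kv (s ++ t) = kv s + kv t.
Proof. by apply/val_inj/vec_cat. Qed.
Lemma kv_sc c s : kv (sc c s) = c *: kv s.
Proof. by apply/val_inj/vec_sc. Qed.
Lemma kv_nil : kv [::] = 0.
Proof. by apply/val_inj/vec_nil. Qed.

Lemma rN_ge0 x : 0 <= rN x. Proof. exact: sqrtr_ge0. Qed.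
Lemma sqr_rN x : rN x ^+ 2 = rQ x. Proof. by rewrite sqr_sqrtr // rQ_ge0. Qed.
Lemma rN_D x y : rN (x + y) <= rN x + rN y.
Proof. by have := rnormD x y; rewrite /rnorm -rmorphD lecR. Qed.
Lemma rN_N x : rN (- x) = rN x.
Proof. by rewrite -scaleN1r /rN rQZ /nsq !Csimpl /= oppr0 sqrrN expr0n expr1n addr0 mul1r. Qed.
Lemma rk_norm_rN (x : rkhs) : `|x| = (rN x)%:C. Proof. by []. Qed.

Lemma rQ_addv_le x s : rQ (x + kv s) <= rQ x + 2 * complex.Re (ev x s) + q s.
Proof.
apply: rk_Q_le => t.
have := rk_QP (rkf_in x) (t ++ sc (-1) s); rewrite -/(rQ x) /rk_val rkfD !evD.
rewrite qf_cat // qf_sc // !ev_cat !ev_sc [ev (vec K t) s]form_herm //.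
rewrite -[vec K s]/(rkf (kv s)) /nsq !Csimpl /=; lra.
Qed.

Lemma q_form s : complex.Re (ev (kv s) s) = q s. Proof. by []. Qed.

(** The expected expansion of a square, from the inequality applied once with
    [s] and once with [- s]. *)
Lemma rQ_addv x s : rQ (x + kv s) = rQ x + 2 * complex.Re (ev x s) + q s.
Proof.
apply/le_anti; rewrite rQ_addv_le /=.
have := rQ_addv_le (x + kv s) (sc (-1) s).
rewrite kv_sc scaleN1r addrK qf_sc // rkfD evD !ev_sc !Csimpl q_form /nsq /=.
lra.
Qed.

Lemma rQ_kv s : rQ (kv s) = q s.
Proof.
have := rQ_addv 0 s; rewrite add0r rkf0.
have -> : ev (0 : W -> C) s = 0 by rewrite -(scale0r (0 : W -> C)) evZ mul0r.
have -> : rQ 0 = 0 by rewrite -(scale0r 0) rQZ /nsq /= expr0n addr0 mul0r.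
by rewrite /= mulr0 !add0r.
Qed.

(** A near maximizer in the definition of [rQ x] is automatically close to
    [x]: that is how density of the kernel vectors comes for free. *)
Lemma kv_dense x (e : R) : 0 < e -> exists s, rN (x - kv s) <= e.
Proof.
move=> e0; have [s hs] := rk_Q_adherent (rkf_in x) (exprn_gt0 2 e0).
exists s; rewrite -[leRHS]gtr0_norm // -sqrtr_sqr ler_sqrt ?sqr_ge0 //.
rewrite -scaleN1r -kv_sc rQ_addv ev_sc qf_sc //.
move: hs; rewrite -/(rQ x) /rk_val !Csimpl /nsq /=; lra.
Qed.

(** The real inner product, by polarization of the squared norm. Its additivity
    is checked against kernel vectors, where it is evaluation, and extended by
    density. *)
Definition rB (x y : rkhs) : R := (rQ (x + y) - rQ x - rQ y) / 2.

Lemma rB_sym x y : rB x y = rB y x.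
Proof. by rewrite /rB (addrC x) addrAC. Qed.

Lemma rB_le x y : `|rB x y| <= rN x * rN y.
Proof.
have h1 := rN_D x y.
have h2 : rN x <= rN (x + y) + rN y by have := rN_D (x + y) (- y); rewrite addrK rN_N.
have h3 : rN y <= rN (x + y) + rN x.
  by have := rN_D (x + y) (- x); rewrite (addrC x) addrK rN_N.
rewrite /rB -!sqr_rN ler_norml.
have := rN_ge0 x; have := rN_ge0 y; have := rN_ge0 (x + y).
set a := rN x in h1 h2 h3 *; set b := rN y in h1 h2 h3 *.
set c := rN _ in h1 h2 h3 * => c0 b0 a0.
by apply/andP; split; nra.
Qed.

Lemma rB_kv x s : rB x (kv s) = complex.Re (ev x s).
Proof. by rewrite /rB rQ_addv rQ_kv; field. Qed.

Lemma rB_approx x y s : `|rB x y - complex.Re (ev x s)| <= rN x * rN (y - kv s).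
Proof.
apply: le_trans (rB_le _ _); rewrite le_eqVlt; apply/orP; left; apply/eqP.
congr `|_|.
have [d ->] : exists d, y = d + kv s by exists (y - kv s); rewrite subrK.
by rewrite addrK /rB addrA !rQ_addv rkfD evD ReD; field.
Qed.

Lemma eq0_small (a M : R) : (forall e, 0 < e -> `|a| <= M * e) -> a = 0.
Proof.
move=> h; apply/eqP; rewrite -normr_le0; apply: (@le_small _ _ _ M) => e e0.
by rewrite add0r; exact: h.
Qed.

Lemma rBD x x' y : rB (x + x') y = rB x y + rB x' y.
Proof.
apply/eqP; rewrite -subr_eq0; apply/eqP.
apply: (@eq0_small _ (rN (x + x') + rN x + rN x')) => e e0.
have [s hs] := kv_dense y e0.
have := rB_approx (x + x') y s; have := rB_approx x y s; have := rB_approx x' y s.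
rewrite rkfD evD ReD.
have := rN_ge0 x; have := rN_ge0 x'; have := rN_ge0 (x + x').
set d := rN (y - _) in hs *.
set a := rN x; set b := rN x'; set c := rN _ => c0 b0 a0.
have ha : a * d <= a * e by rewrite ler_wpM2l.
have hb : b * d <= b * e by rewrite ler_wpM2l.
have hc : c * d <= c * e by rewrite ler_wpM2l.
rewrite !ler_norml => /andP[? ?] /andP[? ?] /andP[? ?].
by apply/andP; split; lra.
Qed.

Lemma rBZ (r : R) x y : rB (r%:C *: x) y = r * rB x y.
Proof.
apply/eqP; rewrite -subr_eq0; apply/eqP.
apply: (@eq0_small _ (rN (r%:C *: x) + `|r| * rN x)) => e e0.
have [s hs] := kv_dense y e0.
have := rB_approx (r%:C *: x) y s; have := rB_approx x y s.
rewrite rkfZ evZ !Csimpl /= mul0r subr0.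
have := rN_ge0 x; have := rN_ge0 (r%:C *: x).
set d := rN (y - _) in hs *.
set a := rN x; set c := rN _ => c0 a0 h1 h2.
have ha : a * d <= a * e by rewrite ler_wpM2l.
have hc : c * d <= c * e by rewrite ler_wpM2l.
have h3 : `|r * (rB x y - complex.Re (ev x s))| <= `|r| * (a * e).
  by rewrite normrM ler_wpM2l // (le_trans h1).
rewrite -(subrKA (r * complex.Re (ev x s))) -mulrBr.
apply: (le_trans (ler_normD _ _)); rewrite mulrDl lerD //.
  exact: le_trans h2 hc.
by rewrite -normrN mulrBr opprB -mulrBr mulrA in h3 *.
Qed.

Lemma scale_ii (x : rkhs) : 'i *: ('i *: x) = - x.
Proof. by rewrite scalerA -scaleN1r; congr (_ *: _); apply: Ceq; rewrite !Csimpl /=; lra. Qed.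

Lemma rBN x y : rB (- x) y = - rB x y.
Proof. by have := rBZ (-1) x y; rewrite mulN1r => <-; rewrite rmorphN scaleN1r. Qed.

Lemma nsq_i : nsq ('i : C) = 1.
Proof. by rewrite /nsq /= expr0n expr1n add0r. Qed.

Lemma rB_ii x y : rB ('i *: x) ('i *: y) = rB x y.
Proof. by rewrite /rB -scalerDr !rQZ nsq_i !mul1r. Qed.

Lemma rB_i x y : rB ('i *: x) y = - rB x ('i *: y).
Proof. by rewrite -(rB_ii ('i *: x)) scale_ii rBN. Qed.

(** Since [|i x| = |x|], the real form determines a Hermitian one. *)
Definition rdot (x y : rkhs) : C := (rB x y) +i* (rB x ('i *: y)).

Lemma rdotC x y : rdot x y = (rdot y x)^*.
Proof.
by rewrite /rdot; apply: Ceq; rewrite /= rB_sym // rB_i.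
Qed.

Lemma rdotDl x x' y : rdot (x + x') y = rdot x y + rdot x' y.
Proof. by apply: Ceq; rewrite ?Csimpl /= rBD. Qed.

Lemma rdotZl c x y : rdot (c *: x) y = c * rdot x y.
Proof.
have -> : c *: x = (complex.Re c)%:C *: x + (complex.Im c)%:C *: ('i *: x).
  rewrite scalerA -scalerDl; congr (_ *: _); apply: Ceq; rewrite !Csimpl /=; lra.
rewrite rdotDl; apply: Ceq; rewrite !Csimpl /= !rBZ !rB_i ?scale_ii.
  by rewrite mulrN.
by rewrite [rB x (- y)]rB_sym rBN [rB y x]rB_sym opprK.
Qed.

Lemma rdotZr c x y : rdot x (c *: y) = c^* * rdot x y.
Proof. by rewrite rdotC rdotZl cjM -rdotC. Qed.

Lemma rdot_kv x s : rdot x (kv s) = ev x s.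
Proof.
apply: Ceq; rewrite /= ?rB_kv // -kv_sc rB_kv ev_sc !Csimpl /=; lra.
Qed.

Lemma rdotxx x : rdot x x = (rQ x)%:C.
Proof.
apply: Ceq; rewrite /= /rB.
  have -> : x + x = (1 + 1 : C) *: x by rewrite scalerDl scale1r.
  by rewrite rQZ /nsq !Csimpl /=; field.
have -> : x + 'i *: x = (1 + 'i) *: x by rewrite scalerDl scale1r.
by rewrite !rQZ nsq_i /nsq !Csimpl /=; field.
Qed.

Lemma rdot_gt0 x : x != 0 -> 0 < rdot x x.
Proof.
move=> x0; rewrite rdotxx -[0]/(0%:C) ltcR lt_def rQ_ge0 andbT.
apply: contra x0 => /eqP h; apply/eqP/rnorm0_eq0.
by rewrite /rnorm h sqrtr0.
Qed.

Lemma rdotBl x x' y : rdot (x - x') y = rdot x y - rdot x' y.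
Proof. by rewrite rdotDl -scaleN1r rdotZl mulN1r. Qed.
Lemma rdotBr x y y' : rdot x (y - y') = rdot x y - rdot x y'.
Proof. by rewrite rdotC rdotBl cjD cjN -!rdotC. Qed.
HB.instance Definition _ := isBilinear.Build C rkhs rkhs C *%R (Num.conj \; *%R) rdot
  (fun y x x' => rdotBl x x' y) rdotBr (fun y c x => rdotZl c x y) (fun x c y => rdotZr c x y).
Lemma rdot_herm x y : rdot x y = (-1) ^+ false * Num.conj (rdot y x).
Proof. by rewrite expr0 mul1r rdotC. Qed.
HB.instance Definition _ := isHermitianSesquilinear.Build C rkhs false Num.conj rdot rdot_herm.
HB.instance Definition _ := isDotProduct.Build C rkhs rdot rdot_gt0.
Definition rk_dot : {dot rkhs for @Num.conj C} := rdot.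
End ReproducingKernelSpace.

Section RkhsComplete.
Variables (R : realType) (W : Type) (K : W -> W -> R[i]) (pK : pdkernel K).
Local Notation C := R[i].
Local Notation q := (qf K).
Local Notation H := (rkhs pK).

Definition clim (z : nat -> C) (l : C) := forall e : R, 0 < e ->
  exists N, forall n, (N <= n)%N -> nsq (z n - l) <= e.

Lemma nsqD (x y : C) : nsq (x + y) <= 2 * nsq x + 2 * nsq y.
Proof.
rewrite /nsq !Csimpl.
set a := complex.Re x; set b := complex.Im x; set c := complex.Re y; set d := complex.Im y.
have := sqr_ge0 (a - c); have := sqr_ge0 (b - d); lra.
Qed.

Lemma clim_cauchy (z : nat -> C) :
  (forall e : R, 0 < e -> exists N, forall m n, (N <= m)%N -> (N <= n)%N ->
    nsq (z m - z n) <= e) -> exists l, clim z l.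
Proof.
move=> hz.
have part (f : C -> R) : (forall x, f x ^+ 2 <= nsq x) ->
    (forall x y, f (x - y) = f x - f y) ->
    exists l, forall e : R, 0 < e -> exists N, forall n, (N <= n)%N ->
      `|f (z n) - l| <= e.
  move=> fle fB; apply: seq_complete => e e0.
  have [N hN] := hz _ (exprn_gt0 2 e0); exists N => m n Nm Nn.
  rewrite -[leRHS]gtr0_norm // -fB -!sqrtr_sqr ler_sqrt ?sqr_ge0 //.
  exact: le_trans (fle _) (hN _ _ Nm Nn).
have [|x y|a ha] := part (@complex.Re R); first by move=> x; rewrite lerDl sqr_ge0.
  by rewrite ReD ReN.
have [|x y|b hb] := part (@complex.Im R); first by move=> x; rewrite lerDr sqr_ge0.
  by rewrite ImD ImN.
exists (a +i* b) => e e0.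
have e1 : 0 < Num.sqrt (e / 2) by rewrite sqrtr_gt0 divr_gt0.
have [N1 h1] := ha _ e1; have [N2 h2] := hb _ e1.
exists (maxn N1 N2) => n; rewrite geq_max => /andP[n1 n2].
have sq (x : R) : `|x| <= Num.sqrt (e / 2) -> x ^+ 2 <= e / 2.
  by rewrite -sqrtr_sqr ler_sqrt // divr_ge0 // ltW.
have /sq := h1 _ n1; have /sq := h2 _ n2; rewrite /nsq !Csimpl /=; lra.
Qed.

Lemma climD (z z' : nat -> C) l l' : clim z l -> clim z' l' ->
  clim (fun n => z n + z' n) (l + l').
Proof.
move=> h h' e e0; have e4 : 0 < e / 4 by rewrite divr_gt0.
have [N1 h1] := h _ e4; have [N2 h2] := h' _ e4.
exists (maxn N1 N2) => n; rewrite geq_max => /andP[/h1 n1 /h2 n2].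
rewrite opprD addrACA; have := nsqD (z n - l) (z' n - l'); lra.
Qed.

Lemma climZ c (z : nat -> C) l : clim z l -> clim (fun n => c * z n) (c * l).
Proof.
move=> h e e0.
have c0 : 0 < nsq c + 1 by rewrite ltr_wpDl ?nsq_ge0.
have [N hN] := h _ (divr_gt0 e0 c0); exists N => n /hN h1.
rewrite -mulrBr nsqM.
have : nsq (z n - l) * (nsq c + 1) <= e by rewrite -ler_pdivlMr.
have := nsq_ge0 (z n - l); have := nsq_ge0 c; nra.
Qed.

Lemma clim_ev (u : nat -> H) (h : W -> C) s :
  (forall w, clim (fun n => u n w) (h w)) -> clim (fun n => ev (u n) s) (ev h s).
Proof.
move=> hw; elim: s => [|[c w] s ih].
  move=> e e0; exists 0%N => n _.
  by rewrite !ev_nil subrr /nsq /= expr0n addr0 ltW.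
have E f : ev f ((c, w) :: s) = c^* * f w + ev f s by rewrite /ev big_cons.
rewrite E; under eq_fun do rewrite E.
exact: climD (climZ _ (hw w)) ih.
Qed.

(** A Cauchy sequence converges pointwise, because evaluations are bounded;
    the Cauchy estimates pass to the pointwise limit [h], which shows both that
    [h] belongs to the space and that convergence holds in norm. *)
Lemma rkhs_seq_complete (u : nat -> H) : seq_cauchy u -> exists l, seq_lim u l.
Proof.
move=> cu.
have cq (e : R) : 0 < e -> exists N, forall m n, (N <= m)%N -> (N <= n)%N ->
    rQ (u m - u n) <= e.
  move=> e0; have e1 : (0 : C) < (Num.sqrt e)%:C by rewrite -[0]/(0%:C) ltcR sqrtr_gt0.
  have [N hN] := cu _ e1; exists N => m n /hN h /h.
  by rewrite rkhs_normE lecR ler_sqrt // ltW.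
have rd (x y : H) s : ev x s - ev y s = ev (x - y) s.
  by rewrite rkfD rkfN evD evN.
have : forall w, exists l, clim (fun n => u n w) l.
  move=> w; apply: clim_cauchy => e e0.
  have k0 : 0 < q [:: (1, w)] + 1 by rewrite ltr_wpDl ?(qf_ge0 pK).
  have [N hN] := cq _ (divr_gt0 e0 k0); exists N => m n Nm Nn.
  have := rQP (u m - u n) [:: (1, w)]; rewrite -rd !ev1 rmorph1 !mul1r.
  move=> h; apply: (le_trans h); have := hN _ _ Nm Nn.
  rewrite ler_pdivlMr //; have := qf_ge0 pK [:: (1, w)]; have := rQ_ge0 (u m - u n).
  nra.
move=> /choice[h hh].
have key (e : R) : 0 < e -> exists N, forall n s, (N <= n)%N ->
    nsq (ev (u n) s - ev h s) <= e * q s.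
  move=> e0; have e2 : 0 < e / 2 by rewrite divr_gt0.
  have [N hN] := cq _ e2; exists N => n s Nn.
  apply/ler_addgt0Pr => d d0; have d2 : 0 < d / 2 by rewrite divr_gt0.
  have [M hM] := clim_ev s hh d2.
  pose m := maxn N M.
  have h1 := hM m (leq_maxr _ _).
  have h2 := rQP (u n - u m) s.
  have h3 := hN n m Nn (leq_maxl _ _).
  rewrite -(subrKA (ev (u m) s)); apply: (le_trans (nsqD _ _)).
  rewrite rd.
  have : rQ (u n - u m) * q s <= e / 2 * q s by rewrite ler_wpM2r ?(qf_ge0 pK).
  lra.
have diff_in n N : (forall s, nsq (ev (u n) s - ev h s) <= N * q s) -> 0 <= N ->
    rk_bounded K (h - u n) N.
  move=> hN N0; apply: (rk_bounded_nsq pK) => // s.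
  rewrite evD evN; have := hN s.
  by congr (_ <= _); rewrite -opprB /nsq !ImN !ReN !sqrrN.
have h_in : rk_in K h.
  have [N hN] := key _ ltr01.
  have := diff_in N 1 (fun s => hN N s (leqnn N)) ler01 => b.
  have := rk_boundedD pK (rk_bounded_in b) (rkf_in (u N)).
  by rewrite subrK => /rk_bounded_in.
exists (Rkhs h_in : H) => e e0.
have [ee r0] := Cgt0P e0.
have [N hN] := key _ (exprn_gt0 2 r0); exists N => n Nn.
rewrite distrC ee rkhs_normE lecR -[leRHS]gtr0_norm // -sqrtr_sqr ler_sqrt ?sqr_ge0 //.
by apply: rk_Q_le; apply: diff_in => [s|]; rewrite ?sqr_ge0 // hN.
Qed.

Lemma rkhs_complete (F : set_system H) : ProperFilter F -> cauchy F -> cvg F.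
Proof. exact: complete_of_seq rkhs_seq_complete F. Qed.
HB.instance Definition _ := Uniform_isComplete.Build H rkhs_complete.

Lemma rk_hilbert_norm : hilbert_norm (rk_dot pK).
Proof.
move=> x; rewrite rkhs_normE -rmorphXn /= sqr_sqrtr ?rQ_ge0 //.
by rewrite -rdotxx.
Qed.
End RkhsComplete.

Section RkhsSeparable.
Variables (R : realType) (W : countType) (K : W -> W -> R[i]) (pK : pdkernel K).
Local Notation C := R[i].
Local Notation H := (rkhs pK).

Definition rat_comb (s : seq (rat * rat * W)) : seq (C * W) :=
  [seq ((ratr x.1.1 : R) +i* ratr x.1.2, x.2) | x <- s].

Lemma rat_comb_dense (s : seq (C * W)) (e : R) : 0 < e ->
  exists s', rN (kv pK s - kv pK (rat_comb s')) <= e.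
Proof.
elim: s e => [|[c w] s ih] e e0.
  exists [::]; rewrite kv_nil subrr /rN -(scale0r 0) rQZ /nsq /= expr0n addr0.
  by rewrite mul0r sqrtr0 ltW.
have e2 : 0 < e / 2 by rewrite divr_gt0.
have [s' hs'] := ih _ e2.
pose d := Num.sqrt (qf K [:: (1, w)]).
have d0 : 0 <= d by exact: sqrtr_ge0.
pose eta := e / 4 / (d + 1).
have eta0 : 0 < eta by rewrite !divr_gt0 // ltr_wpDl.
have approx (x : R) : exists r : rat, `|x - ratr r| <= eta.
  have : x - eta < x + eta by lra.
  move=> /rat_in_itvoo[r]; rewrite in_itv /= => /andP[h1 h2]; exists r.
  rewrite ler_norml; apply/andP; split; lra.
have [a ha] := approx (complex.Re c); have [b hb] := approx (complex.Im c).
exists ((a, b, w) :: s').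
have E x t : kv pK ((x, w) :: t) = x *: kv pK [:: (1, w)] + kv pK t.
  by rewrite -cat1s kv_cat -kv_sc /sc /= mulr1.
have -> : kv pK (rat_comb ((a, b, w) :: s')) =
    ((ratr a : R) +i* ratr b) *: kv pK [:: (1, w)] + kv pK (rat_comb s').
  exact: E.
rewrite E opprD addrACA -scalerBl; apply: (le_trans (rN_D _ _)).
rewrite (splitr e) lerD //.
rewrite /rN rQZ rQ_kv sqrtrM ?nsq_ge0 // -/d.
set z := (_ - _ : C).
have : Num.sqrt (nsq z) <= 2 * eta.
  have t0 : 0 < 2 * eta by rewrite mulr_gt0.
  rewrite -[leRHS]gtr0_norm // -sqrtr_sqr ler_sqrt ?sqr_ge0 //.
  rewrite /nsq !Csimpl /=.
  have sq (x : R) : `|x| <= eta -> x ^+ 2 <= eta ^+ 2.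
    by rewrite -[X in _ <= X -> _]gtr0_norm // -!sqrtr_sqr ler_sqrt ?sqr_ge0.
  have := sq _ ha; have := sq _ hb; have := sqr_ge0 eta; lra.
have -> : e / 2 = 2 * eta * (d + 1).
  by rewrite /eta; field; rewrite lt0r_neq0 // ltr_wpDl.
have := sqrtr_ge0 (nsq z); nra.
Qed.

Lemma rk_separable : separable_hilbert H.
Proof.
exists [set kv pK (rat_comb s) | s in setT].
  exact: card_le_trans (card_image_le _ _) (countableP _).
move=> O [x Ox] oO.
have : nbhs x O by apply: open_nbhs_nbhs.
move=> /nbhs_ballP[e /= e0 eO].
have [ee r0] := Cgt0P e0.
have e4 : 0 < complex.Re e / 4 by rewrite divr_gt0.
have [s hs] := kv_dense x e4; have [s' hs'] := rat_comb_dense s e4.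
exists (kv pK (rat_comb s')); split; last by exists s'.
apply: eO; rewrite -ball_normE /ball_ /= ee rk_norm_rN ltcR.
rewrite -(subrKA (kv pK s)); apply: (le_lt_trans (rN_D _ _)); lra.
Qed.
End RkhsSeparable.

(** * Operators on a Hilbert space *)
Section HilbertSpaces.
Variables (R : realType) (H : completeNormedModType R[i]).
Variable dot : {dot H for @Num.conj R[i]}.
Hypothesis hn : hilbert_norm dot.
Local Notation C := R[i].
Implicit Types (x y z : H) (S T Z : H -> H) (c : C).

Definition nm x : R := complex.Re `|x|.
Lemma nmE x : `|x| = (nm x)%:C.
Proof. by have [] := Cge0P (normr_ge0 x). Qed.
Lemma nm_ge0 x : 0 <= nm x.
Proof. by have [] := Cge0P (normr_ge0 x). Qed.
Lemma nmD x y : nm (x + y) <= nm x + nm y.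
Proof. by have := ler_normD x y; rewrite !nmE -rmorphD lecR. Qed.
Lemma nmN x : nm (- x) = nm x.
Proof. by rewrite /nm normrN. Qed.
Lemma nmB x y : nm (x - y) = nm (y - x).
Proof. by rewrite /nm distrC. Qed.
Lemma nm0 : nm 0 = 0. Proof. by rewrite /nm normr0. Qed.
Lemma nm_eq0 x : nm x = 0 -> x = 0.
Proof. by move=> h; apply/eqP; rewrite -normr_eq0 nmE h. Qed.
Lemma nmZ c x : nm (c *: x) = Num.sqrt (nsq c) * nm x.
Proof. by rewrite /nm normrZ normC_nsq ReM /= mul0r subr0. Qed.
Lemma nm_dist z x y : nm (x - y) <= nm (x - z) + nm (z - y).
Proof. by have := nmD (x - z) (z - y); rewrite subrKA. Qed.

Lemma dDl x y z : dot (x + y) z = dot x z + dot y z.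
Proof. exact: linearDl. Qed.
Lemma dZl c x z : dot (c *: x) z = c * dot x z.
Proof. exact: linearZl_LR. Qed.
Lemma dC x y : dot x y = (dot y x)^*.
Proof. by have := hermitian_subproof (s := dot) x y; rewrite expr0 mul1r. Qed.
Lemma dDr x y z : dot x (y + z) = dot x y + dot x z.
Proof. by rewrite dC dDl cjD -!dC. Qed.
Lemma dZr c x z : dot x (c *: z) = c^* * dot x z.
Proof. by rewrite dC dZl cjM -dC. Qed.
Lemma dNl x z : dot (- x) z = - dot x z.
Proof. by rewrite -scaleN1r dZl mulN1r. Qed.
Lemma dNr x z : dot x (- z) = - dot x z.
Proof. by rewrite dC dNl cjN -dC. Qed.
Lemma d0l z : dot 0 z = 0.
Proof. by rewrite -(scale0r 0) dZl mul0r. Qed.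
Lemma d0r z : dot z 0 = 0.
Proof. by rewrite -(scale0r 0) dZr conjc0 mul0r. Qed.
Lemma dxx x : dot x x = (nm x ^+ 2)%:C.
Proof. by rewrite -hn nmE -rmorphXn. Qed.
Lemma nm_sqr x : nm x ^+ 2 = complex.Re (dot x x).
Proof. by rewrite dxx. Qed.

Lemma nm_sqrD x y : nm (x + y) ^+ 2 = nm x ^+ 2 + 2 * complex.Re (dot x y) + nm y ^+ 2.
Proof. by rewrite !nm_sqr !dDl !dDr [dot y x]dC !Csimpl; lra. Qed.
Lemma nm_sqrZ c x : nm (c *: x) ^+ 2 = nsq c * nm x ^+ 2.
Proof. by rewrite nmZ exprMn sqr_sqrtr ?nsq_ge0. Qed.

Lemma dot_CS x y : nsq (dot x y) <= nm x ^+ 2 * nm y ^+ 2.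
Proof.
apply: quadratic_CS; rewrite ?sqr_ge0 // => l.
by have := sqr_ge0 (nm (x + l *: y)); rewrite nm_sqrD dZr nm_sqrZ.
Qed.

Lemma dot_Re_le x y : `|complex.Re (dot x y)| <= nm x * nm y.
Proof.
rewrite -[leRHS]ger0_norm ?mulr_ge0 ?nm_ge0 // -!sqrtr_sqr ler_sqrt ?sqr_ge0 //.
by rewrite exprMn; apply: le_trans (dot_CS x y); rewrite lerDl sqr_ge0.
Qed.

Lemma dot_eq0 x : (forall y, dot x y = 0) -> x = 0.
Proof.
move=> h; apply: nm_eq0; apply/eqP; rewrite -sqrf_eq0 nm_sqr h.
exact: eqxx.
Qed.
Lemma dot_eq x y : (forall z, dot x z = dot y z) -> x = y.
Proof.
by move=> h; apply/eqP; rewrite -subr_eq0; apply/eqP/dot_eq0 => z; rewrite dDl dNl h subrr.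
Qed.
Lemma dot_eqr x y : (forall z, dot z x = dot z y) -> x = y.
Proof. by move=> h; apply: dot_eq => z; rewrite dC h -dC. Qed.

Definition slim (u : nat -> H) l := forall e : R, 0 < e ->
  exists N, forall n, (N <= n)%N -> nm (u n - l) <= e.

Lemma slim_cauchy (u : nat -> H) :
  (forall e : R, 0 < e -> exists N, forall m n, (N <= m)%N -> (m <= n)%N ->
     nm (u n - u m) <= e) -> exists l, slim u l.
Proof.
move=> hu.
have [|l hl] := @seq_complete _ H u.
  move=> e e0; have [ee r0] := Cgt0P e0.
  have [N hN] := hu _ r0; exists N => m n Nm Nn; rewrite ee nmE lecR.
  by have [mn|/ltnW nm'] := leqP m n; [rewrite nmB; exact: hN|exact: hN].
exists l => e e0; have e0' : (0 : C) < e%:C by rewrite -[0]/(0%:C) ltcR.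
by have [N hN] := hl _ e0'; exists N => n /hN; rewrite nmE lecR.
Qed.

Lemma slim_unique u l l' : slim u l -> slim u l' -> l = l'.
Proof.
move=> h h'; apply/eqP; rewrite -subr_eq0; apply/eqP/nm_eq0/le_anti.
rewrite nm_ge0 andbT; apply: (@le_small _ _ _ 2) => e e0.
have [N hN] := h _ e0; have [M hM] := h' _ e0.
have := nm_dist (u (maxn N M)) l l'; rewrite [nm (l - u _)]nmB.
have := hN _ (leq_maxl N M); have := hM _ (leq_maxr N M); lra.
Qed.

Lemma slim_cst x : slim (fun=> x) x.
Proof. by move=> e e0; exists 0%N => n _; rewrite subrr nm0 ltW. Qed.

Lemma slimD u v l l' : slim u l -> slim v l' -> slim (fun n => u n + v n) (l + l').
Proof.
move=> h h' e e0; have e2 : 0 < e / 2 by rewrite divr_gt0.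
have [N hN] := h _ e2; have [M hM] := h' _ e2.
exists (maxn N M) => n; rewrite geq_max => /andP[/hN a /hM b].
by rewrite opprD addrACA; apply: (le_trans (nmD _ _)); lra.
Qed.

Lemma slim_nm_le u l M : slim u l -> (forall n, nm (u n) <= M) -> nm l <= M.
Proof.
move=> h hM; apply: (@le_small _ _ _ 1) => e e0.
have [N hN] := h _ e0; have := hN N (leqnn _); have := hM N.
have := nmD (l - u N) (u N); rewrite subrK nmB; lra.
Qed.

Lemma bounded_opP T : bounded_op T ->
  exists2 M : R, 0 <= M & forall x, nm (T x) <= M * nm x.
Proof.
move=> [_ [k hk]]; exists `|complex.Re k| => // x.
have := hk x; rewrite !nmE lecE ReM /= mulr0 subr0 => /andP[_ h].
by apply: (le_trans h); rewrite ler_wpM2r ?nm_ge0 // ler_norm.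
Qed.

Lemma op_add T : linear T -> forall x y, T (x + y) = T x + T y.
Proof. by move=> lT x y; have := lT 1 x y; rewrite !scale1r. Qed.
Lemma op_0 T : linear T -> T 0 = 0.
Proof.
move=> lT; have := op_add lT 0 0; rewrite addr0 => /eqP.
by rewrite -subr_eq subrr eq_sym => /eqP.
Qed.
Lemma op_scale T : linear T -> forall c x, T (c *: x) = c *: T x.
Proof. by move=> lT c x; have := lT c x 0; rewrite (op_0 lT) !addr0. Qed.
Lemma op_opp T : linear T -> forall x, T (- x) = - T x.
Proof. by move=> lT x; rewrite -scaleN1r op_scale // scaleN1r. Qed.
Lemma op_sub T : linear T -> forall x y, T (x - y) = T x - T y.
Proof. by move=> lT x y; rewrite op_add // op_opp. Qed.

Lemma bounded_of T (M : R) : linear T -> (forall x, nm (T x) <= M * nm x) -> bounded_op T.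
Proof. by move=> lT hM; split=> //; exists M%:C => x; rewrite !nmE -rmorphM lecR. Qed.

Lemma slim_op T u l : bounded_op T -> slim u l -> slim (fun n => T (u n)) (T l).
Proof.
move=> bT h e e0; have [M M0 hM] := bounded_opP bT.
have M1 : 0 < M + 1 by rewrite ltr_wpDl.
have [N hN] := h _ (divr_gt0 e0 M1); exists N => n /hN.
rewrite ler_pdivlMr // -op_sub; last by case: bT.
have := hM (u n - l); have := nm_ge0 (u n - l); nra.
Qed.

Lemma adjoint_sym S T : adjoint_op dot S T -> adjoint_op dot T S.
Proof. by move=> h x y; rewrite dC -h -dC. Qed.

Lemma adjoint_unique S T T' : adjoint_op dot S T -> adjoint_op dot S T' -> T = T'.
Proof. by move=> h h'; apply/funext => y; apply: dot_eqr => x; rewrite -h. Qed.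

Lemma adjoint_comp S S' T T' : adjoint_op dot S S' -> adjoint_op dot T T' ->
  adjoint_op dot (S \o T) (T' \o S').
Proof. by move=> h h' x y; rewrite /= h h'. Qed.

Lemma half_half (x : H) : 2^-1 *: x + 2^-1 *: x = x.
Proof.
rewrite -scalerDl -[RHS]scale1r; congr (_ *: _).
by rewrite -mulr2n -[X in X *+ _]mulr1 -mulrnAr mulVf // pnatr_eq0.
Qed.

(** ** Orthogonal projections *)

Section Projection.
Variable K : set H.
Hypothesis K0 : K 0.
Hypothesis Klin : forall c x y, K x -> K y -> K (c *: x + y).
Hypothesis Kclosed : forall u l, slim u l -> (forall n, K (u n)) -> K l.

(** A minimizing sequence for the distance from [h] to [K] is Cauchy; at its
    limit, the first variation of the distance vanishes. *)
Lemma projection_exists h : exists2 k, K k & forall k', K k' -> dot (h - k) k' = 0.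
Proof.
pose D := [set nm (h - k) ^+ 2 | k in K].
have infD : has_inf D.
  by split; [exists (nm (h - 0) ^+ 2), 0|exists 0 => _ [k _ <-]; exact: sqr_ge0].
have dle k : K k -> inf D <= nm (h - k) ^+ 2.
  by move=> Kk; apply: (ge_inf infD.2); exists k.
have inv0 (n : nat) : 0 < (n.+1%:R^-1 : R) by rewrite invr_gt0 ltr0n.
have ch (n : nat) : exists k, K k /\ nm (h - k) ^+ 2 < inf D + n.+1%:R^-1.
  by have [_ [k Kk <-] lt] := inf_adherent (inv0 n) infD; exists k.
move/choice: ch => [u hu].
(* Parallelogram law: the midpoint of [u m] and [u n] lies in [K]. *)
have par m n : (m <= n)%N -> nm (u n - u m) ^+ 2 <= 4 * m.+1%:R^-1.
  move=> mn; have [Km lm] := hu m; have [Kn ln] := hu n.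
  have : K (2^-1 *: (u n + u m)).
    rewrite -[_ *: _]addr0; apply: Klin => //.
    by rewrite -[u n]scale1r; apply: Klin.
  move=> /dle; have -> : h - 2^-1 *: (u n + u m) = 2^-1 *: ((h - u n) + (h - u m)).
    by rewrite addrACA -opprD scalerBr [2^-1 *: (h + h)]scalerDr half_half.
  have nsq4 : nsq (2^-1 : C) = 4^-1.
    by rewrite C_half /nsq /= expr0n addr0; field.
  have -> : u n - u m = (h - u m) + - (h - u n) by rewrite opprB [RHS]addrC subrKA.
  rewrite nm_sqrZ; move: lm ln; set a := h - u m; set b := h - u n => lm ln.
  rewrite (nm_sqrD b a) (nm_sqrD a (- b)).
  rewrite nsq4 nmN dNr ReN [dot b a]dC ReJ.
  have : (n.+1%:R^-1 : R) <= m.+1%:R^-1 by rewrite lef_pV2 ?posrE ?ltr0n // ler_nat.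
  move: lm ln; move: (m.+1%:R^-1) (n.+1%:R^-1) (inf D) => im jn d; lra.
have [l hl] : exists l, slim u l.
  apply: slim_cauchy => e e0.
  have [N hN] := nat_above ((e ^+ 2 / 4)^-1).
  exists N => m n Nm mn.
  rewrite -[leRHS]gtr0_norm // -[leLHS]ger0_norm ?nm_ge0 // -!sqrtr_sqr ler_sqrt ?sqr_ge0 //.
  apply: (le_trans (par _ _ mn)).
  have e4 : 0 < e ^+ 2 / 4 by rewrite divr_gt0 // exprn_gt0.
  suff : (m.+1%:R^-1 : R) <= e ^+ 2 / 4 by move: (m.+1%:R^-1) => im; lra.
  rewrite -[leRHS]invrK lef_pV2 ?posrE ?invr_gt0 ?ltr0n //.
  by apply: (le_trans (ltW hN)); rewrite ler_nat leqW.
have Kl : K l by apply: Kclosed hl _ => n; case: (hu n).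
exists l => // k' Kk'.
have dl : nm (h - l) ^+ 2 <= inf D.
  have s0 : 0 <= inf D by apply: lb_le_inf; [exact: infD.1|move=> _ [k _ <-]; exact: sqr_ge0].
  have : nm (h - l) <= Num.sqrt (inf D).
    apply: (@le_small _ _ _ 2) => e e0.
    have [N hN] := hl _ e0.
    have e2 : 0 < e ^+ 2 by rewrite exprn_gt0.
    have [M hM] := nat_above ((e ^+ 2)^-1).
    pose n := maxn N M.
    have h1 := hN n (leq_maxl _ _).
    have [_ h2] := hu n.
    have h3 : (n.+1%:R^-1 : R) <= e ^+ 2.
      rewrite -[leRHS]invrK lef_pV2 ?posrE ?invr_gt0 ?ltr0n //.
      by apply: (le_trans (ltW hM)); rewrite ler_nat leqW // leq_maxr.
    have h4 : nm (h - u n) <= Num.sqrt (inf D) + e.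
      have p0 : 0 <= Num.sqrt (inf D) + e by rewrite addr_ge0 ?sqrtr_ge0 ?ltW.
      rewrite -[leRHS]ger0_norm // -[leLHS]ger0_norm ?nm_ge0 // -!sqrtr_sqr ler_sqrt ?sqr_ge0 //.
      rewrite sqrrD sqr_sqrtr //.
      have : 0 <= Num.sqrt (inf D) * e *+ 2 by rewrite mulrn_wge0 // mulr_ge0 ?sqrtr_ge0 ?ltW.
      by move: h2 h3; move: (n.+1%:R^-1) => im; lra.
    by have := nm_dist (u n) h l; lra.
  move=> h1; rewrite -[leRHS]sqr_sqrtr //.
  by apply: lerXn2r; rewrite // nnegrE ?nm_ge0 ?sqrtr_ge0.
apply: nsq_eq0; apply/le_anti; rewrite nsq_ge0 andbT.
rewrite -[leRHS](mul0r (nm k' ^+ 2)).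
apply: quadratic_CS; rewrite ?sqr_ge0 // => c; rewrite add0r.
have : K (- c *: k' + l) by apply: Klin.
move=> /dle; have -> : h - (- c *: k' + l) = (h - l) + c *: k'.
  by rewrite opprD scaleNr opprK addrCA addrC.
by rewrite nm_sqrD nm_sqrZ dZr; lra.
Qed.

(** The last clause is used to place the projection in a commutant: it commutes
    with every operator that leaves [K] invariant together with its adjoint. *)
Lemma projection_op_exists : exists P, [/\ bounded_op P, projection_op dot P,
  (forall x, K (P x)), (forall x, K x -> P x = x) &
  forall Z Zs, linear Z -> adjoint_op dot Z Zs -> (forall x, K x -> K (Z x)) ->
    (forall x, K x -> K (Zs x)) -> Z \o P = P \o Z].
Proof.
have : forall h, exists k, K k /\ forall k', K k' -> dot (h - k) k' = 0.
  by move=> h; have [k ? ?] := projection_exists h; exists k.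
move=> /choice[P hP].
have PK x : K (P x) by case: (hP x).
have Port x k : K k -> dot (x - P x) k = 0 by case: (hP x) => _; apply.
have KB x y : K x -> K y -> K (x - y).
  by move=> Kx Ky; rewrite addrC -scaleN1r; apply: Klin.
have Puniq x k : K k -> (forall k', K k' -> dot (x - k) k' = 0) -> P x = k.
  move=> Kk hk; apply/eqP; rewrite -subr_eq0; apply/eqP/nm_eq0/eqP.
  rewrite -sqrf_eq0 nm_sqr.
  have Kd := KB _ _ (PK x) Kk.
  have -> : dot (P x - k) (P x - k) = 0.
    have {1}-> : P x - k = (x - k) - (x - P x) by rewrite opprB [RHS]addrC subrKA.
    by rewrite dDl hk // dNl Port // oppr0 addr0.
  exact: eqxx.
have Plin : linear P.
  move=> c x y; apply: Puniq => [|k Kk]; first exact: Klin.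
  rewrite opprD addrACA -scalerBr dDl dZl !Port //; by rewrite mulr0 addr0.
have Pid x : K x -> P x = x by move=> Kx; apply: Puniq => // k _; rewrite subrr d0l.
have Psym x y : dot (P x) y = dot (P x) (P y).
  have := Port y (P x) (PK x); rewrite dDl dNl => /eqP; rewrite subr_eq0 => /eqP e.
  by rewrite dC e -dC.
exists P; split=> //.
- apply: (@bounded_of _ 1) => // x; rewrite mul1r.
  rewrite -[leRHS]ger0_norm ?nm_ge0 // -[leLHS]ger0_norm ?nm_ge0 // -!sqrtr_sqr ler_sqrt ?sqr_ge0 //.
  have := nm_sqrD (x - P x) (P x); rewrite subrK Port // /= mulr0 addr0 => ->.
  by rewrite lerDr sqr_ge0.
- split; first by apply/funext => x /=; rewrite Pid.
  by move=> x y; rewrite Psym [RHS]dC [dot (P y) x]Psym -dC.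
- move=> Z Zs lZ adj ZK ZsK; apply/funext => x /=; symmetry; apply: Puniq; first exact: ZK.
  by move=> k Kk; rewrite -op_sub // adj; apply/Port/ZsK.
Qed.
End Projection.

(** ** Square roots *)

Section SquareRoot.
Variable B : H -> H.
Hypothesis linB : linear B.
Hypothesis contrB : forall x, nm (B x) <= nm x.
Hypothesis symB : adjoint_op dot B B.

Fixpoint sq_it (n : nat) : H -> H := if n is n'.+1 then
  fun x => 2^-1 *: (B x + sq_it n' (sq_it n' x)) else fun=> 0.
Fixpoint sq_sc (n : nat) : R := if n is n'.+1 then (1 + sq_sc n' ^+ 2) / 2 else 0.
Local Notation Y := sq_it.
Local Notation y := sq_sc.

Lemma nm_half (x : H) : nm (2^-1 *: x) = nm x / 2.
Proof.
have : nm (2^-1 *: x + 2^-1 *: x) = 2 * nm (2^-1 *: x).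
  rewrite -mulr2n /nm normrMn -[LHS]/(complex.Re (`|2^-1 *: x| + `|2^-1 *: x|)) ReD.
  ring.
by rewrite half_half => ->; field.
Qed.

Lemma sq_it_lin n : linear (Y n).
Proof.
elim: n => [|n ih] c x z /=; first by rewrite scaler0 addr0.
rewrite linB !ih scalerA mulrC -scalerA -scalerDr; congr (_ *: _).
by rewrite scalerDr addrACA.
Qed.
Lemma sq_it_sym n : adjoint_op dot (Y n) (Y n).
Proof.
elim: n => [|n ih] x z /=; first by rewrite d0l d0r.
have r : (2^-1 : C)^* = 2^-1.
  by rewrite C_half; apply: Ceq; rewrite ?Csimpl //= oppr0.
by rewrite dZl dZr r dDl dDr symB !ih.
Qed.
Lemma sq_it_comm n Z : linear Z -> Z \o B = B \o Z -> Z \o Y n = Y n \o Z.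
Proof.
move=> lZ ZB; have E x : Z (B x) = B (Z x) by have := congr1 (fun f => f x) ZB.
apply/funext; elim: n => [|n ih] x /=; first by rewrite op_0.
by rewrite op_scale // op_add // E; congr (_ *: (_ + _)); have /= := ih (Y n x) => ->; have /= := ih x => ->.
Qed.

Lemma sq_sc_bounds n : [/\ 0 <= y n, y n <= 1 & y n <= y n.+1].
Proof.
have : 0 <= y n <= 1.
  by elim: n => [|n /andP[a b]] /=; rewrite ?lexx ?ler01 //; apply/andP; split; nra.
move=> /andP[a b]; split=> //=; have := sqr_ge0 (1 - y n); lra.
Qed.

Lemma sq_it_nm n x : nm (Y n x) <= y n * nm x.
Proof.
elim: n x => [|n ih] x /=; first by rewrite nm0 mul0r.
rewrite nm_half; have := nmD (B x) (Y n (Y n x)); have := contrB x.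
have := ih (Y n x); have := ih x; have [a b _] := sq_sc_bounds n.
have := nm_ge0 x => x0 h1 h2 h3 h4.
have : y n * nm (Y n x) <= y n * (y n * nm x) by rewrite ler_wpM2l.
lra.
Qed.

Lemma sq_it_step n x : nm (Y n.+1 x - Y n x) <= (y n.+1 - y n) * nm x.
Proof.
elim: n x => [|n ih] x.
  rewrite /= subr0 addr0 nm_half expr0n /= addr0 subr0.
  have := contrB x; lra.
have -> : Y n.+2 x - Y n.+1 x =
   2^-1 *: (Y n.+1 (Y n.+1 x - Y n x) + (Y n.+1 (Y n x) - Y n (Y n x))).
  rewrite (op_sub (@sq_it_lin n.+1)) subrKA.
  by rewrite -[Y n.+2 x]/(2^-1 *: (B x + Y n.+1 (Y n.+1 x))) -{2}[Y n.+1 x]/(2^-1 *: (B x + Y n (Y n x)))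
      -scalerBr opprD addrACA subrr add0r.
rewrite nm_half.
have h1 := sq_it_nm n.+1 (Y n.+1 x - Y n x).
have h2 := ih (Y n x); have h3 := sq_it_nm n x; have h4 := ih x.
have h5 := nmD (Y n.+1 (Y n.+1 x - Y n x)) (Y n.+1 (Y n x) - Y n (Y n x)).
have [a b c] := sq_sc_bounds n; have [a' _ _] := sq_sc_bounds n.+1.
have x0 := nm_ge0 x.
have -> : y n.+2 = (1 + y n.+1 ^+ 2) / 2 by [].
have e : y n.+1 = (1 + y n ^+ 2) / 2 by [].
set p := y n.+1 in a' c h1 h2 h4 e *; set r := y n in a b c h2 h3 h4 e *.
have k1 : p * nm (Y n.+1 x - Y n x) <= p * ((p - r) * nm x) by rewrite ler_wpM2l.
have k2 : (p - r) * nm (Y n x) <= (p - r) * (r * nm x) by rewrite ler_wpM2l ?subr_ge0.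
have -> : ((1 + p ^+ 2) / 2 - p) * nm x = (p * ((p - r) * nm x) + (p - r) * (r * nm x)) / 2.
  have r2 : r ^+ 2 = 2 * p - 1 by lra.
  have -> : p * ((p - r) * nm x) + (p - r) * (r * nm x) = (p ^+ 2 - r ^+ 2) * nm x by ring.
  rewrite r2; lra.
lra.
Qed.

Lemma sq_it_dist m n x : (m <= n)%N -> nm (Y n x - Y m x) <= (y n - y m) * nm x.
Proof.
elim: n => [|n ih]; first by rewrite leqn0 => /eqP ->; rewrite !subrr nm0 mul0r.
rewrite leq_eqVlt => /orP[/eqP ->|]; first by rewrite !subrr nm0 mul0r.
rewrite ltnS => /ih h; have := nm_dist (Y n x) (Y n.+1 x) (Y m x).
have := sq_it_step n x; lra.
Qed.

Lemma sq_sc_mono m n : (m <= n)%N -> y m <= y n.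
Proof.
elim: n => [|n ih]; first by rewrite leqn0 => /eqP ->.
rewrite leq_eqVlt => /orP[/eqP -> //|]; rewrite ltnS => /ih h.
by apply: (le_trans h); case: (sq_sc_bounds n).
Qed.

Lemma sq_sc_cauchy (e : R) : 0 < e -> exists N, forall m n, (N <= m)%N -> (m <= n)%N ->
  y n - y m <= e.
Proof.
move=> e0; pose D := range y.
have sD : has_sup D.
  by split; [exists (y 0), 0%N|exists 1 => _ [n _ <-]; case: (sq_sc_bounds n)].
have [_ [N _ <-] hN] := sup_adherent e0 sD.
exists N => m n Nm mn; have := sq_sc_mono Nm.
have : y n <= sup D by apply: (sup_upper_bound sD); exists n.
lra.
Qed.

(** The iteration [Y' = (B + Y^2)/2] from 0 is dominated step by step by its
    scalar instance with [B = 1], which increases to a limit, so it converges;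
    its limit [Y] satisfies [2 Y = B + Y^2], that is, [(1 - Y)^2 = 1 - B]. Each
    iterate is a polynomial in [B], whence the last clause. *)
Lemma op_sqrt : exists S, [/\ bounded_op S, adjoint_op dot S S,
  (forall x, S (S x) = x - B x), (forall x, 0 <= complex.Re (dot (S x) x)) &
  forall Z, bounded_op Z -> Z \o B = B \o Z -> Z \o S = S \o Z].
Proof.
have : forall x, exists l, slim (fun n => Y n x) l.
  move=> x; apply: slim_cauchy => e e0.
  have x1 : 0 < nm x + 1 by rewrite ltr_wpDl ?nm_ge0.
  have [N hN] := sq_sc_cauchy (divr_gt0 e0 x1); exists N => m n Nm mn.
  apply: (le_trans (sq_it_dist x mn)); have := hN m n Nm mn.
  rewrite ler_pdivlMr //; have := nm_ge0 x.
  have : 0 <= y n - y m by rewrite subr_ge0 sq_sc_mono.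
  nra.
move=> /choice[T hT].
have linT : linear T.
  move=> c x z; apply: (slim_unique (hT _)).
  have -> : (fun n => Y n (c *: x + z)) = (fun n => c *: Y n x + Y n z).
    by apply/funext => n; rewrite sq_it_lin.
  apply: slimD (hT z); apply: (@slim_op (fun x => c *: x)) (hT x).
  apply: (@bounded_of _ (Num.sqrt (nsq c))) => [a p r|p]; last by rewrite nmZ.
  by rewrite scalerDr !scalerA mulrC.
have nT x : nm (T x) <= nm x.
  apply: slim_nm_le (hT x) _ => n; have [a b _] := sq_sc_bounds n.
  apply: (le_trans (sq_it_nm n x)); have := nm_ge0 x; nra.
have bT : bounded_op T by apply: (@bounded_of _ 1) => // x; rewrite mul1r.
have symT : adjoint_op dot T T.
  have re x z : complex.Re (dot (T x) z - dot x (T z)) = 0.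
    apply/eqP; rewrite -normr_le0; apply: (@le_small _ _ _ (nm z + nm x)) => e e0.
    have [N hN] := hT x _ e0; have [M hM] := hT z _ e0.
    pose n := maxn N M; have h1 := hN n (leq_maxl _ _); have h2 := hM n (leq_maxr _ _).
    have -> : dot (T x) z - dot x (T z) = dot x (Y n z - T z) - dot (Y n x - T x) z.
      by rewrite !dDl !dDr !dNl !dNr sq_it_sym; ring.
    rewrite ReD ReN add0r; apply: (le_trans (ler_normB _ _)).
    have := dot_Re_le x (Y n z - T z); have := dot_Re_le (Y n x - T x) z.
    have := nm_ge0 x; have := nm_ge0 z; nra.
  move=> x z; apply/eqP; rewrite -subr_eq0; apply/eqP/Ceq; first exact: re.
  have := re ('i *: x) z; rewrite op_scale // !dZl -mulrBr ReM /= mul0r sub0r mul1r.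
  by move=> /eqP; rewrite oppr_eq0 => /eqP.
have TT x : 2^-1 *: (B x + T (T x)) = T x.
  have h1 : slim (fun n => Y n.+1 x) (T x).
    by move=> e e0; have [N hN] := hT x _ e0; exists N => n Nn; apply: hN; rewrite leqW.
  apply: slim_unique _ h1 => /=.
  apply: (@slim_op (fun x => 2^-1 *: x)).
    apply: (@bounded_of _ 2^-1) => [a p r|p]; last by rewrite nm_half mulrC.
    by rewrite scalerDr !scalerA mulrC.
  apply: slimD; first exact: slim_cst.
  move=> e e0; have e2 : 0 < e / 2 by rewrite divr_gt0.
  have [N hN] := hT x _ e2; have [M hM] := hT (T x) _ e2.
  exists (maxn N M) => n; rewrite geq_max => /andP[/hN a /hM b].
  apply: (le_trans (nm_dist (Y n (T x)) _ _)).
  rewrite -op_sub; last exact: sq_it_lin.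
  have := sq_it_nm n (Y n x - T x); have [c d _] := sq_sc_bounds n.
  have := nm_ge0 (Y n x - T x); nra.
exists (fun x => x - T x); split.
- apply: (@bounded_of _ 2) => [c x z|x].
    by rewrite linT opprD scalerBr addrACA.
  have := nmD x (- T x); rewrite nmN; have := nT x; lra.
- by move=> x z; rewrite dDl dDr dNl dNr symT.
- move=> x; rewrite op_sub //.
  have := half_half (B x + T (T x)); rewrite TT => e.
  have -> : T (T x) = T x + (T x - B x) by rewrite addrA e addrC addKr.
  have -> : T x - (T x + (T x - B x)) = B x - T x.
    by rewrite opprD addrA subrr sub0r opprB.
  by rewrite opprB subrKA.
- move=> x; rewrite dDl dNl ReD ReN -nm_sqr subr_ge0.
  have := dot_Re_le (T x) x; have := ler_norm (complex.Re (dot (T x) x)).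
  have := nT x; have := nm_ge0 x; nra.
- move=> Z bZ ZB; have lZ : linear Z by case: bZ.
  apply/funext => x /=; rewrite op_sub //; congr (_ - _).
  apply: slim_unique (slim_op bZ (hT x)) _.
  have -> : (fun n => Z (Y n x)) = (fun n => Y n (Z x)); last exact: hT.
  by apply/funext => n; have := congr1 (fun f => f x) (sq_it_comm n lZ ZB).
Qed.
End SquareRoot.
End HilbertSpaces.

(** * Bounded operators and commutants *)
Section OperatorAlgebras.
Variables (R : realType) (H : completeNormedModType R[i]).
Variable dot : {dot H for @Num.conj R[i]}.
Hypothesis hn : hilbert_norm dot.
Local Notation C := R[i].

Lemma bounded_lin (c : C) (S T : H -> H) : bounded_op S -> bounded_op T ->
  bounded_op (fun x => c *: S x + T x).
Proof.
move=> bS bT; have [M M0 hM] := bounded_opP bS; have [N N0 hN] := bounded_opP bT.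
have [lS _] := bS; have [lT _] := bT.
apply: (@bounded_of _ _ _ (Num.sqrt (nsq c) * M + N)) => [a x y|x].
  by rewrite lS lT !scalerDr !scalerA mulrC addrACA.
apply: (le_trans (nmD _ _)); rewrite nmZ mulrDl lerD //.
by rewrite -mulrA ler_wpM2l ?sqrtr_ge0.
Qed.

Lemma bounded_comp (S T : H -> H) : bounded_op S -> bounded_op T -> bounded_op (S \o T).
Proof.
move=> bS bT; have [M M0 hM] := bounded_opP bS; have [N N0 hN] := bounded_opP bT.
have [lS _] := bS; have [lT _] := bT.
apply: (@bounded_of _ _ _ (M * N)) => [a x y|x] /=; first by rewrite lT lS.
by apply: (le_trans (hM _)); rewrite -mulrA ler_wpM2l.
Qed.

Lemma bounded_id : bounded_op (id : H -> H).
Proof. by apply: (@bounded_of _ _ _ 1) => // x; rewrite mul1r. Qed.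

Lemma adjoint_nm (M : R) (T Ts : H -> H) : 0 <= M -> (forall x, nm (T x) <= M * nm x) ->
  adjoint_op dot T Ts -> forall x, nm (Ts x) <= M * nm x.
Proof.
move=> M0 hM adj x; have h := dot_Re_le hn (T (Ts x)) x.
rewrite adj -(nm_sqr hn) ger0_norm ?sqr_ge0 // in h.
have [->|n0] := eqVneq (nm (Ts x)) 0; first by rewrite mulr_ge0 ?nm_ge0.
have n1 : 0 < nm (Ts x) by rewrite lt_def n0 nm_ge0.
rewrite -(ler_pM2l n1); apply: (le_trans (y := nm (T (Ts x)) * nm x)); first by rewrite -expr2.
by rewrite mulrA [nm _ * M]mulrC ler_wpM2r ?nm_ge0.
Qed.

Lemma adjoint_bounded (T Ts : H -> H) : bounded_op T -> adjoint_op dot T Ts -> bounded_op Ts.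
Proof.
move=> bT adj; have [M M0 hM] := bounded_opP bT.
apply: (@bounded_of _ _ _ M) => [a x y|x]; last exact: adjoint_nm adj _.
by apply: (dot_eqr hn) => z; rewrite dDr dZr -!adj dDr dZr.
Qed.

Lemma adjoint_lin (c : C) (S Ss T Ts : H -> H) : adjoint_op dot S Ss -> adjoint_op dot T Ts ->
  adjoint_op dot (fun x => c *: S x + T x) (fun x => c^* *: Ss x + Ts x).
Proof. by move=> hS hT x y; rewrite dDl dZl dDr dZr hS hT cjK. Qed.

Lemma commutant_lin (M : set (H -> H)) c S T : M `<=` @bounded_op R H ->
  commutant M S -> commutant M T -> commutant M (fun x => c *: S x + T x).
Proof.
move=> Mb [bS hS] [bT hT]; split; first exact: bounded_lin.
move=> Z MZ; have [lZ _] := Mb _ MZ; apply/funext => x /=; rewrite lZ.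
by have /= -> := congr1 (fun f => f x) (hS _ MZ); have /= -> := congr1 (fun f => f x) (hT _ MZ).
Qed.

Lemma commutant_comp (M : set (H -> H)) S T :
  commutant M S -> commutant M T -> commutant M (S \o T).
Proof.
move=> [bS hS] [bT hT]; split; first exact: bounded_comp.
move=> Z MZ; rewrite -compA hT // compA hS //.
Qed.

Lemma commutant_id (M : set (H -> H)) : commutant M id.
Proof. by split; [exact: bounded_id|]. Qed.

(** A commutant equals its own bicommutant, so commutants of selfadjoint sets
    are von Neumann algebras with no closure argument. *)
Lemma commutant3 (M : set (H -> H)) : M `<=` @bounded_op R H ->
  commutant (commutant (commutant M)) = commutant M.
Proof.
move=> Mb; apply/seteqP; split=> T [bT hT]; split=> // Z hZ.
  by apply: hT; split; [exact: Mb|move=> U [_ hU]; rewrite hU].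
by case: hZ => _ hZ; rewrite hZ.
Qed.

End OperatorAlgebras.

(** * The von Neumann algebra of a tracial state *)
Section GNS.
Variables (R : realType) (W : Type) (op : W -> W -> W) (e : W) (st : W -> W).
Variables (phi : W -> R[i]) (S : word_state op e st phi).
Local Notation C := R[i].
Local Notation "v ** w" := (op v w) (at level 40, left associativity).
Let K := sker op st phi.
Let pK := sker_pd S.
Local Notation H := (rkhs pK).
Local Notation dot := (rk_dot pK).
Local Notation q := (qf K).
Let hn := @rk_hilbert_norm R W _ pK.

Definition kw (w : W) : H := kv pK [:: (1, w)].
Local Notation xi := (kw e).

Lemma kwE w v : kw w v = phi (st v ** w).
Proof. by rewrite /= /vec big_seq1 mul1r. Qed.
Lemma dot_kw (x : H) w : dot x (kw w) = x w.
Proof. by rewrite /= [LHS]rdot_kv ev1 conjc1 mul1r. Qed.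
Lemma nm_rN (x : H) : nm x = rN x. Proof. by []. Qed.
Lemma nm_le_of (A : R) (x y : H) : 0 <= A ->
  (forall s, nsq (ev x s) <= A ^+ 2 * (rQ y * q s)) -> nm x <= A * nm y.
Proof.
move=> A0 h; rewrite !nm_rN.
have : rQ x <= A ^+ 2 * rQ y.
  apply: rQ_le => [|s]; last by rewrite -mulrA.
  by rewrite mulr_ge0 ?sqr_ge0 ?rQ_ge0.
rewrite /rN => h2.
rewrite -[X in X * _]ger0_norm // -sqrtr_sqr -sqrtrM ?sqr_ge0 // ler_sqrt //.
by rewrite mulr_ge0 ?sqr_ge0 ?rQ_ge0.
Qed.

(** Left translations, the antiunitary conjugation [h |-> h^*], and right
    translations, obtained from the left ones by conjugation. *)
Lemma Lop_in u (h : H) : (fun w => h (st u ** w)) \in rk_mem pK.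
Proof.
apply: (@rk_bounded_in _ _ _ _ (rQ h)); apply: (rk_bounded_nsq pK) => [|s].
  exact: rQ_ge0.
have -> : ev (fun w => h (st u ** w)) s = ev h (mulc op (st u) s).
  by rewrite /ev /mulc big_map.
by apply: (le_trans (rQP _ _)); rewrite ler_wpM2l ?rQ_ge0 // (q_mulc S).
Qed.
Definition Lop u (h : H) : H := Rkhs (Lop_in u h).

Lemma Jop_in (h : H) : (fun w => (h (st w))^*) \in rk_mem pK.
Proof.
apply: (@rk_bounded_in _ _ _ _ (rQ h)); apply: (rk_bounded_nsq pK) => [|s].
  exact: rQ_ge0.
have -> : ev (fun w => (h (st w))^*) s = (ev h (starc st s))^*.
  rewrite /ev /starc big_map (big_morph _ (@cjD R) (conjc0 _)).
  by apply: eq_bigr => x _; rewrite cjM cjK.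
by rewrite nsqJ; apply: (le_trans (rQP _ _)); rewrite (q_starc S).
Qed.
Definition Jop (h : H) : H := Rkhs (Jop_in h).
Definition Rop u (h : H) : H := Jop (Lop (st u) (Jop h)).

Lemma LopE u h w : Lop u h w = h (st u ** w). Proof. by []. Qed.
Lemma JopE h w : Jop h w = (h (st w))^*. Proof. by []. Qed.
Lemma RopE u h w : Rop u h w = h (w ** st u).
Proof. by rewrite /Rop JopE LopE JopE cjK (ws_stM S) !(ws_stK S). Qed.

Lemma Jop_D x y : Jop (x + y) = Jop x + Jop y.
Proof. by apply: rkhsP => w; rewrite JopE rkfD [LHS]cjD. Qed.
Lemma Jop_Z c x : Jop (c *: x) = c^* *: Jop x.
Proof. by apply: rkhsP => w; rewrite JopE rkfZ [LHS]cjM. Qed.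
Lemma JopK x : Jop (Jop x) = x.
Proof. by apply: rkhsP => w; rewrite !JopE cjK (ws_stK S). Qed.
Lemma rQ_Jop x : rQ (Jop x) = rQ x.
Proof.
have le y : rQ (Jop y) <= rQ y.
  apply: rQ_le => [|s]; first exact: rQ_ge0.
  have -> : ev (Jop y) s = (ev y (starc st s))^*.
    rewrite /ev /starc big_map (big_morph _ (@cjD R) (conjc0 _)).
    by apply: eq_bigr => z _; rewrite cjM cjK.
  by rewrite nsqJ; apply: (le_trans (rQP _ _)); rewrite (q_starc S).
by apply/le_anti; rewrite le /= -{1}(JopK x) le.
Qed.
Lemma dot_Jop x y : dot (Jop x) (Jop y) = dot y x.
Proof.
have B a b : rB (Jop a) (Jop b) = rB a b by rewrite /rB -Jop_D !rQ_Jop.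
rewrite [RHS](dC dot) /= /rk_dot /= /rdot.
have -> : 'i *: Jop y = Jop (- ('i *: y)).
  rewrite -scaleN1r scalerA Jop_Z; congr (_ *: _).
  by apply: Ceq; rewrite !Csimpl /=; lra.
by rewrite !B; apply: Ceq; rewrite //= rB_sym rBN rB_sym.
Qed.

Lemma Lop_lin u : linear (Lop u).
Proof. by move=> c x y; apply: rkhsP => w; rewrite LopE !rkfD !rkfZ. Qed.
Lemma Rop_lin u : linear (Rop u).
Proof. by move=> c x y; rewrite /Rop Jop_D Jop_Z Lop_lin Jop_D Jop_Z cjK. Qed.
Lemma nm_Jop x : nm (Jop x) = nm x.
Proof. by rewrite !nm_rN /rN rQ_Jop. Qed.
(** The contraction property of translations on the kernel form, by duality. *)
Lemma Lop_contr u x : nm (Lop u x) <= nm x.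
Proof.
rewrite -[leRHS]mul1r; apply: nm_le_of => // s; rewrite expr1n mul1r.
have -> : ev (Lop u x) s = ev x (mulc op (st u) s) by rewrite /ev /mulc big_map.
by apply: (le_trans (rQP _ _)); rewrite ler_wpM2l ?rQ_ge0 // (q_mulc S).
Qed.
Lemma Rop_contr u x : nm (Rop u x) <= nm x.
Proof. by rewrite /Rop nm_Jop; apply: (le_trans (Lop_contr _ _)); rewrite nm_Jop. Qed.
Lemma Lop_bounded u : bounded_op (Lop u).
Proof. by apply: (@bounded_of _ _ _ 1); [exact: Lop_lin|move=> x; rewrite mul1r Lop_contr]. Qed.
Lemma Rop_bounded u : bounded_op (Rop u).
Proof. by apply: (@bounded_of _ _ _ 1); [exact: Rop_lin|move=> x; rewrite mul1r Rop_contr]. Qed.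

Lemma Lop_kw u w : Lop u (kw w) = kw (u ** w).
Proof. by apply: rkhsP => v; rewrite LopE !kwE (ws_stM S) (ws_stK S) (ws_assoc S). Qed.
Lemma Jop_kw w : Jop (kw w) = kw (st w).
Proof.
apply: rkhsP => v; rewrite JopE !kwE -(ws_st S) (ws_stM S) !(ws_stK S).
exact: (ws_tr S).
Qed.
Lemma Rop_kw u w : Rop u (kw w) = kw (w ** u).
Proof. by rewrite /Rop Jop_kw Lop_kw Jop_kw (ws_stM S) !(ws_stK S). Qed.
Lemma Rop_xi u : Rop u xi = kw u. Proof. by rewrite Rop_kw (ws_1w S). Qed.
Lemma Lop_xi u : Lop u xi = kw u. Proof. by rewrite Lop_kw (ws_w1 S). Qed.
Lemma Jop_xi : Jop xi = xi. Proof. by rewrite Jop_kw (ws_st1 S). Qed.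
Lemma Lop_Rop u v x : Lop u (Rop v x) = Rop v (Lop u x).
Proof. by apply: rkhsP => w; rewrite LopE !RopE LopE (ws_assoc S). Qed.
Lemma Lop_op u v x : Lop (u ** v) x = Lop u (Lop v x).
Proof. by apply: rkhsP => w; rewrite !LopE (ws_stM S) (ws_assoc S). Qed.

(** Riesz representation holds by construction: a bounded functional is its
    table of values on the kernel vectors. *)
Section Adjoint.
Variables (T : H -> H) (bT : bounded_op T).

Lemma adj_ev (h : H) s : ev (fun w => dot h (T (kw w))) s = dot h (T (kv pK s)).
Proof.
have lT : linear T by case: bT.
elim: s => [|[c w] s ih]; first by rewrite ev_nil kv_nil (op_0 lT) d0r.
have -> : kv pK ((c, w) :: s) = c *: kw w + kv pK s.
  by rewrite -cat1s kv_cat /kw -kv_sc /sc /= mulr1.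
by rewrite lT dDr dZr -ih /ev big_cons.
Qed.

Lemma adj_in (h : H) : (fun w => dot h (T (kw w))) \in rk_mem pK.
Proof.
have [M M0 hM] := bounded_opP bT.
apply: (@rk_bounded_in _ _ _ _ (nm h ^+ 2 * M ^+ 2)).
apply: (rk_bounded_nsq pK) => [|s]; first by rewrite mulr_ge0 ?sqr_ge0.
rewrite adj_ev; apply: (le_trans (dot_CS hn _ _)).
rewrite -[leRHS]mulrA; apply: ler_wpM2l; first exact: sqr_ge0.
have -> : qf (sker op st phi) s = nm (kv pK s) ^+ 2 by rewrite nm_rN sqr_rN rQ_kv.
by rewrite -exprMn lerXn2r // ?nnegrE ?mulr_ge0 ?nm_ge0.
Qed.
Definition Adj (h : H) : H := Rkhs (adj_in h).

Lemma AdjP : adjoint_op dot T Adj.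
Proof.
have lT : linear T by case: bT.
move=> x y; apply/eqP; rewrite -subr_eq0; apply/eqP/nsq_eq0/le_anti.
rewrite nsq_ge0 andbT.
have [M M0 hM] := bounded_opP bT.
apply: (@le_small _ _ _ (2 * (M ^+ 2 * nm y ^+ 2) + 2 * nm (Adj y) ^+ 2)) => d d0.
rewrite add0r.
have [s hs] : exists s, rN (x - kv pK s) <= Num.sqrt d.
  by apply: kv_dense; rewrite sqrtr_gt0.
set z := x - _ in hs.
have zs : dot (T (kv pK s)) y = dot (kv pK s) (Adj y).
  by rewrite [LHS](dC dot) [RHS](dC dot); congr (_^*); rewrite -adj_ev; symmetry; exact: rdot_kv.
have -> : dot (T x) y - dot x (Adj y) = dot (T z) y - dot z (Adj y).
  have -> : x = z + kv pK s by rewrite subrK.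
  clearbody z.
  rewrite (op_add lT) (dDl dot (T z)) (dDl dot z) zs.
  by rewrite opprD addrACA subrr addr0.
have hz : nm z ^+ 2 <= d.
  have d1 : d = Num.sqrt d ^+ 2 by rewrite sqr_sqrtr // ltW.
  by rewrite d1 lerXn2r // ?nnegrE ?sqrtr_ge0 ?nm_ge0.
apply: (le_trans (nsqD _ _)).
have -> : nsq (- dot z (Adj y)) = nsq (dot z (Adj y)) by rewrite /nsq !Csimpl !sqrrN.
have h1 : nsq (dot (T z) y) <= M ^+ 2 * d * nm y ^+ 2.
  apply: (le_trans (dot_CS hn _ _)); apply: ler_wpM2r; first exact: sqr_ge0.
  apply: le_trans (_ : (M * nm z) ^+ 2 <= _).
    by rewrite lerXn2r // ?nnegrE ?mulr_ge0 ?nm_ge0.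
  by rewrite exprMn; apply: ler_wpM2l; rewrite ?sqr_ge0.
have h2 : nsq (dot z (Adj y)) <= d * nm (Adj y) ^+ 2.
  by apply: (le_trans (dot_CS hn _ _)); apply: ler_wpM2r; rewrite ?sqr_ge0.
lra.
Qed.
End Adjoint.

Lemma Lop_adj u : adjoint_op dot (Lop u) (Lop (st u)).
Proof.
have -> : Lop (st u) = Adj (Lop_bounded u); last exact: AdjP.
apply/funext => h; apply: rkhsP => w.
by rewrite LopE /= Lop_kw -[RHS]/(dot h (kw (u ** w))) dot_kw (ws_stK S).
Qed.
Lemma Rop_adj u : adjoint_op dot (Rop u) (Rop (st u)).
Proof.
have -> : Rop (st u) = Adj (Rop_bounded u); last exact: AdjP.
apply/funext => h; apply: rkhsP => w.
by rewrite RopE -[RHS]/(dot h (Rop u (kw w))) Rop_kw dot_kw (ws_stK S).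
Qed.

(** Defining the algebra as a commutant, rather than as the closure of the left
    translations, makes the bicommutant property automatic. *)
Definition gnsF : set (H -> H) := commutant [set Rop u | u in setT].
Local Notation F := gnsF.

Lemma Rop_set_bounded : [set Rop u | u in setT] `<=` @bounded_op R H.
Proof. by move=> _ [u _ <-]; exact: Rop_bounded. Qed.
Lemma gnsF_bounded T : F T -> bounded_op T. Proof. by case. Qed.
Lemma gnsF_lin T : F T -> linear T. Proof. by case=> [[]]. Qed.
Lemma gnsF_Rop T u x : F T -> T (Rop u x) = Rop u (T x).
Proof. by move=> [_ h]; have := congr1 (fun f => f x) (h (Rop u) (ex_intro2 _ _ u I erefl)). Qed.
Lemma gnsFP T : bounded_op T -> (forall u x, T (Rop u x) = Rop u (T x)) -> F T.
Proof. by move=> bT h; split=> // _ [u _ <-]; apply/funext => x /=. Qed.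
Lemma gnsF_Lop u : F (Lop u).
Proof. by apply: gnsFP => [|v x]; [exact: Lop_bounded|exact: Lop_Rop]. Qed.
Lemma gnsF_lincomb c A B : F A -> F B -> F (fun x => c *: A x + B x).
Proof. by apply: commutant_lin; exact: Rop_set_bounded. Qed.
Lemma gnsF_comp A B : F A -> F B -> F (A \o B).
Proof. exact: commutant_comp. Qed.
Lemma gnsF_id : F id. Proof. exact: commutant_id. Qed.
Lemma gnsF_kw T w : F T -> T (kw w) = Rop w (T xi).
Proof. by move=> FT; rewrite -gnsF_Rop // Rop_xi. Qed.

(** The set of right translations is closed under adjoints, hence so is its
    commutant. *)
Lemma gnsF_adj T Ts : F T -> adjoint_op dot T Ts -> F Ts.
Proof.
move=> FT adj; apply: gnsFP => [|u x].
  exact: (adjoint_bounded hn (gnsF_bounded FT) adj).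
apply: (dot_eqr hn) => z; rewrite -adj.
rewrite -[in LHS](ws_stK S u) -Rop_adj -gnsF_Rop // adj.
by rewrite Rop_adj (ws_stK S).
Qed.

(** The vector [xi] separates [F]: right translations commute with [T] and carry
    [xi] to all kernel vectors. *)
Lemma gnsF_eq0 T : F T -> T xi = 0 -> T = (fun=> 0).
Proof.
move=> FT T0; have adj := AdjP (gnsF_bounded FT).
have FA := gnsF_adj FT adj.
have Tk w : T (kw w) = 0 by rewrite gnsF_kw // T0 op_0 //; exact: Rop_lin.
have A0 y : Adj (gnsF_bounded FT) y = 0.
  by apply: rkhsP => w; rewrite /= -[LHS]/(dot y (T (kw w))) Tk d0r.
by apply/funext => x; apply: (dot_eq hn) => z; rewrite adj A0 d0r d0l.
Qed.

Lemma gns_vn : von_neumann_algebra dot F.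
Proof.
split=> [T|T FT|]; first exact: gnsF_bounded.
  have adj := AdjP (gnsF_bounded FT).
  by exists (Adj (gnsF_bounded FT)) => //; apply: gnsF_adj adj.
exact: commutant3 Rop_set_bounded.
Qed.

Definition gns_tr (T : H -> H) : C := dot (T xi) xi.

(** The antiunitary [Jop] implements the adjoint on the orbit of the trace
    vector; the trace property of the vector state at [xi] follows. *)
Lemma adj_xi T Ts : F T -> adjoint_op dot T Ts -> Ts xi = Jop (T xi).
Proof.
move=> FT adj; apply: rkhsP => w.
rewrite -dot_kw (dC dot) -adj gnsF_kw // dot_kw RopE JopE.
by rewrite (ws_1w S).
Qed.

Lemma gns_trC A B : F A -> F B -> gns_tr (A \o B) = gns_tr (B \o A).
Proof.
move=> FA FB; have aA := AdjP (gnsF_bounded FA); have aB := AdjP (gnsF_bounded FB).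
rewrite /gns_tr /comp (aA (B xi) xi) (aB (A xi) xi) (adj_xi FA aA) (adj_xi FB aB).
by rewrite -[A xi]JopK dot_Jop JopK.
Qed.

Lemma gns_tr_adj A B : adjoint_op dot A B -> gns_tr (B \o A) = (nm (A xi) ^+ 2)%:C.
Proof. by move=> adj; rewrite /gns_tr /= (dC dot) -adj (dxx hn) conjc_real. Qed.

Lemma xi_norm : nm xi = 1.
Proof.
have : dot xi xi = 1 by rewrite dot_kw kwE (ws_w1 S) (ws_st1 S) (ws_1 S).
rewrite (dxx hn) => /(congr1 (@complex.Re R)) /= h; apply/eqP.
by rewrite -(@eqrXn2 _ 2) // ?nm_ge0 // h expr1n.
Qed.

Lemma gns_trace : canonical_trace dot F gns_tr.
Proof.
split.
- by move=> c A B FA FB; rewrite /gns_tr dDl dZl.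
- exact: gns_trC.
- by move=> A B FA FB /gns_tr_adj ->; rewrite realC_ge0 sqr_ge0.
- by rewrite /gns_tr (dxx hn) xi_norm expr1n.
Qed.

(** If [v] is an isometry in [F], then [1 - v v^*] kills [xi], since the
    trace gives [v v^*] and [v^* v] the same value. *)
Lemma gns_finite : finite_vna dot F.
Proof.
move=> v vs Fv Fvs adj h.
have E x : vs (v x) = x by have := congr1 (fun f => f x) h.
pose d x := (-1 : C) *: (v \o vs) x + id x.
have Fd : F d by apply: gnsF_lincomb; [exact: gnsF_comp|exact: gnsF_id].
suff d0 : d xi = 0.
  have /= d00 := gnsF_eq0 Fd d0; apply/funext => x.
  have := congr1 (fun f => f x) d00; rewrite /d /= scaleN1r addrC => /eqP.
  by rewrite subr_eq0 => /eqP.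
apply: nm_eq0; apply/eqP; rewrite -sqrf_eq0.
have -> : d xi = xi + - v (vs xi) by rewrite /d scaleN1r addrC.
rewrite (nm_sqrD hn) nmN dNr !(nm_sqr hn).
have -> : dot (v (vs xi)) (v (vs xi)) = 1.
  rewrite adj E; have := gns_trC Fv Fvs; rewrite h /gns_tr /comp adj.
  by have -> : dot xi xi = 1 by rewrite (dxx hn) xi_norm expr1n.
have -> : dot xi (v (vs xi)) = 1.
  have := gns_trC Fv Fvs; rewrite h /gns_tr /comp => hh.
  by rewrite (dC dot) hh (dxx hn) xi_norm expr1n conjc1.
have -> : dot xi xi = 1 by rewrite (dxx hn) xi_norm expr1n.
by rewrite !Csimpl /=; apply/eqP; lra.
Qed.
End GNS.

(** * Factors without minimal projections *)
Section Bessel.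
Variables (R : realType) (H : completeNormedModType R[i]).
Variable dot : {dot H for @Num.conj R[i]}.
Hypothesis hn : hilbert_norm dot.

Lemma bessel (N : nat) (E : nat -> H) (x : H) :
  (forall j k, (j < N)%N -> (k < N)%N -> dot (E j) (E k) = (j == k)%:R) ->
  \sum_(k < N) nsq (dot x (E k)) <= nm x ^+ 2.
Proof.
elim: N x => [|N ih] x hE; first by rewrite big_ord0 sqr_ge0.
rewrite big_ord_recr /=.
pose c := dot x (E N); pose y := x - c *: E N.
have : \sum_(k < N) nsq (dot y (E k)) <= nm y ^+ 2.
  by apply: ih => j k jN kN; apply: hE; rewrite ltnS ltnW.
have -> : \sum_(k < N) nsq (dot y (E k)) = \sum_(k < N) nsq (dot x (E k)).
  apply: eq_bigr => k _; rewrite /y dDl dNl dZl hE ?ltnS //; last by rewrite ltnW.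
  by rewrite eq_sym (ltn_eqF (ltn_ord k)) mulr0 subr0.
have n1 : nm (E N) ^+ 2 = 1 by rewrite (nm_sqr hn) hE // eqxx.
have -> : nm y ^+ 2 = nm x ^+ 2 - nsq c.
  rewrite /y (nm_sqrD hn) nmN nm_sqrZ n1 dNr dZr -/c conjM_nsq ReN /=.
  ring.
rewrite -/c; lra.
Qed.
End Bessel.

Section GNSFactor.
Variables (R : realType) (W : Type) (op : W -> W -> W) (e : W) (st : W -> W).
Variables (phi : W -> R[i]) (S : word_state op e st phi).
Local Notation C := R[i].
Local Notation "v ** w" := (op v w) (at level 40, left associativity).
Let pK := sker_pd S.
Local Notation H := (rkhs pK).
Local Notation dot := (rk_dot pK).
Let hn := @rk_hilbert_norm R W _ pK.
Local Notation F := (@gnsF R W op e st phi S).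
Local Notation kw := (@kw R W op e st phi S).
Local Notation xi := (kw e).
Local Notation Lop := (@Lop R W op e st phi S).
Local Notation Rop := (@Rop R W op e st phi S).
Local Notation tr := (@gns_tr R W op e st phi S).

Lemma gnsF_0 : F (fun=> 0).
Proof.
apply: gnsFP => [|u x]; last by rewrite (op_0 (@Rop_lin _ _ _ _ _ _ S u)).
by apply: (@bounded_of _ _ _ 0) => [c x y|x]; rewrite ?scaler0 ?addr0 // nm0 mul0r.
Qed.

Lemma gnsF_scale c T : F T -> F (fun x => c *: T x).
Proof.
move=> FT; have -> : (fun x => c *: T x) = (fun x => c *: T x + 0).
  by apply/funext => x; rewrite addr0.
exact: gnsF_lincomb FT gnsF_0.
Qed.

Lemma gnsF_D A B : F A -> F B -> F (fun x => A x + B x).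
Proof.
move=> FA FB; have -> : (fun x => A x + B x) = (fun x => 1 *: A x + B x).
  by apply/funext => x; rewrite scale1r.
exact: gnsF_lincomb.
Qed.

(** A positive operator of trace zero vanishes on the trace vector, hence
    everywhere. *)
Lemma gnsF_pos_tr0 T : F T -> adjoint_op dot T T ->
  (forall x, 0 <= complex.Re (dot (T x) x)) -> complex.Re (tr T) = 0 -> T = (fun=> 0).
Proof.
move=> FT sT pT t0; apply: (gnsF_eq0 FT); apply: (dot_eq0 hn) => k.
have lT := gnsF_lin FT.
apply/nsq_eq0/le_anti; rewrite nsq_ge0 andbT -[leRHS](mul0r (complex.Re (dot (T k) k))) -t0.
apply: quadratic_CS; [exact: pT|exact: pT|move=> l].
have := pT (xi + l *: k); rewrite (op_add lT) (op_scale lT).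
rewrite (dDl dot (T xi)) (dDr dot (T xi)) (dDr dot (l *: _)) !(dZl dot) !(dZr dot).
have -> : dot (T k) xi = (dot (T xi) k)^* by rewrite sT (dC dot).
rewrite /gns_tr /nsq !Csimpl.
move: (dot (T xi) xi) (dot (T xi) k) (dot (T k) k) => a b c.
congr (_ <= _); ring.
Qed.

Section MinimalProjection.
Variable p : H -> H.
Hypothesis pmin : minimal_projection dot F p.

Let Fp : F p. Proof. by case: pmin. Qed.
Let pp x : p (p x) = p x.
Proof. by case: pmin => _ [h _] _ _; have := congr1 (fun f => f x) h. Qed.
Let psym : adjoint_op dot p p. Proof. by case: pmin => _ []. Qed.
Let plin : linear p. Proof. exact: gnsF_lin Fp. Qed.

(** The corner [p F p] of a minimal projection contains no selfadjoint
    element [a] of trace zero except 0: with [s = |a|], the product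
    [(s - a)(s + a)] vanishes, and the kernel of [s - a] in the range of [p] is
    an invariant subspace, so that minimality makes [s - a] or [s + a] zero;
    either way [s] has trace zero. *)
Lemma corner_tr0 a : F a -> adjoint_op dot a a -> (forall x, p (a x) = a x) ->
  (forall x, a (p x) = a x) -> tr a = 0 -> a = (fun=> 0).
Proof.
move=> Fa sa pa ap tra.
have [M M0 hM] := bounded_opP (gnsF_bounded Fa).
have M1 : 0 < M + 1 by rewrite ltr_wpDl.
(* [b] is [a] scaled to a contraction, and [s] will be its absolute value. *)
pose k : R := (M + 1)^-1.
have k0 : 0 < k by rewrite invr_gt0.
pose b x := k%:C *: a x.
have Fb : F b by apply: gnsF_scale.
have lb := gnsF_lin Fb.
have sb : adjoint_op dot b b.
  by move=> x y; rewrite /b (dZl dot) (dZr dot) conjc_real sa.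
have nb x : nm (b x) <= nm x.
  rewrite /b nmZ {1}/nsq /= expr0n addr0 sqrtr_sqr gtr0_norm //.
  rewrite /k mulrC ler_pdivrMr // mulrC; have := hM x; have := nm_ge0 x; lra.
have pb x : p (b x) = b x by rewrite /b (op_scale plin) pa.
have bp x : b (p x) = b x by rewrite /b ap.
have trb : tr b = 0 by rewrite /gns_tr /b (dZl dot) -/(tr a) tra mulr0.
suff b0 : b = (fun=> 0).
  apply/funext => x; have := congr1 (fun f => f x) b0; rewrite /b => /eqP.
  by rewrite scaler_eq0 => /orP[/eqP/(congr1 (@complex.Re R)) /= h|/eqP //]; rewrite h ltxx in k0.
pose B x := x - b (b x).
have FB : F B.
  have -> : B = (fun x => (-1) *: (b \o b) x + id x).
    by apply/funext => x; rewrite scaleN1r addrC.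
  by apply: gnsF_lincomb; [exact: gnsF_comp|exact: gnsF_id].
have cB x : nm (B x) <= nm x.
  rewrite -(@ler_pXn2r _ 2) // ?nnegrE ?nm_ge0 // /B (nm_sqrD hn) nmN dNr ReN.
  rewrite -sb -(nm_sqr hn).
  have : nm (b (b x)) ^+ 2 <= nm (b x) ^+ 2 by rewrite lerXn2r // ?nnegrE ?nm_ge0.
  have := sqr_ge0 (nm (b x)); lra.
have sB : adjoint_op dot B B.
  by move=> x y; rewrite /B (dDl dot) (dDr dot) (dNl dot) (dNr dot) !sb.
have [s [bs ss ssq spos scomm]] := op_sqrt hn (gnsF_lin FB) cB sB.
have SS x : s (s x) = b (b x) by rewrite ssq /B opprB addrC subrK.
have ls : linear s by case: bs.
have Fs : F s.
  apply: gnsFP => // u x.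
  have /= h := congr1 (fun f => f x) (scomm (Rop u) (@Rop_bounded _ _ _ _ _ _ S u) _).
  by rewrite -h //; apply/funext => z /=; rewrite (gnsF_Rop u z FB).
have sbc x : s (b x) = b (s x).
  have /= h := congr1 (fun f => f x) (scomm b (gnsF_bounded Fb) _).
  by rewrite -h //; apply/funext => z /=; rewrite /B (op_sub lb).
have fin : complex.Re (tr s) = 0 -> b = (fun=> 0).
  move=> /(gnsF_pos_tr0 Fs ss spos) s0; apply/funext => x.
  apply: nm_eq0; apply/eqP; rewrite -sqrf_eq0 (nm_sqr hn) sb -SS.
  have -> : s (s x) = 0 by have := congr1 (fun f => f (s x)) s0.
  by rewrite d0r.
have sp x : s (p x) = s x.
  apply/eqP; rewrite eq_sym -subr_eq0 -(op_sub ls); apply/eqP/nm_eq0/eqP.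
  rewrite -sqrf_eq0 (nm_sqr hn) ss SS (op_sub lb) bp subrr (op_0 lb) d0r.
  exact: eqxx.
have ps x : p (s x) = s x.
  by apply: (dot_eq hn) => z; rewrite psym ss sp -ss.
pose x h := s h + b h; pose y h := s h - b h.
have ly : linear y by move=> c u v; rewrite /y ls lb opprD scalerBr addrACA.
have Fy : F y.
  have -> : y = (fun h => (-1) *: b h + s h) by apply/funext => h; rewrite scaleN1r addrC.
  exact: gnsF_lincomb.
have yx h : y (x h) = 0.
  rewrite /y /x (op_add ls) (op_add lb) SS sbc.
  by rewrite [b (b h) + _]addrC subrr.
(* The projection onto the kernel of [s - b] in the range of [p] lies in [F]. *)
pose K := [set h | y h = 0 /\ p h = h].
have K0 : K 0 by split; [exact: op_0 ly|exact: op_0 plin].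
have Klin c u v : K u -> K v -> K (c *: u + v).
  by move=> [yu pu] [yv pv]; split; [rewrite ly yu yv scaler0 addr0|rewrite plin pu pv].
have Kcl u l : slim u l -> (forall n, K (u n)) -> K l.
  move=> ul Ku; split.
    apply: (slim_unique (slim_op (gnsF_bounded Fy) ul)).
    have -> : (fun n => y (u n)) = (fun=> 0) by apply/funext => n; case: (Ku n).
    exact: slim_cst.
  apply: (slim_unique (slim_op (gnsF_bounded Fp) ul)).
  by have -> : (fun n => p (u n)) = u by apply/funext => n; case: (Ku n).
have [Q [bQ projQ KQ Qid Qcomm]] := projection_op_exists hn K0 Klin Kcl.
have KR u h : K h -> K (Rop u h).
  move=> [yh ph]; split; first by rewrite (gnsF_Rop u h Fy) yh (op_0 (@Rop_lin _ _ _ _ _ _ S u)).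
  by rewrite (gnsF_Rop u h Fp) ph.
have FQ : F Q.
  apply: gnsFP => // u h.
  have /= <- // := congr1 (fun f => f h) (Qcomm (Rop u) (Rop (st u)) (@Rop_lin _ _ _ _ _ _ S u) (@Rop_adj _ _ _ _ _ _ S u) (KR u) (KR (st u))).
have pQ : p \o Q = Q by apply/funext => h /=; case: (KQ h).
case: pmin => _ _ _ /(_ Q FQ projQ pQ)[Q0|Qp]; apply: fin.
  have sx h : s h = - b h.
    apply/eqP; rewrite -subr_eq0 opprK; apply/eqP; rewrite -/(x h) -(Qid (x h)) ?Q0 //.
    by split; rewrite ?yx // /x (op_add plin) ps pb.
  by rewrite /gns_tr sx (dNl dot) -/(tr b) trb oppr0.
have sy h : s h = b h.
  apply/eqP; rewrite -subr_eq0 -sp -bp -/(y (p h)) -Qp.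
  by case: (KQ h) => ->.
by rewrite /gns_tr sy -/(tr b) trb.
Qed.

Lemma p_xi_gt0 : 0 < nm (p xi) ^+ 2.
Proof.
rewrite lt_def sqr_ge0 andbT sqrf_eq0; apply/eqP => /nm_eq0 h.
by case: pmin => _ _ + _; apply; exact: gnsF_eq0 Fp h.
Qed.

(** Subtracting a multiple of [p] from the compression of [x] brings the trace
    to zero. *)
Lemma corner_sa x : F x -> adjoint_op dot x x ->
  exists c : C, forall h, p (x (p h)) = c *: p h.
Proof.
move=> Fx sx; have t0 := p_xi_gt0; set t := nm (p xi) ^+ 2 in t0.
have [r0 r0E] : exists r : R, dot (x (p xi)) (p xi) = r%:C.
  have r (z : C) : z = z^* -> exists r : R, z = r%:C.
    move=> /(congr1 (@complex.Im R)); rewrite ImJ => h.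
    by exists (complex.Re z); apply: Ceq => //=; lra.
  by apply: r; rewrite -(dC dot) sx.
pose c : R := r0 / t.
pose a h := p (x (p h)) - c%:C *: p h.
have sa : adjoint_op dot a a.
  move=> u v; rewrite /a (dDl dot) (dDr dot) (dNl dot) (dNr dot) (dZl dot) (dZr dot).
  by rewrite conjc_real !psym sx psym.
have Fa : F a.
  have -> : a = (fun h => (- c%:C) *: p h + (p \o (x \o p)) h).
    by apply/funext => h /=; rewrite scaleNr addrC.
  by apply: gnsF_lincomb => //; exact: gnsF_comp Fp (gnsF_comp Fx Fp).
exists c%:C => h; apply/eqP; rewrite -subr_eq0 -/(a h).
have -> // := corner_tr0 Fa sa.
- by move=> u; rewrite /a (op_sub plin) (op_scale plin) !pp.
- by move=> u; rewrite /a !pp.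
- rewrite /gns_tr /a (dDl dot) (dNl dot) (dZl dot) !psym.
  have -> : dot xi (p xi) = t%:C by rewrite -psym -pp psym (dxx hn).
  rewrite r0E; have -> : c%:C * t%:C = r0%:C.
    by rewrite -(rmorphM (real_complex R)) /c divfK // lt0r_neq0.
  by rewrite subrr.
Qed.

Lemma corner_scalar x : F x -> exists c : C, forall h, p (x (p h)) = c *: p h.
Proof.
move=> Fx; have adj := AdjP (gnsF_bounded Fx).
set xs := Adj _ in adj; have Fxs := gnsF_adj Fx adj.
have adj' := adjoint_sym adj.
pose x1 h := x h + xs h; pose x2 h := 'i%C *: (x h - xs h).
have [|c1 h1] := @corner_sa x1 (gnsF_D Fx Fxs).
  by move=> u v; rewrite /x1 (dDl dot) (dDr dot) adj adj' addrC.
have [||c2 h2] := @corner_sa x2.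
- apply: gnsF_scale; have -> : (fun h => x h - xs h) = (fun h => (-1) *: xs h + x h).
    by apply/funext => h; rewrite scaleN1r addrC.
  exact: gnsF_lincomb.
- move=> u v; rewrite /x2 (dZl dot) (dZr dot) (dDl dot) (dDr dot) (dNl dot) (dNr dot) adj adj'.
  have -> : ('i%C : C)^* = - 'i%C by apply: Ceq; rewrite ?Csimpl //= oppr0.
  by rewrite mulNr -mulrN opprB.
exists (2^-1 * (c1 - 'i%C * c2)) => h.
rewrite -scalerA scalerBl -h1 -scalerA -h2 /x1 /x2.
rewrite -(op_scale plin) -(op_sub plin) -(op_scale plin); congr p.
rewrite scalerA.
have -> : 'i%C * 'i%C = -1 :> C by apply: Ceq; rewrite ?Csimpl /=; ring.
rewrite scaleN1r opprK addrACA subrr addr0 scalerDr half_half //.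
Qed.

(** An infinite orthonormal sequence of unitaries [u_k] is incompatible with a
    minimal projection. Since [p u_j^* u_k p] is a multiple of [p], Bessel's
    inequality bounds the norm of [Z], the sum of [u_k p u_k^* xi] over
    [k < N], by the square root of [N], while [Z] pairs with [xi] to
    [N tr p]. *)
Variable g : nat -> W.
Hypothesis g1 : forall j, g j ** st (g j) = e.
Hypothesis g2 : forall j, st (g j) ** g j = e.
Hypothesis g3 : forall j k, j != k -> phi (st (g k) ** g j) = 0.

Lemma no_minimal_aux : False.
Proof.
have t0 := p_xi_gt0; set t := nm (p xi) ^+ 2 in t0.
have := fun w => corner_scalar (gnsF_Lop S w).
move=> /choice[lam hlam].
have tE : dot (p xi) xi = t%:C by rewrite -pp psym (dxx hn).
have lamE w : dot (kw w) (p xi) = lam w * t%:C.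
  have FL := gnsF_Lop S w.
  rewrite -tE -(dZl dot) -hlam.
  have -> : dot (p (Lop w (p xi))) xi = tr (p \o (Lop w \o p)) by [].
  rewrite gns_trC //; last exact: gnsF_comp.
  have -> : (Lop w \o p) \o p = Lop w \o p by apply/funext => h /=; rewrite pp.
  by rewrite gns_trC // /gns_tr /comp psym Lop_xi.
have lamJ w : lam (st w) = (lam w)^*.
  have := lamE (st w); rewrite -Jop_kw [p xi](adj_xi Fp psym) dot_Jop (dC dot) lamE.
  rewrite cjM conjc_real => /mulIf -> //.
  by apply/eqP => /(congr1 (@complex.Re R)) /= h; rewrite h ltxx in t0.
have Lfold v w x : Lop (st (g v)) (Lop (g w) x) = Lop (st (g v) ** g w) x by rewrite Lop_op.
pose z k := Lop (g k) (p (Lop (st (g k)) xi)).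
have zz k j : dot (z k) (z j) = (nsq (lam (st (g j) ** g k)) * t)%:C.
  have adjL v := @Lop_adj _ _ _ _ _ _ S v.
  have aL x y : dot x (Lop (g j) y) = dot (Lop (st (g j)) x) y.
    by rewrite [in RHS]adjL (ws_stK S).
  rewrite /z aL -psym Lfold hlam (dZl dot).
  have -> : dot (p (Lop (st (g k)) xi)) (Lop (st (g j)) xi) = tr (Lop (g j) \o (p \o Lop (st (g k)))).
    by rewrite /gns_tr /comp [in RHS]adjL.
  rewrite gns_trC; [|exact: gnsF_Lop|by apply: gnsF_comp => //; exact: gnsF_Lop].
  rewrite /gns_tr /comp psym Lfold Lop_xi lamE.
  have -> : st (g k) ** g j = st (st (g j) ** g k) by rewrite (ws_stM S) (ws_stK S).
  by rewrite lamJ mulrA [lam _ * _]mulrC conjM_nsq -rmorphM.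
have Lid x : Lop e x = x.
  by apply: rkhsP => w; rewrite LopE (ws_st1 S) (ws_1w S).
have zxi k : dot (z k) xi = t%:C.
  have -> : dot (z k) xi = tr ((Lop (g k) \o p) \o Lop (st (g k))) by [].
  rewrite gns_trC; [|by apply: gnsF_comp => //; exact: gnsF_Lop|exact: gnsF_Lop].
  by rewrite /gns_tr /comp Lfold g2 Lid tE.
have bes N j : \sum_(k < N) nsq (lam (st (g j) ** g k)) * t <= 1.
  rewrite -mulr_suml -(ler_pM2r t0) mul1r -mulrA mulr_suml.
  have := @bessel _ _ _ hn N (fun k => kw (st (g j) ** g k)) (p xi).
  move=> h; apply: le_trans (h _).
    apply: ler_sum => k _; rewrite (dC dot) lamE nsqJ nsqM {3}/nsq /= expr0n addr0.
    by rewrite expr2.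
  move=> k l _ _; rewrite dot_kw kwE (ws_stM S) (ws_stK S).
  rewrite -(ws_assoc S (st (g l))) (ws_assoc S (g j)) g1 (ws_1w S).
  by have [->|kl] := eqVneq k l; [rewrite g2 (ws_1 S)|rewrite g3].
have dsl N (f : nat -> H) y : dot (\sum_(k < N) f k) y = \sum_(k < N) dot (f k) y.
  elim: N => [|N ih]; first by rewrite !big_ord0 d0l.
  by rewrite !big_ord_recr /= (dDl dot) ih.
have dsr N (f : nat -> H) y : dot y (\sum_(k < N) f k) = \sum_(k < N) dot y (f k).
  elim: N => [|N ih]; first by rewrite !big_ord0 d0r.
  by rewrite !big_ord_recr /= (dDr dot) ih.
have key (N : nat) : (N%:R * t) ^+ 2 <= N%:R.
  pose Z := \sum_(k < N) z k.
  have -> : (N%:R * t) ^+ 2 = nsq (dot Z xi).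
    rewrite dsl; under eq_bigr do rewrite zxi.
    rewrite sumr_const card_ord -[t%:C *+ N](rmorphMn (real_complex R)) /nsq /=.
    by rewrite expr0n addr0 mulr_natl.
  apply: (le_trans (dot_CS hn _ _)); rewrite (xi_norm S) expr1n mulr1 (nm_sqr hn) dsl.
  have -> : \sum_(k < N) dot (z k) Z =
      (\sum_(k < N) \sum_(j < N) nsq (lam (st (g j) ** g k)) * t)%:C.
    rewrite rmorph_sum; apply: eq_bigr => k _; rewrite dsr rmorph_sum.
    by apply: eq_bigr => j _; rewrite zz.
  rewrite /= exchange_big /=.
  have -> : (N%:R : R) = \sum_(j < N) 1 by rewrite sumr_const card_ord.
  by apply: ler_sum => j _; exact: bes.
have [N hN] := nat_above ((t ^+ 2)^-1).
have t2 : 0 < t ^+ 2 by rewrite exprn_gt0.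
have n0 : 0 < (N%:R : R) by apply: lt_trans hN; rewrite invr_gt0.
have : 1 < N%:R * t ^+ 2 by rewrite -ltr_pdivrMr // div1r.
have := key N; rewrite exprMn expr2 -mulrA -[leRHS]mulr1 (ler_pM2l n0) => h h'.
by have := lt_le_trans h' h; rewrite ltxx.
Qed.
End MinimalProjection.

Lemma gns_no_minimal (g : nat -> W) :
  (forall j, g j ** st (g j) = e) -> (forall j, st (g j) ** g j = e) ->
  (forall j k, j != k -> phi (st (g k) ** g j) = 0) ->
  forall p, ~ minimal_projection dot F p.
Proof. by move=> g1 g2 g3 p pmin; exact: no_minimal_aux pmin g g1 g2 g3. Qed.

(** A central element of [F] sends [xi] to a vector commuting with all
    translations; if only multiples of [xi] do, [F] is a factor. *)
Lemma gns_factor :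
  (forall z : H, (forall u w, z (u ** w) = z (w ** u)) -> exists c : C, z = c *: xi) ->
  vn_factor dot F.
Proof.
move=> htr; split; first exact: gns_vn.
apply/seteqP; split=> [T [FT [_ cT]]|_ [c _ <-]]; last first.
  split; first exact: gnsF_scale (gnsF_id S).
  split; first exact: gnsF_bounded (gnsF_scale c (gnsF_id S)).
  by move=> A FA; apply/funext => x /=; rewrite (op_scale (gnsF_lin FA)).
have [|c hc] := htr (T xi).
  move=> u w.
  have := congr1 (fun f => f xi) (cT (Lop (st u)) (gnsF_Lop S (st u))).
  rewrite /comp Lop_xi (gnsF_kw _ FT) => /(congr1 (fun h : H => h w)).
  by rewrite LopE RopE (ws_stK S) => ->.
have adj := AdjP (gnsF_bounded FT); set Ts := Adj _ in adj.
have FTs := gnsF_adj FT adj.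
have Txi : Ts xi = c^* *: xi by rewrite (adj_xi FT adj) hc Jop_Z Jop_xi.
have Tk w : Ts (kw w) = c^* *: kw w.
  by rewrite (gnsF_kw _ FTs) Txi (op_scale (@Rop_lin _ _ _ _ _ _ S w)) Rop_xi.
exists c => //; apply/funext => x; apply: rkhsP => w.
by rewrite -[in RHS]dot_kw adj Tk (dZr dot) cjK dot_kw.
Qed.

Lemma gns_II1 (g : nat -> W) :
  (forall j, g j ** st (g j) = e) -> (forall j, st (g j) ** g j = e) ->
  (forall j k, j != k -> phi (st (g k) ** g j) = 0) ->
  (forall z : H, (forall u w, z (u ** w) = z (w ** u)) -> exists c : C, z = c *: xi) ->
  II1_factor dot F.
Proof.
move=> g1 g2 g3 htr; split.
- exact: gns_factor.
- exists xi; apply/eqP => h; have := xi_norm S; rewrite h nm0 => /eqP.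
  by rewrite eq_sym oner_eq0.
- exact: gns_finite.
- exact: gns_no_minimal g1 g2 g3.
Qed.
End GNSFactor.

(** * Products of positive definite kernels *)
Section KernelCalculus.
Variables (R : realType).
Local Notation C := R[i].

Lemma formE (W : Type) (K : W -> W -> C) s t :
  ev (vec K s) t = \sum_(y <- t) \sum_(x <- s) y.1^* * (x.1 * K x.2 y.2).
Proof. by rewrite /ev /vec; apply: eq_bigr => y _; rewrite mulr_sumr. Qed.

Lemma kernel_CS0 (W : Type) (K : W -> W -> C) v w : pdkernel K -> K v v = 0 -> K v w = 0.
Proof.
move=> pK h; have := form_CS pK [:: (1, v)] [:: (1, w)].
rewrite vec1 scale1r ev1 conjc1 mul1r.
have -> : qf K [:: (1, v)] = 0 by rewrite /qf vec1 scale1r ev1 h mulr0.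
rewrite mul0r => h2; apply/nsq_eq0/le_anti.
by rewrite h2 nsq_ge0.
Qed.

(** One step of Gaussian elimination at [w0] stays positive definite, by
    Cauchy-Schwarz. *)
Definition schur_compl (W : Type) (K : W -> W -> C) w0 : W -> W -> C :=
  fun v w => K v w - (K w0 w0)^-1 * (K v w0 * K w0 w).

Lemma schur_compl_pd (W : Type) (K : W -> W -> C) w0 : pdkernel K -> K w0 w0 != 0 ->
  pdkernel (schur_compl K w0).
Proof.
move=> pK k0; have hK := pK.1.
have [k [kE kpos]] : exists k : R, K w0 w0 = k%:C /\ 0 < k.
  have := pK.2 [:: (1, w0)]; rewrite vec1 scale1r ev1 conjc1 mul1r => /Cge0P[e h].
  exists (complex.Re (K w0 w0)); split=> //; rewrite lt_def h andbT.
  by apply: contra k0 => /eqP h0; rewrite e h0.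
have kV : (K w0 w0)^-1 = (k^-1)%:C by rewrite kE fmorphV.
split=> [v w|s].
  rewrite /schur_compl kV cjD cjN !cjM conjc_real -!hK; congr (_ - _ * _).
  by rewrite mulrC.
have -> : ev (vec (schur_compl K w0) s) s =
    ev (vec K s) s - (k^-1)%:C * (ev (vec K s) [:: (1, w0)] * ev (K w0) s).
  rewrite ev1 conjc1 mul1r /ev /vec !mulr_sumr -sumrB; apply: eq_bigr => y _.
  rewrite !mulr_sumr /schur_compl !mulr_suml mulr_sumr -sumrB.
  apply: eq_bigr => x _; rewrite kV; ring.
have -> : ev (K w0) s = (ev (vec K s) [:: (1, w0)])^*.
  by rewrite form_herm // vec1 scale1r cjK.
rewrite [X in _ * X]mulrC conjM_nsq -(rmorphM (real_complex R)) (qfE pK) -rmorphB.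
rewrite realC_ge0 subr_ge0 mulrC ler_pdivrMr //.
have := form_CS pK s [:: (1, w0)].
suff -> : qf K [:: (1, w0)] = k by [].
by rewrite /qf vec1 scale1r ev1 conjc1 mul1r kE.
Qed.

(** Schur's product theorem: eliminating one point of a finite set at a time
    writes the first kernel as a sum of rank one kernels. *)
Lemma pdkernelM (W : eqType) (K1 K2 : W -> W -> C) : pdkernel K1 -> pdkernel K2 ->
  pdkernel (fun v w => K1 v w * K2 v w).
Proof.
move=> pK1 pK2; split=> [v w|s]; first by rewrite cjM -pK1.1 -pK2.1.
(* Induction on the number of points with nonzero diagonal value: eliminating
   [w0] makes its diagonal value vanish, and zero values remain zero. *)
have [m] := ubnP (count (fun x => K1 x.2 x.2 != 0) s).
elim: m K1 pK1 => // m ih K1 pK1 cm.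
have [|] := boolP (has (fun x => K1 x.2 x.2 != 0) s); last first.
  move=> /hasPn nh; rewrite formE big_seq big1 // => y ys.
  rewrite big_seq big1 // => x xs; rewrite (kernel_CS0 _ pK1) ?mul0r ?mulr0 //.
  by apply/eqP; have := nh _ xs; rewrite negbK.
have hK := pK1.1.
move=> hs; have [w0 [k0 hin]] : exists w0, K1 w0 w0 != 0 /\ has (fun x => x.2 == w0) s.
  by move/hasP: hs => [x xs h]; exists x.2; split=> //; apply/hasP; exists x.
have pS := schur_compl_pd pK1 k0.
have : (count (fun x => schur_compl K1 w0 x.2 x.2 != 0%R) s < m)%N.
  rewrite ltnS in cm; apply: leq_trans _ cm => {ih}.
  have imp x : schur_compl K1 w0 x x != 0 -> K1 x x != 0.
    by apply: contra => /eqP h; rewrite /schur_compl h (kernel_CS0 _ pK1 h) mul0r mulr0 subrr.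
  have z0 : schur_compl K1 w0 w0 w0 = 0.
    by rewrite /schur_compl mulrA mulVf // mul1r subrr.
  elim: s hin {hs} => //= x s ih' /orP[/eqP xw|/ih' lt].
    rewrite xw z0 eqxx k0 add0n add1n ltnS.
    by apply: sub_count => y; exact: imp.
  have := imp x.2; case: (schur_compl K1 w0 x.2 x.2 != 0) => [/(_ isT) ->|_].
    by rewrite !add1n ltnS.
  by rewrite add0n; apply: leq_trans lt _; rewrite leq_addl.
move=> /(ih _ pS) h.
have [k [kE kpos]] : exists k : R, K1 w0 w0 = k%:C /\ 0 < k.
  have := pK1.2 [:: (1, w0)]; rewrite vec1 scale1r ev1 conjc1 mul1r => /Cge0P[e h0].
  exists (complex.Re (K1 w0 w0)); split=> //; rewrite lt_def h0 andbT.
  by apply: contra k0 => /eqP h1; rewrite e h1.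
pose s' := [seq (x.1 * K1 x.2 w0, x.2) | x <- s].
have -> : ev (vec (fun v w => K1 v w * K2 v w) s) s =
   ev (vec (fun v w => schur_compl K1 w0 v w * K2 v w) s) s +
   (k^-1)%:C * ev (vec K2 s') s'.
  rewrite !formE /s' big_map /= mulr_sumr -big_split; apply: eq_bigr => y _ /=.
  rewrite big_map mulr_sumr -big_split; apply: eq_bigr => x _ /=.
  rewrite cjM -hK /schur_compl kE -fmorphV /=; ring.
by apply: addr_ge0 => //; apply: mulr_ge0; [rewrite realC_ge0 invr_ge0 ltW|exact: pK2.2].
Qed.

Lemma pdkernel_pull (V W : Type) (f : W -> V) (K : V -> V -> C) : pdkernel K ->
  pdkernel (fun v w => K (f v) (f w)).
Proof.
move=> pK; split=> [v w|s]; first exact: pK.1.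
have := pK.2 [seq (x.1, f x.2) | x <- s].
by rewrite !formE big_map; under eq_bigr do rewrite big_map.
Qed.

Lemma pdkernel_eq (V : eqType) : pdkernel (fun v w : V => (v == w)%:R : C).
Proof.
split=> [v w|s]; first by rewrite eq_sym; case: eqP => _; rewrite ?conjc1 ?conjc0.
have Su : forall u, \sum_(x <- s) x.1 * (x.2 == u)%:R = \sum_(x <- s | x.2 == u) x.1.
  move=> u; rewrite [RHS]big_mkcond; apply: eq_bigr => x _.
  by case: eqP => _; rewrite ?mulr1 ?mulr0.
pose U := undup (map snd s).
pose T u := \sum_(x <- s | x.2 == u) x.1.
suff -> : ev (vec (fun v w : V => (v == w)%:R) s) s = \sum_(u <- U) (T u)^* * T u.
  by apply: sumr_ge0 => u _; rewrite conjM_nsq realC_ge0 nsq_ge0.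
rewrite /ev /vec; under eq_bigr do rewrite Su -/(T _).
rewrite (eq_big_seq (fun y => \sum_(u <- U) (if y.2 == u then y.1^* * T u else 0))); last first.
  move=> y ys.
  have yU : y.2 \in U by rewrite mem_undup map_f.
  rewrite (bigD1_seq y.2) ?undup_uniq //= eqxx big1 ?addr0 // => u.
  by rewrite eq_sym => /negPf ->.
rewrite exchange_big /=; apply: eq_bigr => u _.
rewrite {2}/T (big_morph _ (@cjD R) (conjc0 _)) mulr_suml [RHS]big_mkcond.
by apply: eq_bigr => y _.
Qed.

Lemma pdkernel1 (W : Type) : pdkernel (fun _ _ : W => 1 : C).
Proof.
have := pdkernel_pull (fun _ : W => tt) (pdkernel_eq unit).
by congr pdkernel; apply/funext => v; apply/funext => w; rewrite eqxx.
Qed.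

Lemma pdkernel_prod (W : eqType) (I : Type) (r : seq I) (K : I -> W -> W -> C) :
  (forall i, pdkernel (K i)) -> pdkernel (fun v w => \prod_(i <- r) K i v w).
Proof.
move=> pK; elim: r => [|i r ih].
  have := pdkernel1 W; congr pdkernel; apply/funext => v; apply/funext => w.
  by rewrite big_nil.
have := pdkernelM (pK i) ih; congr pdkernel; apply/funext => v; apply/funext => w.
by rewrite big_cons.
Qed.
End KernelCalculus.

(** * Enlarging a state until its algebra is a factor *)
Section Parity.
Variables (R : realType) (n : nat) (phi : seq 'I_n -> R[i]).
Hypothesis S : word_state cat [::] rev phi.
Local Notation C := R[i].
Local Notation A := (option 'I_n).

(** In the state [ophi] the extra letter [None] is a symmetry of trace zero,
    independent of the other letters. *)
Definition par (v : seq A) : bool := odd (count_mem None v).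
Definition ophi (v : seq A) : C := phi (pmap id v) * (~~ par v)%:R.

Lemma par_cat v w : par (v ++ w) = par v (+) par w.
Proof. by rewrite /par count_cat oddD. Qed.
Lemma par_rev v : par (rev v) = par v.
Proof. by rewrite /par count_rev. Qed.

Lemma pmap_rev (v : seq A) : pmap id (rev v) = rev (pmap id v).
Proof.
elim: v => //= x v ih; rewrite rev_cons -cats1 pmap_cat ih.
by case: x => [a|] /=; rewrite ?cats0 // rev_cons cats1.
Qed.

Lemma ophi_state : word_state cat [::] rev ophi.
Proof.
apply: free_word_state.
- by move=> v w; rewrite /ophi !pmap_cat (ws_tr S) !par_cat addbC.
- move=> w; rewrite /ophi pmap_rev (ws_st S) par_rev cjM.
  by congr (_ * _); apply: Ceq; case: (par w); rewrite ?Csimpl //= oppr0.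
- by rewrite /ophi /= (ws_1 S) mulr1.
- move=> w; rewrite /ophi nsqM.
  case: par => /=; rewrite /nsq /= expr0n /=; first by rewrite addr0 mulr0.
  by rewrite expr1n addr0 mulr1; exact: (ws_le1 S).
- have p1 := pdkernel_pull (pmap id) (sker_pd S).
  have p2 := pdkernel_pull par (pdkernel_eq R bool).
  move=> s; have := (pdkernelM p1 p2).2 s; congr (0 <= ev (vec _ s) s).
  apply/funext => v; apply/funext => w.
  rewrite /ophi /sker pmap_cat pmap_rev par_cat par_rev; congr (_ * (_)%:R).
  by case: (par v) (par w) => [] [].
Qed.

Lemma ophi_None : ophi [:: None] = 0.
Proof. by rewrite /ophi /par /= mulr0. Qed.
Lemma ophi_None2 v : ophi (v ++ [:: None; None]) = ophi v.
Proof. by rewrite /ophi pmap_cat par_cat /= cats0 /par /= addbF. Qed.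
Lemma ophi_Some w : ophi (map Some w) = phi w.
Proof.
have -> : ophi (map Some w) = phi w * 1; last by rewrite mulr1.
rewrite /ophi; congr (phi _ * _); first by elim: w => //= x w ->.
by have -> : par (map Some w) = false by rewrite /par; elim: w.
Qed.
End Parity.

Section Sites.
Variables (R : realType) (A : countType) (psi : seq A -> R[i]).
Hypothesis S : word_state cat [::] rev psi.
Local Notation C := R[i].
Local Notation sword := (seq (A * int)).

Definition site (s : int) (w : sword) : seq A := [seq x.1 | x <- w & x.2 == s].
Definition sites (w : sword) : seq int := undup [seq x.2 | x <- w].
(** The infinite product of copies of [psi]: letters sitting at different sites
    are independent. *)
Definition Psi (w : sword) : C := \prod_(s <- sites w) psi (site s w).
Definition shift (g : int) (w : sword) : sword := [seq (x.1, x.2 + g) | x <- w].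

Lemma site_cat s v w : site s (v ++ w) = site s v ++ site s w.
Proof. by rewrite /site filter_cat map_cat. Qed.
Lemma site_rev s w : site s (rev w) = rev (site s w).
Proof. by rewrite /site filter_rev map_rev. Qed.
Lemma site_shift s g w : site (s + g) (shift g w) = site s w.
Proof.
rewrite /site /shift filter_map -map_comp; congr map.
by apply: eq_filter => x /=; rewrite (inj_eq (addIr g)).
Qed.
Lemma site_nil s w : s \notin sites w -> site s w = [::].
Proof.
rewrite mem_undup => h; rewrite /site.
suff -> : [seq x <- w | x.2 == s] = [::] by [].
apply/eqP; rewrite -(negbK (_ == _)) -has_filter; apply/negP => /hasP[x xw /eqP e].
by move: h; rewrite -e map_f.
Qed.
Lemma mem_sites_cat s v w : (s \in sites (v ++ w)) = (s \in sites v) || (s \in sites w).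
Proof. by rewrite !mem_undup map_cat mem_cat. Qed.
Lemma mem_sites_rev s w : (s \in sites (rev w)) = (s \in sites w).
Proof. by rewrite !mem_undup map_rev mem_rev. Qed.
Lemma mem_sites_shift s g w : (s \in sites (shift g w)) = (s - g \in sites w).
Proof.
rewrite !mem_undup /shift -map_comp; apply/mapP/mapP => -[x xw e]; exists x => //=.
  by rewrite e /= addrK.
by rewrite -e subrK.
Qed.

(** Empty sites contribute the factor 1, so the product may be taken over any
    set of sites that covers the word; this aligns the sites of several
    words. *)
Lemma Psi_super (T : seq int) w : uniq T -> {subset sites w <= T} ->
  Psi w = \prod_(s <- T) psi (site s w).
Proof.
move=> uT sT; rewrite (bigID (mem (sites w))) /= [X in _ * X]big1 ?mulr1.
  rewrite -big_filter /Psi; apply: perm_big; apply: uniq_perm.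
  - exact: undup_uniq.
  - exact: filter_uniq.
  - by move=> s; rewrite mem_filter; case: (boolP (s \in sites w)) => [/sT ->|].
by move=> s h; rewrite site_nil // (ws_1 S).
Qed.

Lemma Psi_cat_disjoint v w : (forall s, s \in sites v -> s \notin sites w) ->
  Psi (v ++ w) = Psi v * Psi w.
Proof.
move=> dis; pose T := sites (v ++ w).
have uT : uniq T by exact: undup_uniq.
rewrite (@Psi_super T v) //; last by move=> s h; rewrite mem_sites_cat h.
rewrite (@Psi_super T w) //; last by move=> s h; rewrite mem_sites_cat h orbT.
rewrite -big_split; apply: eq_bigr => s _; rewrite site_cat.
have [sv|sv] := boolP (s \in sites v).
  by rewrite (site_nil (dis s sv)) cats0 (ws_1 S) /= mulr1.
by rewrite (site_nil sv) (ws_1 S) /= mul1r.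
Qed.

Lemma Psi_shift g w : Psi (shift g w) = Psi w.
Proof.
rewrite (@Psi_super [seq s + g | s <- sites w]); last 2 first.
- by rewrite map_inj_uniq ?undup_uniq //; exact: addIr.
- move=> s; rewrite mem_sites_shift => h; apply/mapP; exists (s - g) => //.
  by rewrite subrK.
by rewrite big_map; apply: eq_bigr => s _; rewrite site_shift.
Qed.

Lemma Psi_rev w : Psi (rev w) = (Psi w)^*.
Proof.
rewrite (@Psi_super (sites w)); last 2 first.
- exact: undup_uniq.
- by move=> s; rewrite mem_sites_rev.
rewrite /Psi (big_morph _ (@cjM R) (conjc1 _)); apply: eq_bigr => s _.
by rewrite site_rev (ws_st S).
Qed.

Lemma Psi_tr v w : Psi (v ++ w) = Psi (w ++ v).
Proof.
rewrite (@Psi_super (sites (v ++ w)) (w ++ v)); last 2 first.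
- exact: undup_uniq.
- by move=> s; rewrite !mem_sites_cat orbC.
by apply: eq_bigr => s _; rewrite !site_cat (ws_tr S).
Qed.

Lemma Psi_le1 w : nsq (Psi w) <= 1.
Proof.
rewrite /Psi; apply: (big_ind (fun z => nsq z <= 1)).
- by rewrite /nsq /= expr0n expr1n addr0.
- by move=> x y hx hy; rewrite nsqM mulr_ile1 ?nsq_ge0.
- by move=> s _; exact: (ws_le1 S).
Qed.

Lemma Psi_pd : pdkernel (fun v w => Psi (rev w ++ v)).
Proof.
split=> [v w|s]; first by rewrite -Psi_rev rev_cat revK.
pose T := sites (flatten [seq x.2 | x <- s]).
have sub x : x \in s -> {subset sites x.2 <= T}.
  move=> xs i; rewrite !mem_undup => /mapP[a ax ->]; apply: map_f.
  by apply/flattenP; exists x.2 => //; apply: map_f.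
have := (pdkernel_prod T (fun i : int => pdkernel_pull (site i) (sker_pd S))).2 s.
congr (_ <= _); rewrite !formE; apply: eq_big_seq => y ys; apply: eq_big_seq => x xs.
congr (_ * (_ * _)); rewrite (@Psi_super T).
- by apply: eq_bigr => i _; rewrite /sker site_cat site_rev.
- exact: undup_uniq.
- move=> i; rewrite mem_sites_cat mem_sites_rev => /orP[]; exact: sub.
Qed.

(** The crossed product by the shift of the sites: the word [w] followed by the
    group element [g]. *)
Definition cword : countType := (seq (A * int) * int)%type.
Definition cop (v w : cword) : cword := (v.1 ++ shift v.2 w.1, v.2 + w.2).
Definition cst (w : cword) : cword := (shift (- w.2) (rev w.1), - w.2).
Definition cone : cword := ([::], 0).
Definition cphi (w : cword) : C := if w.2 == 0 then Psi w.1 else 0.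

Lemma shift_cat g v w : shift g (v ++ w) = shift g v ++ shift g w.
Proof. exact: map_cat. Qed.
Lemma shift_rev g w : shift g (rev w) = rev (shift g w).
Proof. exact: map_rev. Qed.
Lemma shift_shift g h w : shift g (shift h w) = shift (h + g) w.
Proof. by rewrite /shift -map_comp; apply: eq_map => x /=; rewrite addrA. Qed.
Lemma shift0 w : shift 0 w = w.
Proof. by rewrite /shift -[RHS]map_id; apply: eq_map => -[a s] /=; rewrite addr0. Qed.

Lemma cop_st v w : cop (cst w) v = (shift (- w.2) (rev w.1 ++ v.1), v.2 - w.2).
Proof. by rewrite /cop /cst /= shift_cat addrC. Qed.
(** In the crossed product the kernel is block diagonal in the group element,
    and each block is a copy of the kernel of the product state. *)
Lemma cphi_st v w : cphi (cop (cst w) v) = if v.2 == w.2 then Psi (rev w.1 ++ v.1) else 0.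
Proof. by rewrite cop_st /cphi /= subr_eq0 Psi_shift. Qed.

Lemma cphi_state : word_state cop cone cst cphi.
Proof.
split.
- move=> [u g] [v h] [w k]; rewrite /cop /=; congr pair; last by rewrite addrA.
  by rewrite shift_cat shift_shift catA addrC.
- by move=> [w g]; rewrite /cop /= shift0 add0r.
- by move=> [w g]; rewrite /cop /= cats0 addr0.
- by move=> [w g]; rewrite /cst /= opprK -shift_rev revK shift_shift addNr shift0.
- move=> [v g] [w h]; rewrite /cst /cop /= rev_cat shift_cat -!shift_rev !shift_shift.
  have -> : g - (g + h) = - h by ring.
  by rewrite opprD [- g - h]addrC.
- move=> [v g] [w h]; rewrite /cphi /cop /= [h + g]addrC.
  case: eqP => // gh; have -> : h = - g by apply/eqP; rewrite -addr_eq0 addrC gh.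
  rewrite -(Psi_shift g (w ++ _)) shift_cat shift_shift addNr shift0.
  exact: Psi_tr.
- move=> [w g]; rewrite /cphi /cst /= oppr_eq0 Psi_shift Psi_rev.
  by case: eqP; rewrite ?conjc0.
- by rewrite /cphi /= /Psi /sites /= big_nil.
- move=> w; rewrite /cphi; case: eqP => _; first exact: Psi_le1.
  by rewrite /nsq /= expr0n addr0.
- move=> s; have := (pdkernelM (pdkernel_pull (fun w : cword => w.2) (pdkernel_eq R int))
     (pdkernel_pull (fun w : cword => w.1) Psi_pd)).2 s.
  congr (0 <= ev (vec _ s) s); apply/funext => v; apply/funext => w.
  by rewrite cphi_st; case: eqP; rewrite ?mul1r ?mul0r.
Qed.

Lemma cphi_site0 (a : seq A) : cphi ([seq (x, 0) | x <- a], 0) = psi a.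
Proof.
rewrite /cphi /= (@Psi_super [:: 0]) //; last first.
  move=> s; rewrite mem_undup -map_comp => /mapP[x _ ->]; exact: mem_head.
rewrite big_seq1 /site; congr psi; elim: a => //= x a ih.
by rewrite ih.
Qed.

(** ** The crossed product is a factor *)
Variable y : A.
Hypothesis y1 : psi [:: y] = 0.
Hypothesis y2 : forall v, psi (v ++ [:: y; y]) = psi v.
Let CS := cphi_state.
Local Notation H := (rkhs (sker_pd CS)).
Local Notation kw := (@kw R cword cop cone cst cphi CS).
Local Notation dot := (rk_dot (sker_pd CS)).
Local Notation xi := (kw cone).
Let hn := @rk_hilbert_norm R cword _ (sker_pd CS).
Local Notation "v ** w" := (cop v w) (at level 40, left associativity).

(** The means of [E 0], ..., [E (N - 1)] tend to zero, so a bounded orthogonal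
    sequence cannot have a constant nonzero pairing with [z]. *)
Lemma const_on_orthogonal (K : completeNormedModType C) (d : {dot K for @Num.conj C})
    (dn : hilbert_norm d) (z : K) (c : C) (M : R) (E : nat -> K) :
  (forall j k, j != k -> d (E j) (E k) = 0) -> (forall k, nm (E k) ^+ 2 <= M) ->
  (forall k, d z (E k) = c) -> c = 0.
Proof.
move=> ort nE zE.
have dz N : d z (\sum_(k < N) E k) = c *+ N.
  elim: N => [|N ih]; first by rewrite big_ord0 d0r.
  by rewrite big_ord_recr /= dDr ih zE mulrSr.
have dE N k : (N <= k)%N -> d (\sum_(j < N) E j) (E k) = 0.
  elim: N => [|N ih] Nk; first by rewrite big_ord0 d0l.
  by rewrite big_ord_recr /= dDl (ih (ltnW Nk)) add0r ort // neq_ltn Nk.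
have nN N : nm (\sum_(k < N) E k) ^+ 2 <= N%:R * M.
  elim: N => [|N ih]; first by rewrite big_ord0 nm0 expr0n mul0r.
  rewrite big_ord_recr /= (nm_sqrD dn) dE // mulr0 addr0 -natr1 mulrDl mul1r.
  exact: lerD.
apply: nsq_eq0; apply/eqP; rewrite eq_le nsq_ge0 andbT leNgt; apply/negP => cp.
pose B := nm z ^+ 2 * M.
(* For such [N], the sum of the first [N] vectors violates Cauchy-Schwarz. *)
have [N hN] := nat_above (B / nsq c).
rewrite ltr_pdivrMr // in hN.
have M0 : 0 <= M by apply: le_trans (nE 0%N); exact: sqr_ge0.
have B0 : 0 <= B by rewrite mulr_ge0 ?sqr_ge0.
have N0 : 0 < (N%:R : R) by have := le_lt_trans B0 hN; rewrite pmulr_lgt0.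
have := dot_CS dn z (\sum_(k < N) E k); rewrite dz.
have -> : nsq (c *+ N) = N%:R * (N%:R * nsq c).
  have -> : c *+ N = (N%:R)%:C * c by rewrite (rmorph_nat (real_complex R)) mulr_natl.
  by rewrite nsqM {1}/nsq /= expr0n addr0 expr2 mulrA.
have := nN N; have := sqr_ge0 (nm z) => z0 h1 h2.
have h3 : nm z ^+ 2 * nm (\sum_(k < N) E k) ^+ 2 <= N%:R * B.
  apply: (le_trans (ler_wpM2l z0 h1)); rewrite /B; lra.
have := le_trans h2 h3; rewrite (ler_pM2l N0) => h4.
by have := lt_le_trans hN h4; rewrite ltxx.
Qed.

(** Distinct multiples of [spread w g] differ by more than the size of [g] plus
    twice that of any site of [w], so translates of [w] by them are disjoint. *)
Definition spread (w : sword) (g : int) : nat :=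
  (`|g|%N + (\sum_(x <- w) `|x.2|%N).*2).+1.
Definition far (w : sword) (g : int) (k : nat) : int := (spread w g * k.+1)%N%:Z.

Lemma site_bound w s : s \in sites w -> (`|s| <= \sum_(x <- w) `|x.2|)%N.
Proof.
rewrite mem_undup; elim: w => //= x w ih; rewrite inE big_cons => /orP[/eqP ->|/ih h].
  exact: leq_addr.
by apply: leq_trans h _; exact: leq_addl.
Qed.

Lemma far_dist w g j k : j != k -> (spread w g <= `|far w g j - far w g k|)%N.
Proof.
rewrite /far; move: (spread w g) => B jk.
have [lt|lt|e] := ltngtP j k; last by rewrite e eqxx in jk.
  have : (B * j.+1 + B <= B * k.+1)%N by rewrite -mulnSr leq_mul2l ltnS lt orbT.
  lia.
have : (B * k.+1 + B <= B * j.+1)%N by rewrite -mulnSr leq_mul2l ltnS lt orbT.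
lia.
Qed.

Lemma far_big w g k : (spread w g <= `|far w g k|)%N.
Proof. by rewrite /far absz_nat leq_pmulr. Qed.

Lemma kw_eq x x' : (forall v, cphi (v ** x) = cphi (v ** x')) -> kw x = kw x'.
Proof. by move=> h; apply: rkhsP => v; rewrite !kwE. Qed.

(** The letter [y], of square one and trace zero, placed at site [t]. *)
Definition lamp (t : int) : cword := ([:: (y, t)], 0).

Lemma lamp2 x t : kw (x ** (lamp t ** lamp t)) = kw x.
Proof.
apply: kw_eq => v; rewrite (ws_assoc CS); move: (v ** x) => [w g].
rewrite /cphi /cop /= !addr0; case: eqP => // _.
set u := t + g.
pose T := undup (u :: sites w).
rewrite (@Psi_super T w) ?undup_uniq //; last by move=> s h; rewrite mem_undup inE h orbT.
rewrite (@Psi_super T) ?undup_uniq //; last first.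
  move=> s; rewrite mem_sites_cat [s \in T]mem_undup inE => /orP[->|]; first by rewrite orbT.
  by rewrite mem_undup !inE orbb => ->.
apply: eq_bigr => s _; rewrite site_cat {2}/site /=.
by case: eqP => /= _; rewrite ?y2 ?cats0.
Qed.

Lemma nm_kw x : nm (kw x) ^+ 2 <= 1.
Proof.
have := ws_le1 CS (cst x ** x).
rewrite (nm_sqr hn) dot_kw kwE; set c := cphi _ => h.
have : complex.Re c ^+ 2 <= nsq c by rewrite lerDl sqr_ge0.
nra.
Qed.

(** Conjugating [(w, g)] by the unitary [lamp (t k)] does not change the
    value of a central vector, but the conjugates are orthogonal for distinct
    [k], since [g] moves one of the two lamps away from the other. *)
Lemma central_twisted (z : H) (w : sword) (g : int) : (forall u v, z (u ** v) = z (v ** u)) ->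
  g != 0 -> z (w, g) = 0.
Proof.
move=> hz g0.
pose t k := far w g k.
pose x k : cword := lamp (t k) ** ((w, g) ** lamp (t k)).
apply: (@const_on_orthogonal H dot hn z _ 1 (fun k => kw (x k))).
- move=> j k jk; rewrite dot_kw kwE cphi_st /=.
  rewrite !add0r addr0 eqxx !shift0.
  pose u := rev ((y, t k) :: w ++ [:: (y, t k + g)]) ++ (y, t j) :: w ++ [:: (y, t j + g)].
  have tw : t j \notin sites w.
    apply/negP => /site_bound; have := far_big w g j; rewrite -/(t j) /spread; lia.
  have d := far_dist w g jk; rewrite -/(t j) -/(t k) /spread in d.
  have sw : site (t j) w = [::] by exact: site_nil.
  (* At site [t j] the product state sees a single [y], of value 0. *)
  have su : site (t j) u = [:: y].
    rewrite /u site_cat site_rev -(cat1s _ (w ++ _)) -(cat1s (y, t j)) !site_cat sw /site /=.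
    have -> : (t k == t j) = false by lia.
    have -> : (t k + g == t j) = false by lia.
    have -> : (t j + g == t j) = false by lia.
    by rewrite eqxx.
  have uj : t j \in sites u.
    by apply: contraT => /site_nil; rewrite su.
  by rewrite -/u /Psi (bigD1_seq (t j)) ?undup_uniq //= su y1 mul0r.
- by move=> k; exact: nm_kw.
- by move=> k; rewrite dot_kw hz -(ws_assoc CS) -dot_kw lamp2 dot_kw.
Qed.

(** Conjugating [w] by far shifts gives words that become independent: after
    their mean is subtracted they are orthogonal. *)
Lemma central_untwisted (z : H) (w : sword) : (forall u v, z (u ** v) = z (v ** u)) ->
  z (w, 0) = z cone * (Psi w)^*.
Proof.
move=> hz; apply/eqP; rewrite -subr_eq0; apply/eqP.
pose t k := far w 0 k.
pose x k : cword := (shift (t k) w, 0).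
have e1 k : cphi (x k) = Psi w by rewrite /cphi /= Psi_shift.
have e2 k : dot (kw (x k)) xi = Psi w.
  by rewrite dot_kw kwE (ws_st1 CS) (ws_1w CS) e1.
have e3 k : dot xi (kw (x k)) = (Psi w)^* by rewrite (dC dot) e2.
have e4 : dot xi xi = 1 by rewrite dot_kw kwE (ws_st1 CS) (ws_1w CS) (ws_1 CS).
apply: (@const_on_orthogonal H dot hn z _ 4 (fun k => kw (x k) - Psi w *: xi)).
- move=> j k jk.
  rewrite (dDl dot) (dDr dot) (dDr dot (- _)) !(dNl dot) !(dNr dot) !(dZl dot) !(dZr dot).
  rewrite e2 e3 e4 dot_kw kwE cphi_st /= Psi_cat_disjoint.
    by rewrite Psi_rev !Psi_shift; ring.
  move=> s; rewrite mem_sites_rev !mem_sites_shift => h1; apply/negP => h2.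
  have := far_dist w 0 jk; have := site_bound h1; have := site_bound h2.
  rewrite -/(t j) -/(t k) /spread; lia.
- move=> k; have := nmD (kw (x k)) (- (Psi w *: xi)); rewrite nmN nmZ (xi_norm CS) mulr1.
  have h1 : nm (kw (x k)) <= 1.
    by have := nm_kw (x k); rewrite -[X in _ <= X -> _](expr1n R 2) ler_pXn2r ?nnegrE ?nm_ge0.
  have h2 : Num.sqrt (nsq (Psi w)) <= 1.
    by rewrite -[leRHS]sqrtr1 ler_sqrt // Psi_le1.
  have := nm_ge0 (kw (x k) - Psi w *: xi); nra.
- move=> k; rewrite (dDr dot) (dNr dot) (dZr dot) !dot_kw mulrC; congr (_ - _).
  pose G s : cword := ([::], s).
  have -> : x k = G (t k) ** ((w, 0) ** G (- t k)).
    by rewrite /cop /= cats0 add0r addrN.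
  rewrite hz -(ws_assoc CS); congr (rkf z).
  by rewrite /cop /= cats0 add0r addNr.
Qed.

Lemma crossed_II1 : II1_factor dot (@gnsF R cword cop cone cst cphi CS).
Proof.
apply: (@gns_II1 _ _ _ _ _ _ CS (fun k => ([::], k%:Z))).
- by move=> j; rewrite /cop /cst /= subrr.
- by move=> j; rewrite /cop /cst /= addNr.
- move=> j k jk; rewrite cphi_st /=; case: eqP => // -[e].
  by rewrite e eqxx in jk.
move=> z hz; exists (z cone); apply: rkhsP => -[w g].
rewrite rkfZ -[RHS]/(z cone * xi (w, g)) kwE (ws_w1 CS) (ws_st CS) /cphi /=.
have [->|g0] := eqVneq g 0; first exact: central_untwisted.
by rewrite central_twisted // conjc0 mulr0.
Qed.
End Sites.

(** * Noncommutative polynomials and their states *)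
Section PolynomialWords.
Variables (R : realType) (n : nat).
Local Notation C := R[i].
Local Notation ncp := (ncpoly R n).
Local Notation word := (word n).
Local Notation ncword := (@ncword R n).
Implicit Types (f g h : ncp) (v w : word) (c d : C).

Definition pol (s : seq (C * word)) : ncp := \sum_(x <- s) x.1 *: ncword x.2.
Definition comb (f : ncp) : seq (C * word) := [seq (mcoeff w f, w) | w <- msupp f].

Lemma mcoeff_ncword v w : mcoeff v (ncword w) = (w == v)%:R :> C.
Proof. by rewrite /ncword mcoeffU. Qed.
Lemma mkmalgUZ (w : word) (c : C) : mkmalgU w c = c *: ncword w :> ncp.
Proof. by apply/malgP => v; rewrite mcoeffZ mcoeff_ncword mcoeffU mulr_natr. Qed.
Lemma combK f : pol (comb f) = f.
Proof.
rewrite /pol /comb big_map [RHS]monalgE; apply: eq_bigr => w _ /=.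
by rewrite mkmalgUZ.
Qed.
Lemma ncword1 : ncword [::] = 1.
Proof. by []. Qed.
Lemma ncwordM v w : ncword v * ncword w = ncword (v ++ w).
Proof.
rewrite malgME /ncword !msuppU oner_eq0 !big_seq_fset1 !mcoeffU !eqxx.
by rewrite mulr1.
Qed.

Lemma ncscaleAr c f g : f * (c *: g) = c *: (f * g).
Proof.
have e (k : ncp) : k * malgC c = c *: k.
  rewrite -[LHS]/(fgmul k (malgC c)) fgmulgU [in RHS](monalgE k) scaler_sumr.
  by apply: eq_bigr => w _; rewrite mulm1 !mkmalgUZ scalerA mulrC.
by rewrite -mul_malgC mulrA e scalerAl.
Qed.

Lemma mcoeff_ncstar w f : mcoeff w (ncstar f) = (mcoeff (rev w) f)^*.
Proof.
rewrite /ncstar raddf_sum /=.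
rewrite (eq_bigr (fun v : word => if v == rev w then (mcoeff v f)^* else 0)); last first.
  move=> v _; rewrite mcoeffU.
  have -> : (v == rev w) = (rev v == w) by rewrite -(inj_eq (can_inj revK) v) revK.
  by case: eqP.
have [h|h] := boolP (rev w \in msupp f).
  rewrite (bigD1_seq (rev w)) ?fset_uniq //= eqxx big1 ?addr0 // => v.
  by case: eqP.
rewrite big_seq big1 ?mcoeff_outdom ?conjc0 // => v vf.
by case: eqP => // e; rewrite -e vf in h.
Qed.

Lemma ncstarD f g : ncstar (f + g) = ncstar f + ncstar g.
Proof. by apply/malgP => w; rewrite mcoeffD !mcoeff_ncstar mcoeffD cjD. Qed.
Lemma ncstarZ c f : ncstar (c *: f) = c^* *: ncstar f.
Proof. by apply/malgP => w; rewrite mcoeffZ !mcoeff_ncstar mcoeffZ cjM. Qed.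
Lemma ncstarN f : ncstar (- f) = - ncstar f.
Proof.
rewrite -scaleN1r ncstarZ -[RHS]scaleN1r; congr (_ *: _).
by rewrite cjN conjc1.
Qed.
Lemma ncstarK f : ncstar (ncstar f) = f.
Proof. by apply/malgP => w; rewrite !mcoeff_ncstar revK cjK. Qed.
Lemma ncstar_word w : ncstar (ncword w) = ncword (rev w).
Proof.
apply/malgP => v; rewrite mcoeff_ncstar !mcoeff_ncword -(inj_eq (can_inj revK)) revK.
by case: eqP; rewrite ?conjc1 ?conjc0.
Qed.
Lemma ncstar1 : ncstar 1 = 1 :> ncp.
Proof. by rewrite -ncword1 ncstar_word. Qed.

(** Statements about all polynomials are checked on words. *)
Lemma ncpoly_ind (P : ncp -> Prop) : P 0 -> (forall c w f, P f -> P (c *: ncword w + f)) ->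
  forall f, P f.
Proof.
move=> P0 PS f; rewrite -(combK f) /pol; elim: (comb f) => [|x s ih].
  by rewrite big_nil.
by rewrite big_cons; apply: PS.
Qed.

End PolynomialWords.

Section WordAlgebra.
Variables (R : realType) (n : nat).
Local Notation C := R[i].
Local Notation word := (word n).

(** The algebra of polynomials is used only through its words: the interface
    below is all that the arguments need. *)
Variables (B : lalgType C) (X : word -> B) (star : B -> B).
Hypothesis scaleAr : forall c (f g : B), f * (c *: g) = c *: (f * g).
Hypothesis X1 : X [::] = 1.
Hypothesis XM : forall v w, X v * X w = X (v ++ w).
Hypothesis Xind : forall P : B -> Prop, P 0 -> (forall c w f, P f -> P (c *: X w + f)) ->
  forall f, P f.
Hypothesis starD : {morph star : f g / f + g}.
Hypothesis starZ : forall c f, star (c *: f) = c^* *: star f.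
Hypothesis starX : forall w, star (X w) = X (rev w).
Implicit Types (f g h : B) (v w : word) (c d : C).

Definition wpol (s : seq (C * word)) : B := \sum_(x <- s) x.1 *: X x.2.

Lemma wpol_surj f : exists s, f = wpol s.
Proof.
elim/Xind: f => [|c w f [s ->]]; first by exists [::]; rewrite /wpol big_nil.
by exists ((c, w) :: s); rewrite /wpol big_cons.
Qed.

Lemma star0 : star 0 = 0.
Proof. by have := starZ 0 0; rewrite !scale0r conjc0 scale0r. Qed.
Lemma starN f : star (- f) = - star f.
Proof. by rewrite -scaleN1r starZ cjN conjc1 scaleN1r. Qed.
Lemma star1 : star 1 = 1.
Proof. by rewrite -X1 starX. Qed.
Lemma star_wpol s : star (wpol s) = \sum_(x <- s) x.1^* *: X (rev x.2).
Proof.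
rewrite /wpol (big_morph _ starD star0); apply: eq_bigr => x _.
by rewrite starZ starX.
Qed.
Lemma XZM c v d w : c *: X v * (d *: X w) = (c * d) *: X (v ++ w).
Proof. by rewrite -scalerAl scaleAr XM scalerA. Qed.

Lemma starM f g : star (f * g) = star g * star f.
Proof.
elim/Xind: f => [|c v f ih]; first by rewrite mul0r star0 mulr0.
rewrite mulrDl !starD mulrDr ih; congr (_ + _) => {ih f}.
elim/Xind: g => [|d w g ih]; first by rewrite mulr0 star0 mul0r.
rewrite mulrDr !starD mulrDl ih; congr (_ + _) => {ih g}.
by rewrite XZM !starZ !starX XZM rev_cat cjM mulrC.
Qed.
Lemma starK f : star (star f) = f.
Proof.
elim/Xind: f => [|c v f ih]; first by rewrite !star0.
by rewrite !starD ih !starZ !starX cjK revK.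
Qed.

Section Functional.
Variable phi : B -> C.

Lemma conj_pos k f : (forall h, 0 <= phi (star h * f * h)) ->
  forall h, 0 <= phi (star h * (star k * f * k) * h).
Proof. by move=> fpos h; have := fpos (k * h); rewrite starM !mulrA. Qed.

Hypothesis phiD : {morph phi : f g / f + g}.
Hypothesis phiZ : forall c f, phi (c *: f) = c * phi f.
Local Notation Phi := (fun w => phi (X w)).

Lemma phi0 : phi 0 = 0.
Proof. by have := phiZ 0 0; rewrite scale0r mul0r. Qed.
Lemma phiN f : phi (- f) = - phi f.
Proof. by rewrite -scaleN1r phiZ mulN1r. Qed.
Lemma phi_sum I (r : seq I) (F : I -> B) : phi (\sum_(i <- r) F i) = \sum_(i <- r) phi (F i).
Proof. exact: (big_morph _ phiD phi0). Qed.

Lemma phi_comm f g : (forall f g, phi (f * g) = phi (g * f)) -> phi (f * g - g * f) = 0.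
Proof. by move=> tr; rewrite phiD phiN tr subrr. Qed.

Lemma phi_star_wpol s t : phi (star (wpol s) * wpol t) =
  ev (vec (fun v w => Phi (rev w ++ v)) t) s.
Proof.
rewrite star_wpol mulr_suml phi_sum formE; apply: eq_bigr => y _.
rewrite /wpol mulr_sumr phi_sum; apply: eq_bigr => x _.
by rewrite XZM phiZ mulrA.
Qed.

Lemma wstate_tr : (forall v w, Phi (v ++ w) = Phi (w ++ v)) ->
  forall f g, phi (f * g) = phi (g * f).
Proof.
move=> tr f g; elim/Xind: f => [|c v f ih]; first by rewrite mul0r mulr0.
rewrite mulrDl mulrDr !phiD ih; congr (_ + _) => {ih f}.
elim/Xind: g => [|d w g ih]; first by rewrite mul0r mulr0.
rewrite mulrDl mulrDr !phiD ih; congr (_ + _) => {ih g}.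
by rewrite !XZM !phiZ tr mulrC [c * d]mulrC mulrC.
Qed.

Lemma wstate_star : (forall w, Phi (rev w) = (Phi w)^*) ->
  forall f, phi (star f) = (phi f)^*.
Proof.
move=> st f; elim/Xind: f => [|c w f ih]; first by rewrite star0 phi0 conjc0.
by rewrite starD !phiD ih starZ starX !phiZ cjD cjM st.
Qed.

Lemma wstate_of : (forall f g, phi (f * g) = phi (g * f)) -> (forall w, nsq (Phi w) <= 1) ->
  (forall f, 0 <= phi (star f * f)) -> phi 1 = 1 -> (forall f, phi (star f) = (phi f)^*) ->
  word_state cat [::] rev Phi.
Proof.
move=> ptr ple ppos p1 pst; apply: free_word_state=> //.
- by move=> v w; rewrite -!XM ptr.
- by move=> w; rewrite -starX pst.
- by rewrite X1.
- by move=> s; have := ppos (wpol s); rewrite phi_star_wpol.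
Qed.

Lemma wstate_pos : word_state cat [::] rev Phi -> forall f, 0 <= phi (star f * f).
Proof.
by move=> S f; have [s ->] := wpol_surj f; rewrite phi_star_wpol; exact: (ws_pos S).
Qed.

(** Translation by a letter contracts the kernel form, because the state is
    bounded on words. *)
Lemma wstate_gen_pos i h : word_state cat [::] rev Phi ->
  0 <= phi (star h * (1 - X [:: i] ^+ 2) * h).
Proof.
move=> S; rewrite mulrBr mulr1 mulrBl phiD phiN.
have -> : star h * X [:: i] ^+ 2 * h = star (X [:: i] * h) * (X [:: i] * h).
  by rewrite starM starX expr2 !mulrA.
have [s ->] := wpol_surj h.
have -> : X [:: i] * wpol s = wpol (mulc cat [:: i] s).
  rewrite /wpol /mulc big_map mulr_sumr; apply: eq_bigr => x _.
  by rewrite scaleAr XM.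
rewrite !phi_star_wpol -/(sker cat rev Phi).
rewrite !(qfE (sker_pd S)) -rmorphB realC_ge0 subr_ge0.
exact: q_mulc S [:: i] s.
Qed.
End Functional.
End WordAlgebra.

Section WordStates.
Variables (R : realType) (n : nat).
Local Notation C := R[i].
Local Notation ncp := (ncpoly R n).
Local Notation word := (word n).
Local Notation ncword := (@ncword R n).

Definition ncstarM := starM (@ncscaleAr R n) (@ncwordM R n) (@ncpoly_ind R n)
  (@ncstarD R n) (@ncstarZ R n) (@ncstar_word R n).

Section Extension.
Variable Phi : word -> C.

Definition lext (f : ncp) : C := mmap idfun Phi f.
Lemma lext_zmod : zmod_morphism lext.
Proof. exact: (@mmap_is_additive _ _ _ idfun Phi). Qed.
Lemma lext_scal : scalable_for *%R lext.
Proof.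
move=> c f; rewrite /lext (mmapEw (msuppZ_le _ _)) mmapE mulr_sumr.
by apply: eq_bigr => w _; rewrite /= mcoeffZ mulrA.
Qed.
HB.instance Definition _ := GRing.isZmodMorphism.Build ncp C lext lext_zmod.
HB.instance Definition _ := GRing.isScalable.Build C ncp C *%R lext lext_scal.

Lemma lext_word w : lext (ncword w) = Phi w.
Proof. by rewrite /lext /ncword mmapU /= mul1r. Qed.
End Extension.

Section Bridge.
Variable phi : {scalar ncp}.
Local Notation Phi := (fun w => phi (ncword w)).
Let phiD : {morph phi : f g / f + g}. Proof. by move=> f g; rewrite linearD. Qed.
Let phiZ c f : phi (c *: f) = c * phi f. Proof. by rewrite linearZ. Qed.

Lemma tcs_word_state : tracial_contraction_state phi -> word_state cat [::] rev Phi.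
Proof.
move=> [ptr ple ppos p1 pst].
apply: (@wstate_of R n _ ncword (@ncstar R n) (@ncscaleAr R n) (@ncword1 R n) (@ncwordM R n)
  (@ncstarD R n) (@ncstarZ R n) (@ncstar_word R n) phi phiD phiZ ptr _ ppos p1 pst).
by move=> w; rewrite -normC_le1.
Qed.

Lemma word_state_tcs : word_state cat [::] rev Phi -> tracial_contraction_state phi.
Proof.
move=> S; split.
- apply: (wstate_tr (@ncscaleAr R n) (@ncwordM R n) (@ncpoly_ind R n) phiD phiZ).
  exact: (ws_tr S).
- by move=> w; rewrite normC_le1 (ws_le1 S).
- exact: (wstate_pos (@ncscaleAr R n) (@ncwordM R n) (@ncpoly_ind R n)
    (@ncstarD R n) (@ncstarZ R n) (@ncstar_word R n) phiD phiZ S).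
- by rewrite -ncword1 (ws_1 S).
- apply: (wstate_star (@ncpoly_ind R n) (@ncstarD R n) (@ncstarZ R n) (@ncstar_word R n) phiD phiZ).
  exact: (ws_st S).
Qed.

(** Positivity of [phi (h^* g h)] for all [h] defines a quadratic module that
    contains the generators. *)
Lemma M_C_pos g : tracial_contraction_state phi -> M_C g -> 0 <= phi g.
Proof.
move=> tphi; have [ptr ple ppos p1 pst] := tphi; have S := tcs_word_state tphi.
pose M : set ncp := [set g | ncstar g = g /\ forall h, 0 <= phi (ncstar h * g * h)].
move=> /(_ M) h; have : M g; last first.
  by move=> [_ /(_ 1)]; rewrite ncstar1 mul1r mulr1.
apply: h.
  split.
  - by move=> f [].
  - by split; [exact: ncstar1|move=> h; rewrite mulr1].
  - move=> f k [f1 f2] [k1 k2]; split; first by rewrite ncstarD f1 k1.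
    by move=> h; rewrite mulrDr mulrDl phiD addr_ge0.
  - move=> k f [f1 f2]; split.
      by rewrite (ncstarM (ncstar k * f)) (ncstarM (ncstar k)) ncstarK f1 mulrA.
    exact: (conj_pos (@ncscaleAr R n) (@ncwordM R n) (@ncpoly_ind R n)
      (@ncstarD R n) (@ncstarZ R n) (@ncstar_word R n) (phi := phi)).
move=> _ [i _ <-]; split.
  by rewrite ncstarD ncstar1 ncstarN expr2 (ncstarM (ncX R i)) /ncX ncstar_word.
move=> h; apply: (wstate_gen_pos (@ncscaleAr R n) (@ncwordM R n) (@ncpoly_ind R n)
    (@ncstarD R n) (@ncstarZ R n) (@ncstar_word R n) phiD phiZ i h S).
Qed.
End Bridge.

Lemma tcs_lext Phi : word_state cat [::] rev Phi ->
  tracial_contraction_state (lext Phi : {scalar ncp}).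
Proof.
move=> S; apply: word_state_tcs; move: S; congr word_state.
by apply/funext => w; rewrite -[RHS]/(lext Phi (ncword w)) lext_word.
Qed.

Lemma phi_cyc (phi : {scalar ncp}) f g : (forall p q, phi (p * q) = phi (q * p)) ->
  cyc_equiv f g -> phi f = phi g.
Proof.
move=> ptr [s e]; apply/eqP; rewrite -subr_eq0 -linearB e linear_sum big1 // => pq _.
apply: phi_comm ptr => [x y|c x]; [exact: linearD|exact: linearZ].
Qed.

Lemma state_ge0_of_certificates (f : ncp) :
  (forall eps : R, 0 < eps -> exists2 g, M_C g & cyc_equiv (f + eps%:C%:A) g) ->
  forall phi : {scalar ncp}, tracial_contraction_state phi -> 0 <= phi f.
Proof.
move=> h phi tphi; have [ptr ple ppos p1 pst] := tphi.
have key (eps : R) : 0 < eps -> 0 <= phi f + eps%:C.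
  move=> e0; have [g Mg cg] := h _ e0.
  have := M_C_pos tphi Mg; rewrite -(phi_cyc ptr cg) linearD linearZ /= p1.
  by rewrite mulr1.
have [/eqP i0 _] : complex.Im (phi f) == 0 /\ True.
  by have := key 1 ltr01; rewrite Cge0 ImD /= addr0 => /andP[].
rewrite Cge0 i0 eqxx /=; apply/ler_addgt0Pr => e e0.
by have := key e e0; rewrite Cge0 ReD => /andP[_].
Qed.
End WordStates.

(** * Polynomials killed by all states *)
Section PolynomialRoots.
Variable F : fieldType.

Lemma poly_inf_roots (p : {poly F}) (x : nat -> F) : injective x ->
  (forall m, p.[x m] = 0) -> p = 0.
Proof.
move=> xi px; apply/eqP; apply: contraT => p0.
have := max_poly_roots p0 (rs := mkseq x (size p)).
rewrite size_mkseq ltnn; apply; last by rewrite map_inj_uniq ?iota_uniq.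
by apply/allP => _ /mapP[m _ ->]; rewrite rootE px.
Qed.
End PolynomialRoots.

Section Detection.
Variables (R : realType) (n : nat).
Local Notation C := R[i].
Local Notation word := (seq 'I_n).
Variables (M : nat) (beta : word -> C).

(** Here [beta] holds the coefficients of a polynomial of degree less than [M],
    and [hsum Phi m] is the value of [Phi] on its part of degree [m]. *)
Definition hsum (Phi : word -> C) m : C := \sum_(t : m.-tuple 'I_n) beta t * Phi t.
Hypothesis vanish : forall Phi, word_state cat [::] rev Phi ->
  \sum_(m < M) hsum Phi m = 0.

(** Scaling the letters by [r] separates the degrees: a polynomial in [r] that
    vanishes for infinitely many [r] has zero coefficients. *)
Lemma scaled_state (Phi : word -> C) (r : R) : word_state cat [::] rev Phi -> 0 <= r <= 1 ->
  word_state cat [::] rev (fun w => (r ^+ size w)%:C * Phi w).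
Proof.
move=> S /andP[r0 r1]; apply: free_word_state=> //.
- by move=> v w; rewrite !size_cat addnC (ws_tr S).
- by move=> w; rewrite size_rev (ws_st S) cjM conjc_real.
- by rewrite /= expr0 mul1r (ws_1 S).
- move=> w; rewrite nsqM mulr_ile1 ?nsq_ge0 ?(ws_le1 S) //.
  by rewrite /nsq /= expr0n addr0 -exprM exprn_ile1.
- move=> s; have := ws_pos S [seq ((r ^+ size x.2)%:C * x.1, x.2) | x <- s].
  rewrite !formE big_map; congr (0 <= _); apply: eq_bigr => y _.
  rewrite big_map; apply: eq_bigr => x _ /=.
  rewrite cjM conjc_real size_cat size_rev exprD rmorphM /=; ring.
Qed.

Lemma real_inj : injective (fun m : nat => ((m.+1%:R^-1 : R)%:C : C)).
Proof.
move=> j k /(congr1 (@complex.Re R)) /= /invr_inj /eqP.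
by rewrite eqr_nat => /eqP[].
Qed.

Lemma hsum0 Phi m : word_state cat [::] rev Phi -> (m < M)%N -> hsum Phi m = 0.
Proof.
move=> S mM; pose p := \poly_(j < M) hsum Phi j.
suff p0 : p = 0 by have := coef_poly M (hsum Phi) m; rewrite -/p p0 coef0 mM.
apply: (poly_inf_roots real_inj) => j; rewrite horner_poly.
have r01 : 0 <= (j.+1%:R^-1 : R) <= 1.
  by rewrite invr_ge0 ler0n /= invf_le1 ?ltr0n // ler1n.
rewrite -[RHS](vanish (scaled_state S r01)); apply: eq_bigr => l _.
rewrite /hsum mulr_suml; apply: eq_bigr => t _.
by rewrite size_tuple rmorphXn mulrA mulrAC.
Qed.

(** ** Traces of words in matrices *)

Definition wmx (A : comNzRingType) (k : nat) (X : 'I_n -> 'M[A]_k.+1) (w : word) : 'M[A]_k.+1 :=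
  foldr (fun i Y => X i *m Y) 1%:M w.

Lemma wmx_cat (A : comNzRingType) k (X : 'I_n -> 'M[A]_k.+1) v w :
  wmx X (v ++ w) = wmx X v *m wmx X w.
Proof. by elim: v => [|i v ih] /=; rewrite ?mul1mx // ih mulmxA. Qed.

Section HermitianMatrices.
Variables (k : nat) (X : 'I_n -> 'M[C]_k.+1).
Hypothesis Xherm : forall i a b, X i b a = (X i a b)^*.
Hypothesis Xrow : forall i a, \sum_b `|X i a b| <= 1.
Local Notation N := (k.+1%:R : R).

Lemma wmx_rev w a b : wmx X (rev w) b a = (wmx X w a b)^*.
Proof.
elim: w a b => [|i w ih] a b.
  rewrite /rev /= !mxE eq_sym; case: eqP => _; by rewrite ?conjc1 ?conjc0.
rewrite rev_cons -cats1 wmx_cat /= mulmx1 !mxE (big_morph _ (@cjD R) (conjc0 _)).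
by apply: eq_bigr => c _; rewrite ih (Xherm i a) cjM mulrC.
Qed.

Lemma wmx_row w a : \sum_b `|wmx X w a b| <= 1.
Proof.
elim: w a => [|i w ih] a /=.
  rewrite (bigD1 a) //= big1 ?addr0 ?mxE ?eqxx ?normr1 // => b ba.
  by rewrite mxE eq_sym (negPf ba) normr0.
apply: le_trans (Xrow i a).
apply: le_trans (_ : \sum_b \sum_c `|X i a c| * `|wmx X w c b| <= _).
  apply: ler_sum => b _; rewrite mxE; apply: (le_trans (ler_norm_sum _ _ _)).
  by apply: ler_sum => c _; rewrite normrM.
rewrite exchange_big; apply: ler_sum => c _ /=.
by rewrite -mulr_sumr -[leRHS]mulr1 ler_wpM2l.
Qed.

(** Bounding the row sums of the letters by 1 keeps the entries of all words,
    and so the normalized trace, bounded by 1. *)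
Lemma matrix_state : word_state cat [::] rev (fun w => (N^-1)%:C * \tr (wmx X w)).
Proof.
have N0 : N != 0 by rewrite pnatr_eq0.
apply: free_word_state=> //.
- by move=> v w; rewrite !wmx_cat mxtrace_mulC.
- move=> w; rewrite cjM conjc_real; congr (_ * _).
  rewrite /mxtrace (big_morph _ (@cjD R) (conjc0 _)); apply: eq_bigr => a _.
  exact: wmx_rev.
- rewrite /= mxtrace1 -(rmorph_nat (real_complex R)) -rmorphM mulVf //.
- move=> w; rewrite -normC_le1 normrM.
  have -> : `|(N^-1)%:C : C| = (N^-1)%:C by rewrite ger0_norm // realC_ge0 invr_ge0 ler0n.
  have : `|\tr (wmx X w)| <= N%:C.
    apply: (le_trans (ler_norm_sum _ _ _)).
    rewrite (rmorph_nat (real_complex R)) -[X in X%:R]card_ord -sumr_const.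
    apply: ler_sum => a _; apply: le_trans (wmx_row w a).
    by rewrite (bigD1 a) //= lerDl sumr_ge0.
  move=> /(ler_wpM2l _) => /(_ (N^-1)%:C); rewrite realC_ge0 invr_ge0 ler0n => /(_ isT) h.
  by apply: (le_trans h); rewrite -rmorphM mulVf.
- move=> s; rewrite formE.
  pose Y : 'M[C]_k.+1 := \sum_(x <- s) x.1 *: wmx X x.2.
  have YE a b : Y a b = \sum_(x <- s) x.1 * wmx X x.2 a b.
    by rewrite /Y summxE; apply: eq_bigr => x _; rewrite mxE.
  have -> : \sum_(y <- s) \sum_(x <- s) y.1^* * (x.1 * ((N^-1)%:C * \tr (wmx X (rev y.2 ++ x.2)))) =
     (N^-1)%:C * \sum_a \sum_b (Y b a)^* * Y b a.
    under [in RHS]eq_bigr do under eq_bigr do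
      rewrite !YE (big_morph _ (@cjD R) (conjc0 _)) mulr_suml.
    under [in RHS]eq_bigr do rewrite exchange_big /=.
    rewrite [X in _ * X]exchange_big mulr_sumr; apply: eq_bigr => y _ /=.
    under [in RHS]eq_bigr do under eq_bigr do rewrite mulr_sumr.
    under [in RHS]eq_bigr do rewrite exchange_big /=.
    rewrite [X in _ * X]exchange_big mulr_sumr; apply: eq_bigr => x _ /=.
    rewrite wmx_cat /mxtrace !mulr_sumr; apply: eq_bigr => a _.
    rewrite mxE !mulr_sumr; apply: eq_bigr => b _.
    by rewrite (wmx_rev y.2 b a) cjM; ring.
  apply: mulr_ge0; first by rewrite realC_ge0 invr_ge0 ler0n.
  by apply: sumr_ge0 => a _; apply: sumr_ge0 => b _; rewrite conjM_nsq realC_ge0 nsq_ge0.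
Qed.
End HermitianMatrices.

Definition trsum k (X : 'I_n -> 'M[C]_k.+1) m : C :=
  \sum_(t : m.-tuple 'I_n) beta t * \tr (wmx X t).

Lemma wmxZ (A : comNzRingType) k (X : 'I_n -> 'M[A]_k.+1) c w :
  wmx (fun i => c *: X i) w = c ^+ size w *: wmx X w.
Proof.
elim: w => [|i w ih] /=; first by rewrite expr0 scale1r.
by rewrite ih -scalemxAl -scalemxAr scalerA exprS.
Qed.

(** Hermitian matrices of any size are scaled into the range of
    [matrix_state]; homogeneity undoes the scaling. *)
Lemma trsum_herm k (X : 'I_n -> 'M[C]_k.+1) m :
  (forall i a b, X i b a = (X i a b)^*) -> (m < M)%N -> trsum X m = 0.
Proof.
move=> Xh mM.
(* [T] bounds all the row sums of the letters. *)
pose T := 1 + \sum_i \sum_a \sum_b `|X i a b|.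
have T1 : 1 <= T by rewrite lerDl; do 3 (apply: sumr_ge0 => ? _).
have T0 : 0 < T by apply: lt_le_trans T1; exact: ltr01.
have Vge : 0 <= T^-1 by rewrite invr_ge0 ltW.
have Vc : (T^-1)^* = T^-1 by have [-> _] := Cge0P Vge; rewrite conjc_real.
have Vh i a b : (T^-1 *: X i) b a = ((T^-1 *: X i) a b)^*.
  by rewrite !mxE Xh cjM Vc.
have Vr i a : \sum_b `|(T^-1 *: X i) a b| <= 1.
  under eq_bigr do rewrite mxE normrM (ger0_norm Vge).
  rewrite -mulr_sumr mulrC ler_pdivrMr // mul1r /T.
  apply: le_trans (_ : \sum_i \sum_a \sum_b `|X i a b| <= _); last by rewrite lerDr ler01.
  rewrite [leRHS](bigD1 i) //= [X in _ <= X + _](bigD1 a) //= -addrA lerDl addr_ge0 //.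
    by do 2 (apply: sumr_ge0 => ? _).
  by do 3 (apply: sumr_ge0 => ? _).
have := hsum0 (matrix_state Vh Vr) mM; rewrite /hsum.
have -> : \sum_(t : m.-tuple 'I_n) beta t * (((k.+1%:R : R)^-1)%:C * \tr (wmx (fun i => T^-1 *: X i) t)) =
    ((k.+1%:R : R)^-1)%:C * T^-1 ^+ m * trsum X m.
  rewrite /trsum mulr_sumr; apply: eq_bigr => t _.
  by rewrite wmxZ mxtraceZ size_tuple; ring.
move=> /eqP; rewrite !mulf_eq0 expf_eq0 invr_eq0 (gt_eqF T0) andbF orbF => /orP[|/eqP //].
by move=> /eqP/(congr1 (@complex.Re R)) /= /eqP; rewrite invr_eq0 pnatr_eq0.
Qed.

(** The trace identity is polynomial in the matrix entries, so it extends from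
    Hermitian matrices [H + zK] with [z] real to [z = i], and every matrix
    is of the form [H + iK]. *)
Lemma trsum_all k (X : 'I_n -> 'M[C]_k.+1) m : (m < M)%N -> trsum X m = 0.
Proof.
move=> mM.
have [I ii iJ] : exists2 I : C, I * I = -1 & I^* = - I.
  by exists 'i; apply: Ceq; rewrite ?Csimpl /= ?oppr0 //; ring.
pose A i : 'M[C]_k.+1 := \matrix_(a, b) (2^-1 * (X i a b + (X i b a)^*)).
pose B i : 'M[C]_k.+1 := \matrix_(a, b) (2^-1 * (I * ((X i b a)^* - X i a b))).
have two : (2^-1 : C)^* = 2^-1.
  by rewrite C_half conjc_real.
have Ah i a b : A i b a = (A i a b)^*.
  by rewrite !mxE cjM cjD cjK two addrC.
have Bh i a b : B i b a = (B i a b)^*.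
  by rewrite !mxE !cjM cjD cjN cjK two iJ; ring.
pose P i : 'M[{poly C}]_k.+1 := map_mx polyC (A i) + 'X *: map_mx polyC (B i).
pose q : {poly C} := \sum_(t : m.-tuple 'I_n) (beta t)%:P * \tr (wmx P t).
have hmx z i : map_mx (horner_eval z) (P i) = A i + z *: B i.
  by apply/matrixP => a b; rewrite !mxE /= /horner_eval !hornerE.
have hw z w : map_mx (horner_eval z) (wmx P w) = wmx (fun i => A i + z *: B i) w.
  elim: w => [|i w ih] /=; first by rewrite map_mx1.
  by rewrite map_mxM ih hmx.
have qz z : q.[z] = trsum (fun i => A i + z *: B i) m.
  rewrite /q /trsum horner_sum; apply: eq_bigr => t _.
  rewrite hornerM hornerC; congr (_ * _).
  by rewrite -(hw z) /mxtrace horner_sum; apply: eq_bigr => a _; rewrite mxE.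
have q0 : q = 0.
  apply: (poly_inf_roots real_inj) => j; rewrite qz; apply: trsum_herm => // i a b.
  have e (z : C) (U V : 'M[C]_k.+1) c d : (U + z *: V) c d = U c d + z * V c d.
    by rewrite !mxE.
  by rewrite !e Ah Bh cjD cjM conjc_real.
have := qz I; rewrite q0 horner0 => ->; congr trsum.
apply/funext => i; apply/matrixP => a b; rewrite !mxE.
have h2 : (2 : C) != 0 by rewrite pnatr_eq0.
transitivity (2^-1 * (X i a b + (X i b a)^* + (I * I) * ((X i b a)^* - X i a b))).
  by rewrite ii; field.
by ring.
Qed.

Section Cycle.
Variables (k : nat) (u : k.+1.-tuple 'I_n).
Local Notation m := k.+1.

(** Letter [i] is sent to the sum of the matrix units [E_(a, a+1)], indices
    modulo [m], over the positions [a] of [i] in [u]. A word of length [m]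
    then has a diagonal entry at [a] exactly when it is [u] read from [a]. *)
Definition cyc_mx (i : 'I_n) : 'M[C]_m :=
  \matrix_(a, b) ((tnth u a == i) && (b == inZp a.+1))%:R.
Definition letters (l a : nat) : word := [seq tnth u (inZp (a + j)) | j <- iota 0 l].

Lemma lettersS l a : letters l.+1 a = tnth u (inZp a) :: letters l a.+1.
Proof.
rewrite /letters /= addn0; congr (_ :: _).
rewrite -[1%N]addn0 iotaDl -map_comp; apply: eq_map => j /=.
by rewrite addnA addn1.
Qed.

Lemma letters_mod l a : letters l (a %% m) = letters l a.
Proof.
apply: eq_map => j; congr tnth; apply: val_inj => /=; by rewrite modnDml.
Qed.

Lemma cyc_mx_word w (a b : 'I_m) : wmx cyc_mx w a b =
  ((b == inZp (a + size w)) && (w == letters (size w) a))%:R.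
Proof.
elim: w a b => [|i w ih] a b.
  rewrite /= mxE addn0 eq_sym andbT; congr (_ == _)%:R.
  by apply: val_inj; rewrite /= modn_small.
rewrite /= mxE (bigD1 (inZp a.+1)) //= big1 ?addr0 => [|c ca]; last first.
  by rewrite mxE (negPf ca) andbF mul0r.
rewrite mxE eqxx andbT ih lettersS eqseq_cons.
have -> : inZp a = a :> 'I_m by apply: val_inj; rewrite /= modn_small.
rewrite [i == _]eq_sym /= letters_mod.
have -> : inZp (a.+1 %% m + size w) = inZp (a + (size w).+1) :> 'I_m.
  by apply: val_inj; rewrite /= modnDml addSnnS.
by case: (tnth u a == i); case: (b == _); case: (w == _); rewrite ?mul1r ?mul0r.
Qed.

Lemma letters_rot (a : 'I_m) : letters m a = rot a u.
Proof.
have i0 : 'I_n := tnth u ord0.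
apply: (@eq_from_nth _ i0); first by rewrite size_map size_iota size_rot size_tuple.
move=> j; rewrite size_map size_iota => jm.
rewrite (nth_map 0%N) ?size_iota // nth_iota // add0n (tnth_nth i0) /=.
rewrite /rot nth_cat size_drop size_tuple nth_drop.
have am := ltn_ord a.
case: ltnP => h.
  by congr nth; rewrite modn_small //; lia.
rewrite nth_take; last by lia.
congr nth; have -> : (a + j = (j - (m - a)) + m)%N by lia.
by rewrite modnDr modn_small //; lia.
Qed.

Lemma rotation_sum : (m < M)%N -> \sum_(a < m) beta (rot a u) = 0.
Proof.
move=> mM; have h := trsum_all cyc_mx mM; rewrite /trsum in h; rewrite -[RHS]h.
under [RHS]eq_bigr do rewrite /mxtrace mulr_sumr.
rewrite exchange_big /=; apply: eq_bigr => a _.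
rewrite (bigD1 [tuple of rot a u]) //= big1 ?addr0 => [|t ta].
  rewrite cyc_mx_word size_tuple letters_rot eqxx andbT.
  have -> : inZp (a + m) = a by apply: val_inj; rewrite /= modnDr modn_small.
  by rewrite eqxx mulr1.
rewrite cyc_mx_word size_tuple letters_rot.
have -> : (tval t == rot a u) = false.
  by apply: contraNF ta => /eqP e; apply/eqP/val_inj.
by rewrite andbF mulr0.
Qed.
End Cycle.

(** The empty word has no rotations to sum over; the state that reads the
    constant coefficient takes care of it. *)
Lemma beta_nil : (0 < M)%N -> beta [::] = 0.
Proof.
move=> M0; pose Phi (w : word) : C := (w == [::])%:R.
have S : word_state cat [::] rev Phi.
  have revn (w : word) : (rev w == [::]) = (w == [::]) by rewrite -!size_eq0 size_rev.
  have natJ (b : bool) : (b%:R : C)^* = b%:R by case: b; rewrite ?conjc1 ?conjc0.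
  have catn (v w : word) : (v ++ w == [::]) = (v == [::]) && (w == [::]).
    by rewrite -!size_eq0 size_cat addn_eq0.
  apply: free_word_state=> //.
  - by move=> v w; rewrite /Phi !catn andbC.
  - by move=> w; rewrite /Phi revn; case: eqP; rewrite ?conjc1 ?conjc0.
  - by move=> w; rewrite /Phi; case: eqP => _; rewrite /nsq /= ?expr0n ?expr1n ?addr0.
  - move=> s; rewrite formE.
    have -> : \sum_(y <- s) \sum_(x <- s) y.1^* * (x.1 * Phi (rev y.2 ++ x.2)) =
       (\sum_(y <- s) y.1 * Phi y.2)^* * \sum_(x <- s) x.1 * Phi x.2.
      rewrite (big_morph _ (@cjD R) (conjc0 _)) mulr_suml; apply: eq_bigr => y _.
      rewrite mulr_sumr; apply: eq_bigr => x _; rewrite /Phi catn revn cjM.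
      by rewrite natJ; case: (y.2 == _); rewrite /= ?mulr1 ?mulr0 ?mul0r ?mulr0.
    by rewrite conjM_nsq realC_ge0 nsq_ge0.
have := hsum0 S M0; rewrite /hsum (bigD1 [tuple]) //= big1 => [|t].
  by rewrite /Phi eqxx mulr1 addr0.
by rewrite (tuple0 t) => /eqP.
Qed.
End Detection.

Section Commutators.
Variables (R : realType) (n : nat).
Local Notation C := R[i].
Local Notation word := (word n).
Variables (B : lalgType C) (X : word -> B).
Hypothesis scaleAr : forall c (f g : B), f * (c *: g) = c *: (f * g).
Hypothesis XM : forall v w, X v * X w = X (v ++ w).

Definition comm_sum (f : B) := exists s : seq (B * B),
  f = \sum_(pq <- s) (pq.1 * pq.2 - pq.2 * pq.1).

Lemma comm_sum0 : comm_sum 0.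
Proof. by exists [::]; rewrite big_nil. Qed.
Lemma comm_sumD f g : comm_sum f -> comm_sum g -> comm_sum (f + g).
Proof. by move=> [s ->] [t ->]; exists (s ++ t); rewrite big_cat. Qed.
Lemma comm_sumZ c f : comm_sum f -> comm_sum (c *: f).
Proof.
move=> [s ->]; exists [seq (c *: x.1, x.2) | x <- s].
rewrite big_map scaler_sumr; apply: eq_bigr => x _ /=.
by rewrite scaleAr -scalerAl scalerBr.
Qed.
Lemma comm_sumN f : comm_sum f -> comm_sum (- f).
Proof. by rewrite -scaleN1r; exact: comm_sumZ. Qed.
Lemma comm_sum_big I (r : seq I) (F : I -> B) : (forall i, comm_sum (F i)) ->
  comm_sum (\sum_(i <- r) F i).
Proof.
by move=> h; apply: (big_ind comm_sum) => //; [exact: comm_sum0|exact: comm_sumD].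
Qed.
Lemma comm_sum1 f g : comm_sum (f * g - g * f).
Proof. by exists [:: (f, g)]; rewrite big_seq1. Qed.

Lemma comm_sum_rotr a w : comm_sum (X w - X (rotr a w)).
Proof.
rewrite -{1}(rotrK a w); set s := rotr a w.
by rewrite -{2}(cat_take_drop a s) /rot -!XM; exact: comm_sum1.
Qed.

(** If the coefficients sum to zero over the rotations of every word, then
    averaging over rotations kills the polynomial. *)
Lemma comm_sum_rotations m (beta : word -> C) : (0 < m)%N ->
  (forall t : m.-tuple 'I_n, \sum_(a < m) beta (rot a t) = 0) ->
  comm_sum (\sum_(t : m.-tuple 'I_n) beta t *: X t).
Proof.
move=> m0 h; set f := \sum_t _.
have m1 : (m%:R : C) != 0 by rewrite pnatr_eq0 -lt0n.
rewrite -[f]scale1r -(mulVf m1) -scalerA; apply: comm_sumZ.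
have -> : m%:R *: f = \sum_(a < m) \sum_(t : m.-tuple 'I_n) beta t *: (X t - X (rotr a t)).
  have -> : m%:R *: f = \sum_(a < m) f by rewrite sumr_const card_ord scaler_nat.
  apply/eqP; rewrite -subr_eq0 -sumrB; apply/eqP.
  under eq_bigr do rewrite -sumrB.
  have -> : \sum_(a < m) \sum_(t : m.-tuple 'I_n)
       (beta t *: X t - beta t *: (X t - X (rotr a t))) =
     \sum_(a < m) \sum_(t : m.-tuple 'I_n) beta (rot a t) *: X t.
    apply: eq_bigr => a _.
    rewrite [RHS](reindex_inj (h := fun t : m.-tuple 'I_n => [tuple of rotr a t])).
      by apply: eq_bigr => t _; rewrite /= rotrK scalerBr opprB addrC subrK.
    by move=> s t /(congr1 val) /= /rotr_inj /val_inj.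
  rewrite exchange_big big1 // => t _ /=.
  by rewrite -scaler_suml h scale0r.
apply: comm_sum_big => a; apply: comm_sum_big => t; apply: comm_sumZ.
exact: comm_sum_rotr.
Qed.
End Commutators.

Section CommutatorsInPolynomials.
Variables (R : realType) (n : nat).
Local Notation C := R[i].
Local Notation ncp := (ncpoly R n).
Local Notation word := (word n).
Local Notation ncword := (@ncword R n).

Lemma ncpoly_degrees (b : ncp) M : (forall w : word, (M <= size w)%N -> mcoeff w b = 0) ->
  b = \sum_(m < M) \sum_(t : m.-tuple 'I_n) mcoeff (t : word) b *: ncword t.
Proof.
move=> h; apply/malgP => v; rewrite raddf_sum /=.
under eq_bigr do rewrite raddf_sum /=.
under eq_bigr do under eq_bigr do rewrite mcoeffZ mcoeff_ncword.
have [vM|Mv] := ltnP (size v) M; last first.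
  rewrite h // big1 // => m _; rewrite big1 // => t _.
  case: eqP => [e|]; last by rewrite mulr0.
  by move: Mv; rewrite -e size_tuple leqNgt ltn_ord.
rewrite (bigD1 (Ordinal vM)) //= (bigD1 (in_tuple v)) //= eqxx mulr1.
rewrite !big1 ?addr0 // => [m mv|t tv].
  rewrite big1 // => t _; case: eqP => [e|]; last by rewrite mulr0.
  by case/eqP: mv; apply: val_inj; rewrite /= -e size_tuple.
case: eqP => [e|]; last by rewrite mulr0.
by case/eqP: tv; apply: val_inj.
Qed.

Lemma cyc_equiv0_of_states (b : ncp) :
  (forall phi : {scalar ncp}, tracial_contraction_state phi -> phi b = 0) ->
  cyc_equiv b 0.
Proof.
move=> h; rewrite /cyc_equiv subr0.
pose M := (\max_(w <- msupp b) size w).+1.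
have bM (w : word) : (M <= size w)%N -> mcoeff w b = 0.
  move=> Mw; apply: mcoeff_outdom; apply: contraL Mw => wb.
  by rewrite -ltnNge ltnS; apply: leq_bigmax_seq.
have be := ncpoly_degrees bM.
pose beta (w : word) := mcoeff w b.
have vanish Phi : word_state cat [::] rev Phi -> \sum_(m < M) hsum beta Phi m = 0.
  move=> S; rewrite -[RHS](h (lext Phi : {scalar ncp}) (tcs_lext S)) /=.
  rewrite [in RHS]be linear_sum; apply: eq_bigr => m _.
  rewrite linear_sum; apply: eq_bigr => t _.
  by rewrite linearZ /= lext_word.
suff : comm_sum b by [].
rewrite be; apply: comm_sum_big => m.
have := ltn_ord m; case: (nat_of_ord m) => [|k] mM.
  rewrite big1; first exact: comm_sum0.
  by move=> t _; rewrite (tuple0 t) -[mcoeff _ b]/(beta [::]) (beta_nil vanish mM) scale0r.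
apply: (comm_sum_rotations (@ncscaleAr R n) (@ncwordM R n)) => // t.
exact: rotation_sum vanish _ _ mM.
Qed.
End CommutatorsInPolynomials.

(** * Separation from a convex cone *)
Section ConeSeparation.
Variables (R : realType) (V : lmodType R[i]).
Local Notation C := R[i].
Implicit Types (u v w : V) (r s : R).

Record convex_cone (P : set V) : Prop := ConvexCone {
  cone0 : P 0;
  coneD : forall u v, P u -> P v -> P (u + v);
  coneZ : forall r v, 0 <= r -> P v -> P (r%:C *: v) }.

(** Zorn's lemma is applied to the sets that complete [P0] to a cone, so that
    the empty chain causes no trouble. *)
Lemma maximal_cone (P0 : set V) f : convex_cone P0 -> ~ P0 f ->
  exists P, [/\ convex_cone P, P0 `<=` P, ~ P f &
    forall Q, convex_cone Q -> P `<=` Q -> ~ Q f -> Q `<=` P].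
Proof.
move=> c0 nf.
have [|A [[cA nA] Amax]] := @Zorn_bigcup V (fun A => convex_cone (P0 `|` A) /\ ~ (P0 `|` A) f).
  move=> F FQ Ftot; split; last first.
    move=> [//|[X FX Xf]]; have [_] := FQ _ FX; apply; by right.
  have two u v : (P0 `|` \bigcup_(X in F) X) u -> (P0 `|` \bigcup_(X in F) X) v ->
      (P0 u /\ P0 v) \/ exists2 X, F X & (P0 `|` X) u /\ (P0 `|` X) v.
    move=> [pu|[X FX Xu]] [pv|[Y FY Yv]].
    - by left.
    - by right; exists Y => //; split; [left|right].
    - by right; exists X => //; split; [right|left].
    - have [XY|YX] := Ftot _ _ FX FY.
      + by right; exists Y => //; split; right => //; exact: XY.
      + by right; exists X => //; split; right => //; exact: YX.
  split.
  - by left; exact: cone0.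
  - move=> u v pu pv; have [[p q]|[X FX [p q]]] := two _ _ pu pv.
      by left; exact: coneD.
    have [cX _] := FQ _ FX; have [h|h] := coneD cX p q; first by left.
    by right; exists X.
  - move=> r v r0 pv; have [[p _]|[X FX [p _]]] := two _ _ pv pv.
      by left; exact: coneZ.
    have [cX _] := FQ _ FX; have [h|h] := coneZ cX r0 p; first by left.
    by right; exists X.
exists (P0 `|` A); split; [exact: cA|by move=> x; left|exact: nA|move=> Q cQ PQ nQ].
have AQ : A `<=` Q by move=> x Ax; apply: PQ; right.
have QE : P0 `|` Q = Q.
  by apply/seteqP; split=> [x [h|//]|x h]; [apply: PQ; left|right].
have nlt : ~ A `<` Q by move=> /Amax; rewrite QE; apply.
by move=> x Qx; right; apply: contrapT => nAx; apply: nlt; split=> // QA; exact: nAx (QA _ Qx).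
Qed.

Section MaximalCone.
Variables (P0 P : set V) (e f : V).
Hypothesis cP : convex_cone P.
Hypothesis Pe : P e.
Hypothesis arch : forall v, exists r, P (r%:C *: e - v).
Hypothesis Pf : ~ P f.
Hypothesis Pmax : forall Q, convex_cone Q -> P `<=` Q -> ~ Q f -> Q `<=` P.

(** The cone generated by [P] and [v] is larger than [P], so it contains [f]. *)
Lemma cone_adjoin v : ~ P v -> exists2 r, 0 < r & P (r%:C *: f - v).
Proof.
move=> nv; pose Q := [set u | exists2 p, P p & exists2 r : R, 0 <= r & u = p + r%:C *: v].
have cQ : convex_cone Q.
  split.
  - by exists 0; [exact: cone0|exists 0 => //; rewrite scale0r addr0].
  - move=> _ _ [p pp [r r0 ->]] [q pq [s s0 ->]]; exists (p + q); first exact: coneD.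
    by exists (r + s); [exact: addr_ge0|rewrite rmorphD scalerDl addrACA].
  - move=> t _ t0 [p pp [r r0 ->]]; exists (t%:C *: p); first exact: coneZ.
    by exists (t * r); [exact: mulr_ge0|rewrite scalerDr scalerA rmorphM].
have PQ : P `<=` Q.
  by move=> p pp; exists p => //; exists 0 => //; rewrite scale0r addr0.
have [p pp [r r0 fE]] : Q f.
  apply: contrapT => nQ; apply: nv; apply: (Pmax cQ PQ nQ).
  by exists 0; [exact: cone0|exists 1 => //; rewrite add0r scale1r].
have rp : 0 < r.
  rewrite lt_neqAle r0 andbT eq_sym; apply/eqP => rE; apply: Pf.
  by rewrite fE rE scale0r addr0.
exists r^-1; first by rewrite invr_gt0.
rewrite fE scalerDr scalerA -rmorphM mulVf ?gt_eqF // scale1r addrK.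
by apply: coneZ => //; rewrite invr_ge0.
Qed.

(** If neither [v] nor [- v] were in [P], adding the two relations of
    [cone_adjoin] would put [f] in [P]. *)
Lemma cone_total v : P v \/ P (- v).
Proof.
have [pv|nv] := pselect (P v); first by left.
right; apply: contrapT => nv'.
have [r r0 h] := cone_adjoin nv; have [s s0 h'] := cone_adjoin nv'.
apply: Pf; have := coneD cP h h'; rewrite addrACA subrr addr0 -scalerDl -rmorphD.
have rs : 0 < r + s by exact: addr_gt0.
move=> /(coneZ cP (r := (r + s)^-1)); rewrite invr_ge0 ltW // => /(_ isT).
by rewrite scalerA -rmorphM mulVf ?gt_eqF // scale1r.
Qed.

Lemma cone_unit r : P (r%:C *: e) -> 0 <= r.
Proof.
move=> h; rewrite leNgt; apply/negP => r0; apply: Pf.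
have [s hs] := arch (- f); rewrite opprK in hs.
have [s0|s0] := lerP s 0.
  have ne : 0 <= - s by rewrite oppr_ge0.
  have := coneD cP hs (coneZ cP ne Pe).
  by rewrite rmorphN scaleNr addrAC subrr add0r.
have k0 : 0 <= - (s / r) by rewrite -mulrN mulr_ge0 ?ltW // oppr_gt0 invr_lt0.
have := coneD cP hs (coneZ cP k0 h).
rewrite scalerA -rmorphM mulNr -mulrA mulVf ?lt_eqF // mulr1.
by rewrite rmorphN scaleNr addrAC subrr add0r.
Qed.

Lemma cone_le v r s : P (v - r%:C *: e) -> P (s%:C *: e - v) -> r <= s.
Proof.
move=> h h'; have := coneD cP h h'; rewrite addrC addrA subrK -scalerBl -rmorphB.
by move=> /cone_unit; rewrite subr_ge0.
Qed.

(** [v] agrees with [c e] up to arbitrarily small multiples of [e]. *)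
Definition value v (c : R) := forall d : R, 0 < d ->
  P (v - (c - d)%:C *: e) /\ P ((c + d)%:C *: e - v).

Lemma value_uniq v c c' : value v c -> value v c' -> c = c'.
Proof.
have le a b : value v a -> value v b -> a <= b.
  move=> ha hb; apply/ler_addgt0Pr => d d0.
  have d2 : 0 < d / 2 by rewrite divr_gt0.
  have [h _] := ha _ d2; have [_ h'] := hb _ d2.
  have := cone_le h h'; rewrite lerBlDr -addrA -splitr //.
by move=> h h'; apply/eqP; rewrite eq_le !le.
Qed.

Lemma value_exists v : exists c, value v c.
Proof.
pose S := [set r : R | P (v - r%:C *: e)].
have S0 : S !=set0.
  have [r h] := arch (- v); exists (- r).
  by rewrite /S /= rmorphN scaleNr opprK addrC; rewrite opprK in h.
have [s hs] := arch v.
have Sb : has_ubound S by exists s => r Sr; exact: cone_le Sr hs.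
have Ssup : has_sup S by split.
exists (sup S) => d d0; split.
  have [r Sr lr] := sup_adherent d0 Ssup.
  have k0 : 0 <= r - (sup S - d) by rewrite subr_ge0 ltW.
  have := coneD cP Sr (coneZ cP k0 Pe).
  by rewrite rmorphB scalerBl addrA subrK.
have [h|h] := cone_total ((sup S + d)%:C *: e - v) => //.
rewrite opprB in h; have := sup_upper_bound Ssup h.
by rewrite gerDl leNgt d0.
Qed.

Lemma valueD u v c d : value u c -> value v d -> value (u + v) (c + d).
Proof.
move=> hc hd x x0; have x2 : 0 < x / 2 by rewrite divr_gt0.
have [h1 h2] := hc _ x2; have [h3 h4] := hd _ x2.
split.
  have -> : c + d - x = (c - x / 2) + (d - x / 2) by field.
  by rewrite rmorphD scalerDl opprD addrACA; exact: coneD.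
have -> : c + d + x = (c + x / 2) + (d + x / 2) by field.
by rewrite rmorphD scalerDl opprD addrACA; exact: coneD.
Qed.

Lemma valueN v c : value v c -> value (- v) (- c).
Proof.
move=> hc x x0; have [h1 h2] := hc _ x0; split.
  have -> : - v - (- c - x)%:C *: e = (c + x)%:C *: e - v.
    have -> : - c - x = - (c + x) by ring.
    by rewrite rmorphN scaleNr opprK addrC.
  done.
have -> : (- c + x)%:C *: e - - v = v - (c - x)%:C *: e.
  by rewrite opprK -[c - x]opprK opprB rmorphN scaleNr opprK addrC [x - c]addrC.
done.
Qed.

Lemma valueZ v c r : 0 < r -> value v c -> value (r%:C *: v) (r * c).
Proof.
move=> r0 hc x x0; have xr : 0 < x / r by rewrite divr_gt0.
have [h1 h2] := hc _ xr; have rle := ltW r0.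
have := coneZ cP rle h1; have := coneZ cP rle h2.
rewrite !scalerBr !scalerA -!rmorphM mulrBr mulrDr.
by have -> : r * (x / r) = x by rewrite mulrC divfK // gt_eqF.
Qed.

Definition cval v : R := sval (cid (value_exists v)).
Lemma cvalP v : value v (cval v).
Proof. exact: (svalP (cid (value_exists v))). Qed.
Lemma cval_eq v c : value v c -> cval v = c.
Proof. exact: value_uniq (cvalP v). Qed.

Lemma cvalD u v : cval (u + v) = cval u + cval v.
Proof. by apply: cval_eq; apply: valueD; exact: cvalP. Qed.
Lemma cvalN v : cval (- v) = - cval v.
Proof. by apply: cval_eq; apply: valueN; exact: cvalP. Qed.
Lemma cval0 : cval 0 = 0.
Proof. by apply: (addrI (cval 0)); rewrite -cvalD !addr0. Qed.
Lemma cvalZ r v : cval (r%:C *: v) = r * cval v.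
Proof.
have [r0|r0|->] := ltgtP r 0; last by rewrite scale0r mul0r cval0.
  rewrite -[r]opprK rmorphN scaleNr cvalN mulNr; congr (- _).
  by apply: cval_eq; apply: valueZ; [rewrite oppr_gt0|exact: cvalP].
by apply: cval_eq; apply: valueZ => //; exact: cvalP.
Qed.
Lemma cval_ge0 v : P v -> 0 <= cval v.
Proof.
move=> pv; apply/ler_addgt0Pr => d d0; have [_ h] := cvalP v d0.
by apply: cone_le h; rewrite scale0r subr0.
Qed.
Lemma cval_unit : cval e = 1.
Proof.
have cE (x y : R) : x%:C *: e - y%:C *: e = (x - y)%:C *: e.
  by rewrite -scalerBl -rmorphB.
have e1 : e = (1 : R)%:C *: e by rewrite scale1r.
by apply: cval_eq => d d0; split;
  rewrite [X in X - _]e1 || rewrite [X in _ - X]e1; rewrite cE; apply: coneZ => //; lra.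
Qed.
Lemma cval_avoided : cval f <= 0.
Proof.
have [//|h] := cone_total f; rewrite -oppr_ge0 -cvalN; exact: cval_ge0.
Qed.

(** The complex linear functional with real part [cval]. *)
Definition complexify v : C := (cval v)%:C - 'i * (cval ('i *: v))%:C.
Lemma Re_complexify v : complex.Re (complexify v) = cval v.
Proof. by rewrite /complexify /=; ring. Qed.
Lemma complexifyD : {morph complexify : u v / u + v}.
Proof. move=> u v; rewrite /complexify scalerDr !cvalD !rmorphD /=; ring. Qed.
Lemma complexifyZ c v : complexify (c *: v) = c * complexify v.
Proof.
have cE (z : C) w : z *: w = (complex.Re z)%:C *: w + (complex.Im z)%:C *: ('i *: w).
  rewrite scalerA -scalerDl; congr (_ *: _); apply: Ceq; rewrite ?Csimpl /=; ring.
have ii w : 'i *: ('i *: w) = - w.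
  by rewrite scalerA -scaleN1r; congr (_ *: _); apply: Ceq; rewrite ?Csimpl /=; ring.
have vc w : cval (c *: w) = complex.Re c * cval w + complex.Im c * cval ('i *: w).
  by rewrite cE cvalD !cvalZ.
have ic : 'i *: (c *: v) = c *: ('i *: v) by rewrite !scalerA mulrC.
rewrite {1}/complexify ic !vc ii cvalN /complexify.
by apply: Ceq; rewrite ?Csimpl /=; ring.
Qed.
End MaximalCone.

(** A convex cone with order unit [e] that misses [f] is separated from [f]:
    a maximal cone missing [f] is a total preorder, and comparing vectors with
    the multiples of [e] is a linear functional. *)
Lemma cone_separation (P0 : set V) e f : convex_cone P0 -> P0 e ->
    (forall v, exists r, P0 (r%:C *: e - v)) -> ~ P0 f ->
  exists phi : V -> C, [/\ {morph phi : u v / u + v}, forall c v, phi (c *: v) = c * phi v,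
    forall v, P0 v -> 0 <= complex.Re (phi v), complex.Re (phi e) = 1 & complex.Re (phi f) <= 0].
Proof.
move=> c0 P0e arch nf; have [P [cP P0P nP Pmax]] := maximal_cone c0 nf.
have Pe := P0P _ P0e.
have archP v : exists r, P (r%:C *: e - v) by have [r h] := arch v; exists r; exact: P0P.
exists (complexify cP Pe archP nP Pmax); split.
- exact: complexifyD.
- exact: complexifyZ.
- by move=> v /P0P pv; rewrite Re_complexify; exact: cval_ge0.
- by rewrite Re_complexify; exact: cval_unit.
- by rewrite Re_complexify; exact: cval_avoided.
Qed.
End ConeSeparation.

(** * From states to certificates *)
Section CertificateCone.
Variables (R : realType) (n : nat).
Local Notation C := R[i].
Local Notation word := (word n).
Variables (B : lalgType C) (X : word -> B) (star : B -> B).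
Hypothesis scaleAr : forall c (f g : B), f * (c *: g) = c *: (f * g).
Hypothesis X1 : X [::] = 1.
Hypothesis XM : forall v w, X v * X w = X (v ++ w).
Hypothesis Xind : forall P : B -> Prop, P 0 -> (forall c w f, P f -> P (c *: X w + f)) ->
  forall f, P f.
Hypothesis starD : {morph star : f g / f + g}.
Hypothesis starZ : forall c f, star (c *: f) = c^* *: star f.
Hypothesis starX : forall w, star (X w) = X (rev w).

Variable M : set B.
Hypothesis Mstar : forall g, M g -> star g = g.
Hypothesis M1 : M 1.
Hypothesis MD : forall g h, M g -> M h -> M (g + h).
Hypothesis MJ : forall g h, M h -> M (star g * h * g).
Hypothesis MX : forall i, M (1 - X [:: i] ^+ 2).
Implicit Types (f g h : B) (v w : word) (c d : C).

Let sK := starK Xind starD starZ starX.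
Let sN := starN starZ.
Let s1 := star1 X1 starX.
Let s0 := star0 starZ.

Lemma quad_scale (t : R) g : 0 <= t -> M g -> M (t%:C *: g).
Proof.
move=> t0 Mg; have := MJ ((Num.sqrt t)%:C *: 1) Mg.
rewrite starZ s1 conjc_real -!scalerAl mul1r scaleAr mulr1 scalerA -rmorphM.
by rewrite -expr2 sqr_sqrtr.
Qed.
Lemma quad0 : M 0.
Proof. by have := quad_scale (lexx 0) M1; rewrite scale0r. Qed.

(** Telescoping: peeling the first letter [i] off a word [i :: w] changes
    [1 - w^* w] by [w^* (1 - X_i^2) w]. *)
Lemma quad_word w : M (1 - X (rev w) * X w).
Proof.
elim: w => [|i w ih]; first by rewrite /rev /= X1 mulr1 subrr; exact: quad0.
have -> : 1 - X (rev (i :: w)) * X (i :: w) =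
    (1 - X (rev w) * X w) + star (X w) * (1 - X [:: i] ^+ 2) * X w.
  rewrite starX mulrBr mulr1 mulrBl addrA subrK; congr (_ - _).
  by rewrite expr2 rev_cons -cats1 -(XM (rev w)) -[X (i :: w)](XM [:: i] w) !mulrA.
by apply: MD => //; exact: MJ.
Qed.

(** The real cone of polynomials that are certified nonnegative in real part:
    commutators and skew elements are counted as zero. *)
Definition cert f := exists m k a,
  [/\ M m, comm_sum k, star a = - a & f = m + k + a].

Lemma cert_cone : convex_cone cert.
Proof.
split.
- by exists 0, 0, 0; split; rewrite ?addr0 ?s0 ?oppr0 //; [exact: quad0|exact: comm_sum0].
- move=> _ _ [m [k [a [Mm ck sa ->]]]] [m' [k' [a' [Mm' ck' sa' ->]]]].
  exists (m + m'), (k + k'), (a + a'); split.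
  + exact: MD.
  + exact: comm_sumD.
  + by rewrite starD sa sa' opprD.
  + by rewrite addrACA (addrACA m).
- move=> r _ r0 [m [k [a [Mm ck sa ->]]]].
  exists (r%:C *: m), (r%:C *: k), (r%:C *: a); split.
  + exact: quad_scale.
  + exact: comm_sumZ.
  + by rewrite starZ sa conjc_real scalerN.
  + by rewrite !scalerDr.
Qed.

Lemma cert_quad f : M f -> cert f.
Proof. by exists f, 0, 0; split; rewrite ?addr0 ?s0 ?oppr0 //; exact: comm_sum0. Qed.
Lemma cert_comm f : comm_sum f -> cert f.
Proof. by exists 0, f, 0; split; rewrite ?addr0 ?add0r ?s0 ?oppr0 //; exact: quad0. Qed.
Lemma cert_skew f : star f = - f -> cert f.
Proof. by exists 0, 0, f; split; rewrite ?addr0 ?add0r //; [exact: quad0|exact: comm_sum0]. Qed.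

(** For a monomial [u = c w], expanding [(1 - u)^* (1 - u)] and replacing
    [w^* w] by 1 bounds [u + u^*] by [1 + |c|^2] in [M]; the difference
    between [u] and its selfadjoint part is skew. *)
Lemma cert_bound f : exists r : R, cert (r%:C *: 1 - f).
Proof.
elim/Xind: f => [|c w f [r hr]].
  by exists 1; rewrite subr0 scale1r; apply: cert_quad.
set u := c *: X w; pose t : R := 2^-1 * (1 + nsq c).
exists (t + r); rewrite rmorphD scalerDl opprD addrACA; apply: (coneD cert_cone) => //.
have -> : t%:C *: 1 - u =
    (2^-1 : R)%:C *: (star (1 - u) * 1 * (1 - u) + (nsq c)%:C *: (1 - X (rev w) * X w))
    + (2^-1 : R)%:C *: (star u - u).
  rewrite -scalerDr mulr1 starD s1 sN mulrBr mulr1 mulrBl mul1r.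
  have -> : star u * u = (nsq c)%:C *: (X (rev w) * X w).
    by rewrite /u starZ starX -scalerAl scaleAr scalerA conjM_nsq.
  rewrite scalerBr; set y := _ *: (_ * _); set x := star u.
  have -> : 1 - x - (u - y) + ((nsq c)%:C *: 1 - y) + (x - u) = (1 + nsq c)%:C *: 1 - (2 : R)%:C *: u.
    have -> : (2 : R)%:C *: u = u + u by rewrite -[2]/(1 + 1) rmorphD scalerDl scale1r.
    have -> : (1 + nsq c)%:C = 1 + (nsq c)%:C by rewrite rmorphD.
    rewrite scalerDl scale1r opprB; move: (_ *: 1) => z.
    transitivity (1 - x + (z - u) + (x - u)).
      by congr (_ + _); rewrite -addrA; congr (_ + _); rewrite addrC addrA subrK.
    by rewrite addrAC (addrA (1 - x) x) subrK addrACA opprD.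
  by rewrite -{1}[u]scale1r scalerBr !scalerA -!rmorphM mulVf ?pnatr_eq0.
have h0 : 0 <= (2^-1 : R) by rewrite invr_ge0.
apply: (coneD cert_cone); apply: (coneZ cert_cone) => //.
  apply: cert_quad; apply: MD; first exact: MJ.
  by apply: quad_scale; [exact: nsq_ge0|exact: quad_word].
by apply: cert_skew; rewrite starD sK sN opprB.
Qed.

(** The separating functional kills both signs of every commutator and has zero
    real part on skew elements, so it is tracial and Hermitian; positivity of
    [(X w - phi (X w))^* (X w - phi (X w))] bounds it on words. *)
Lemma state_of_not_cert f : ~ cert f -> exists phi : B -> C,
  [/\ {morph phi : f g / f + g}, forall c f, phi (c *: f) = c * phi f,
    word_state cat [::] rev (fun w => phi (X w)), phi 1 = 1 & complex.Re (phi f) <= 0].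
Proof.
move=> nf; have [phi [phiD phiZ phiP phi1 phif]] :=
  cone_separation cert_cone (cert_quad M1) cert_bound nf.
have pN g : phi (- g) = - phi g by exact: phiN phiZ g.
have skew0 g : star g = - g -> complex.Re (phi g) = 0.
  move=> sg; apply/eqP; rewrite eq_le phiP ?andbT; last exact: cert_skew.
  have : 0 <= complex.Re (phi (- g)) by apply/phiP/cert_skew; rewrite sN sg.
  by rewrite pN ReN oppr_ge0.
have sym0 g : star g = g -> complex.Im (phi g) = 0.
  move=> sg; have := skew0 ('i *: g); rewrite starZ sg phiZ.
  have -> : ('i : C)^* = - 'i by apply: Ceq; rewrite ?Csimpl /= ?oppr0.
  rewrite scaleNr => /(_ erefl); rewrite Csimpl /=; lra.
have pst g : phi (star g) = (phi g)^*.
  have h1 : complex.Re (phi (star g - g)) = 0.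
    by apply: skew0; rewrite starD sK sN opprB.
  have h2 : complex.Im (phi (star g + g)) = 0.
    by apply: sym0; rewrite starD sK addrC.
  by apply: Ceq; move: h1 h2; rewrite !phiD pN ?Csimpl /=; lra.
have comm0 g : comm_sum g -> phi g = 0.
  have re0 h : comm_sum h -> complex.Re (phi h) = 0.
    move=> ch; apply/eqP; rewrite eq_le phiP ?andbT; last exact: cert_comm.
    have : 0 <= complex.Re (phi (- h)) by apply/phiP/cert_comm/comm_sumN.
    by rewrite pN ReN oppr_ge0.
  move=> cg; apply: Ceq; first by rewrite re0.
  have := re0 ('i *: g) (comm_sumZ scaleAr _ cg); rewrite phiZ Csimpl /=; lra.
have ptr g h : phi (g * h) = phi (h * g).
  have := comm0 _ (comm_sum1 g h); rewrite phiD pN => /eqP.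
  by rewrite subr_eq0 => /eqP.
have Mpos g : M g -> 0 <= phi g.
  move=> Mg; rewrite Cge0 (sym0 _ (Mstar Mg)) eqxx /=; exact/phiP/cert_quad.
have p1 : phi 1 = 1 by apply: Ceq; [rewrite phi1|rewrite (sym0 _ s1)].
have ppos g : 0 <= phi (star g * g) by apply: Mpos; rewrite -[star g]mulr1; exact: MJ.
have ple w : nsq (phi (X w)) <= 1.
  pose z := phi (X w).
  have h := ppos (X w - z *: 1).
  have e : phi (star (X w - z *: 1) * (X w - z *: 1)) = phi (X (rev w) * X w) - (nsq z)%:C.
    rewrite starD sN starZ s1 mulrBr !mulrBl.
    rewrite -!scalerAl !scaleAr !mulr1 !mul1r !(phiD, pN, phiZ) p1.
    rewrite -conjM_nsq -/z -starX pst -/z; ring.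
  have := Mpos _ (quad_word w); rewrite phiD pN p1.
  rewrite e in h; move: h; rewrite !Cge0 => /andP[_ h1] /andP[_ h2].
  move: h1 h2; rewrite !Csimpl /=; lra.
exists phi; split=> //.
exact: wstate_of.
Qed.
End CertificateCone.

Section Certificates.
Variables (R : realType) (n : nat).
Local Notation C := R[i].
Local Notation ncp := (ncpoly R n).
Local Notation word := (word n).
Local Notation ncword := (@ncword R n).

Lemma M_C_star (g : ncp) : M_C g -> ncstar g = g.
Proof.
move=> /(_ [set h | ncstar h = h]); apply.
  split=> //=.
  - exact: ncstar1.
  - by move=> f h ef eh; rewrite ncstarD ef eh.
  - move=> f h eh; rewrite (ncstarM (ncstar f * h)) (ncstarM (ncstar f)).
    by rewrite ncstarK eh mulrA.
move=> _ [i _ <-] /=.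
by rewrite ncstarD ncstar1 ncstarN expr2 (ncstarM (ncX R i)) /ncX ncstar_word.
Qed.
Lemma M_C1 : M_C (1 : ncp).
Proof. by move=> Q [] . Qed.
Lemma M_CD (f g : ncp) : M_C f -> M_C g -> M_C (f + g).
Proof.
move=> Mf Mg Q qQ GQ; have [_ _ QD _] := qQ.
by apply: QD; [exact: Mf|exact: Mg].
Qed.
Lemma M_CJ (f g : ncp) : M_C g -> M_C (ncstar f * g * f).
Proof. by move=> Mg Q qQ GQ; have [_ _ _ QJ] := qQ; apply: QJ; exact: Mg. Qed.
Lemma M_CX i : M_C (1 - ncword [:: i] ^+ 2).
Proof. by move=> Q _; apply; exists i. Qed.

(** A state is real on the skew part [a] because it is real on [f + eps] and on
    [m], and imaginary there by skewness; so [a] is killed by all states. *)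
Lemma certificates_of_states (f : ncp) :
  (forall phi : {scalar ncp}, tracial_contraction_state phi -> 0 <= phi f) ->
  forall eps : R, 0 < eps -> exists2 g, M_C g & cyc_equiv (f + eps%:C%:A) g.
Proof.
move=> fpos eps eps0.
have [m [k [a [Mm ck sa fE]]]] : cert (@ncstar R n) (@M_C R n) (f + eps%:C%:A).
  apply: contrapT => nf.
  have [phi [phiD phiZ S p1 phif]] := state_of_not_cert (@ncscaleAr R n) (@ncword1 R n)
    (@ncwordM R n) (@ncpoly_ind R n) (@ncstarD R n) (@ncstarZ R n) (@ncstar_word R n)
    M_C_star M_C1 M_CD M_CJ M_CX nf.
  pose L : {scalar ncp} := lext (fun w => phi (ncword w)).
  have LX w : L (ncword w) = phi (ncword w) by exact: lext_word.
  have pE g : L g = phi g.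
    elim/ncpoly_ind: g => [|c w g ih].
      by rewrite linear0 (phi0 phiZ).
    by rewrite linearD linearZ phiD phiZ ih LX.
  have := fpos _ (tcs_lext S : tracial_contraction_state L); rewrite Cge0 pE => /andP[_ h].
  move: phif; rewrite phiD phiZ p1 mulr1 ReD /=; lra.
exists m => //; suff : comm_sum (k + a) by rewrite /cyc_equiv fE -(addrA m) (addrC m) addrK.
apply: comm_sumD => //.
suff [s e] : cyc_equiv a 0 by exists s; rewrite -e subr0.
apply: cyc_equiv0_of_states => phi tphi.
have [ptr ple ppos p1 pst] := tphi.
have k0 : phi k = 0 by rewrite (phi_cyc (g := 0) ptr) ?linear0 // /cyc_equiv subr0.
have := fpos _ tphi; have := M_C_pos tphi Mm.
have := pst a; rewrite sa linearN.
have : phi (f + eps%:C%:A) = phi m + phi k + phi a by rewrite fE !linearD.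
rewrite linearD linearZ p1 /= mulr1 k0 addr0 => /(canLR (addKr _)) <-.
rewrite !Cge0 => e /andP[/eqP m0 _] /andP[/eqP f0 _].
have := congr1 (@complex.Re R) e; rewrite !Csimpl /= => h.
by apply: Ceq; rewrite !Csimpl /= ?m0 ?f0; lra.
Qed.
End Certificates.

(** * Traces of words in a von Neumann algebra *)
Section TracialAlgebra.
Variables (R : realType) (H : completeNormedModType R[i]).
Variable dot : {dot H for @Num.conj R[i]}.
Hypothesis hn : hilbert_norm dot.
Local Notation C := R[i].
Variables (F : set (H -> H)) (tau : (H -> H) -> C).
Hypothesis Fvn : von_neumann_algebra dot F.
Hypothesis Ftr : canonical_trace dot F tau.

Lemma vna_bounded T : F T -> bounded_op T.
Proof. by have [h _ _] := Fvn; exact: h. Qed.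
Lemma vna_linear T : F T -> linear T.
Proof. by case/vna_bounded. Qed.
Lemma vna_lin c S T : F S -> F T -> F (fun x => c *: S x + T x).
Proof. by have [_ _ <-] := Fvn; apply: commutant_lin => Z []. Qed.
Lemma vna_comp S T : F S -> F T -> F (S \o T).
Proof. by have [_ _ <-] := Fvn; exact: commutant_comp. Qed.
Lemma vna_id : F id.
Proof. by have [_ _ <-] := Fvn; exact: commutant_id. Qed.
Lemma vna_adj T Ts : F T -> adjoint_op dot T Ts -> F Ts.
Proof.
move=> FT h; have [_ /(_ _ FT)[S hS FS] _] := Fvn.
by rewrite (adjoint_unique hn h hS).
Qed.

Lemma tau_lin c S T : F S -> F T -> tau (fun x => c *: S x + T x) = c * tau S + tau T.
Proof. by have [h _ _ _] := Ftr; exact: h. Qed.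
Lemma tau_id : tau id = 1.
Proof. by have [_ _ _ ->] := Ftr. Qed.

Lemma vna_zero : F (fun=> 0) /\ tau (fun=> 0) = 0.
Proof.
have -> : (fun=> 0) = (fun x : H => (-1) *: id x + id x).
  by apply/funext => x; rewrite scaleN1r addNr.
split; first by apply: vna_lin; exact: vna_id.
by rewrite tau_lin ?tau_id ?mulN1r ?addNr //; exact: vna_id.
Qed.

Lemma vna_lincomb I (r : seq I) (c : I -> C) (T : I -> H -> H) : (forall i, F (T i)) ->
  F (fun x => \sum_(i <- r) c i *: T i x) /\
  tau (fun x => \sum_(i <- r) c i *: T i x) = \sum_(i <- r) c i * tau (T i).
Proof.
move=> FT; elim: r => [|i r [F1 t1]].
  have -> : (fun x => \sum_(i <- [::]) c i *: T i x) = (fun=> 0).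
    by apply/funext => x; rewrite big_nil.
  by rewrite big_nil; exact: vna_zero.
have -> : (fun x => \sum_(j <- i :: r) c j *: T j x) =
    (fun x => c i *: T i x + \sum_(j <- r) c j *: T j x).
  by apply/funext => x; rewrite big_cons.
split; first exact: (vna_lin _ (FT i) F1).
by rewrite (tau_lin _ (FT i) F1) t1 big_cons.
Qed.

(** Positivity of [tau] on [(c + S)^* (c + S)]; the choices of [c] below give
    the Hermitian property and the Cauchy-Schwarz inequality. *)
Lemma tau_form S Ss c : F S -> adjoint_op dot S Ss ->
  0 <= (nsq c)%:C + (c^* * tau S + (c * tau Ss + tau (Ss \o S))).
Proof.
move=> FS h; have FSs := vna_adj FS h.
have [_ _ pos _] := Ftr.
pose D x := c *: id x + S x; pose Ds x := c^* *: id x + Ss x.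
have FD : F D by apply: vna_lin => //; exact: vna_id.
have FDs : F Ds by apply: vna_lin => //; exact: vna_id.
have aD : adjoint_op dot D Ds by apply: adjoint_lin.
have := pos _ _ FD FDs aD.
have -> : Ds \o D = (fun x => (nsq c)%:C *: id x + (c^* *: S x + (c *: Ss x + (Ss \o S) x))).
  apply/funext => x; rewrite /Ds /D /= scalerDr scalerA conjM_nsq -addrA.
  by rewrite (vna_linear FSs).
have F1 := vna_comp FSs FS; have F2 := vna_lin c FSs F1; have F3 := vna_lin c^* FS F2.
by rewrite (tau_lin _ vna_id F3) (tau_lin _ FS F2) (tau_lin _ FSs F1) tau_id mulr1.
Qed.

Lemma tau_sq_ge0 S Ss : F S -> adjoint_op dot S Ss -> 0 <= tau (Ss \o S).
Proof.
by move=> FS h; have [_ _ pos _] := Ftr; apply: pos => //; exact: vna_adj h.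
Qed.

Lemma tau_adj S Ss : F S -> adjoint_op dot S Ss -> tau Ss = (tau S)^*.
Proof.
move=> FS h; have := tau_sq_ge0 FS h; rewrite Cge0 => /andP[/eqP i0 _].
have := tau_form 'i FS h; have := tau_form 1 FS h.
rewrite !Cge0 => /andP[/eqP h1 _] /andP[/eqP h2 _].
move: h1 h2; rewrite !Csimpl /= i0 => h1 h2.
by apply: Ceq; rewrite !Csimpl /=; lra.
Qed.

Lemma tau_CS S Ss : F S -> adjoint_op dot S Ss -> nsq (tau S) <= complex.Re (tau (Ss \o S)).
Proof.
move=> FS h; have := tau_form (- tau S) FS h; rewrite (tau_adj FS h) Cge0 => /andP[_].
rewrite !Csimpl /nsq /=; nra.
Qed.

(** The defect [1 - T^* T] of a contraction is a square in the algebra: its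
    square root commutes with the commutant, so it lies in the bicommutant. *)
Lemma tau_contraction T Ts : F T -> (forall x, nm (T x) <= nm x) -> adjoint_op dot T Ts ->
  nsq (tau T) <= 1.
Proof.
move=> FT cT adj; apply: (le_trans (tau_CS FT adj)).
have FTs := vna_adj FT adj; have FB := vna_comp FTs FT.
have cTs x : nm (Ts x) <= nm x.
  rewrite -[leRHS]mul1r; apply: (adjoint_nm hn ler01 _ adj) => y; by rewrite mul1r.
have lB := vna_linear FB.
have cB x : nm ((Ts \o T) x) <= nm x by apply: le_trans (cTs _) (cT _).
have sB : adjoint_op dot (Ts \o T) (Ts \o T).
  by apply: adjoint_comp => //; exact: adjoint_sym.
have [S [bS aS S2 _ cS]] := op_sqrt hn lB cB sB.
have FS : F S.
  have [_ _ <-] := Fvn; split=> // Z [bZ hZ].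
  by rewrite cS // hZ.
have := tau_sq_ge0 FS aS.
have -> : S \o S = (fun x => (-1) *: (Ts \o T) x + id x).
  by apply/funext => x; rewrite /= S2 scaleN1r addrC.
rewrite (tau_lin _ FB vna_id) tau_id mulN1r Cge0 => /andP[_].
by rewrite !Csimpl /=; lra.
Qed.

Section Words.
Variables (n : nat) (A : 'I_n -> H -> H).
Hypothesis AF : forall i, [/\ F (A i), adjoint_op dot (A i) (A i) & contraction_op (A i)].
Local Notation E := (word_eval A).

Lemma word_eval_cat v w : E (v ++ w) = E v \o E w.
Proof. by elim: v => [|i v ih] //=; rewrite ih. Qed.
Lemma word_eval_vna w : F (E w).
Proof.
elim: w => [|i w ih]; first exact: vna_id.
by have [Fi _ _] := AF i; exact: (vna_comp Fi ih).
Qed.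
Lemma word_eval_contr w x : nm (E w x) <= nm x.
Proof.
elim: w => [|i w ih] //=; apply: le_trans ih.
by have [_ _ /(_ (E w x))] := AF i; rewrite !nmE lecR.
Qed.
Lemma word_eval_adj w : adjoint_op dot (E w) (E (rev w)).
Proof.
elim: w => [|i w ih] //; rewrite rev_cons -cats1 word_eval_cat.
by have [_ ai _] := AF i; apply: (adjoint_comp ai ih).
Qed.

Lemma trace_word_state : word_state cat [::] rev (fun w : word n => tau (E w)).
Proof.
apply: free_word_state=> //.
- move=> v w; rewrite !word_eval_cat; have [_ h _ _] := Ftr.
  by apply: h; exact: word_eval_vna.
- by move=> w; apply: tau_adj; [exact: word_eval_vna|exact: word_eval_adj].
- exact: tau_id.
- move=> w; apply: tau_contraction (word_eval_adj w).
    exact: word_eval_vna.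
  exact: word_eval_contr.
- move=> s; rewrite formE.
  pose T x := \sum_(y <- s) y.1 *: E y.2 x.
  pose Ts x := \sum_(y <- s) y.1^* *: E (rev y.2) x.
  have [FT _] := vna_lincomb s (fun y => y.1) (fun y => word_eval_vna y.2).
  have aT : adjoint_op dot T Ts.
    move=> x z; rewrite /T /Ts.
    elim: s {T Ts FT} => [|y s ih]; first by rewrite !big_nil d0l d0r.
    by rewrite !big_cons dDl dDr dZl dZr cjK (word_eval_adj y.2) ih.
  have := tau_sq_ge0 FT aT.
  have -> : Ts \o T = (fun x => \sum_(y <- s) y.1^* *: (E (rev y.2) \o T) x) by [].
  have FET (y : C * word n) : F (E (rev y.2) \o T) by apply: vna_comp => //; exact: word_eval_vna.
  have [_ ->] := vna_lincomb s (fun y : C * word n => y.1^*) FET.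
  congr (0 <= _); apply: eq_bigr => y _; rewrite -mulr_sumr; congr (_ * _).
  have -> : E (rev y.2) \o T = (fun x => \sum_(z <- s) z.1 *: E (rev y.2 ++ z.2) x).
    apply/funext => x /=; have lE := vna_linear (word_eval_vna (rev y.2)).
    rewrite /T (big_morph _ (op_add lE) (op_0 lE)); apply: eq_bigr => z _.
    by rewrite (op_scale lE) word_eval_cat.
  by have [_ ->] := vna_lincomb s (fun z => z.1) (fun z => word_eval_vna (rev y.2 ++ z.2)).
Qed.

Lemma tau_nceval (f : ncpoly R n) : tau (nceval A f) = lext (fun w => tau (E w)) f.
Proof.
have [_ ->] := vna_lincomb (msupp f) (fun w => mcoeff w f) word_eval_vna.
by rewrite /lext mmapE.
Qed.
End Words.
End TracialAlgebra.

(** * States realized in factors *)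
Section MainDirections.
Variables (R : realType) (n : nat) (f : ncpoly R n).
Local Notation C := R[i].

Lemma trace_ge0_of_states :
  (forall phi : {scalar ncpoly R n}, tracial_contraction_state phi -> 0 <= phi f) ->
  forall (H : completeNormedModType C) (dot : {dot H for @Num.conj C})
         (F : set (H -> H)) (tau : (H -> H) -> C) (A : 'I_n -> H -> H),
    hilbert_norm dot -> von_neumann_algebra dot F -> canonical_trace dot F tau ->
    (forall i, [/\ F (A i), adjoint_op dot (A i) (A i) & contraction_op (A i)]) ->
  0 <= tau (nceval A f).
Proof.
move=> h H dot F tau A hn Fvn Ftr AF; rewrite (tau_nceval Fvn Ftr AF).
exact: (h (lext _ : {scalar _}) (tcs_lext (trace_word_state hn Fvn Ftr AF))).
Qed.

Section Realization.
Variable phi : {scalar ncpoly R n}.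
Hypothesis tphi : tracial_contraction_state phi.
Let S := ophi_state (tcs_word_state tphi).
Let CS := cphi_state S.
Local Notation cw := (fun w : word n => ([seq (Some i, 0) | i <- w], 0) : cword (option 'I_n)).
Local Notation dot := (rk_dot (sker_pd CS)).
Local Notation H := (rkhs (sker_pd CS)).

Definition letter (i : 'I_n) : H -> H := Lop (cw [:: i]).

Lemma letter_word w : word_eval letter w (kw CS (@cone _)) = kw CS (cw w).
Proof.
elim: w => [|i w ih] //=; rewrite ih /letter Lop_kw; congr (kw CS _).
by rewrite /cop /= shift0 addr0.
Qed.

(** At the trace vector, a word in the letters at site 0 gives the kernel vector
    of that word, and evaluating it at the neutral element gives the state. *)
Lemma realization : gns_tr (nceval letter f) = phi f.
Proof.
rewrite /gns_tr /nceval.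
have dsum (r : seq (word n)) (G : word n -> H) x :
    dot (\sum_(w <- r) G w) x = \sum_(w <- r) dot (G w) x.
  by apply: (big_morph (fun y => dot y x)) => [y z|]; [exact: dDl|exact: d0l].
rewrite dsum -[in RHS](combK f) /pol /comb big_map linear_sum; apply: eq_bigr => w _.
rewrite dZl linearZ letter_word dot_kw kwE (ws_st1 CS) (ws_1w CS).
have -> : cw w = ([seq (x, 0) | x <- map Some w], 0) by rewrite -map_comp.
by rewrite (cphi_site0 S) (ophi_Some (fun v => phi (ncword R v)) w).
Qed.

Lemma letter_op i : [/\ gnsF (letter i), adjoint_op dot (letter i) (letter i) &
  contraction_op (letter i)].
Proof.
split; first exact: gnsF_Lop.
  have := @Lop_adj _ _ _ _ _ _ CS (cw [:: i]).
  by rewrite /cst /= oppr0 /rev /= /shift /= addr0.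
by move=> x; rewrite !nmE lecR; exact: Lop_contr.
Qed.
End Realization.

Lemma states_ge0_of_factors :
  (forall (H : completeNormedModType C) (dot : {dot H for @Num.conj C})
         (F : set (H -> H)) (tau : (H -> H) -> C) (A : 'I_n -> H -> H),
    hilbert_norm dot -> separable_hilbert H ->
    II1_factor dot F -> canonical_trace dot F tau ->
    (forall i, [/\ F (A i), adjoint_op dot (A i) (A i) & contraction_op (A i)]) ->
    0 <= tau (nceval A f)) ->
  forall phi : {scalar ncpoly R n}, tracial_contraction_state phi -> 0 <= phi f.
Proof.
move=> h phi tphi; rewrite -(realization tphi).
have II1 := crossed_II1 (ophi_state (tcs_word_state tphi)) (ophi_None _) (ophi_None2 _).
apply: (h _ _ _ _ _ _ _ II1 (gns_trace _) (letter_op tphi)).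
  exact: rk_hilbert_norm.
exact: rk_separable.
Qed.
End MainDirections.

Theorem theorem3p12 (R : realType) (n : nat) (f : ncpoly R n) :
  ((forall (H : completeNormedModType R[i]) (dot : {dot H for @Num.conj R[i]})
           (F : set (H -> H)) (tau : (H -> H) -> R[i]) (A : 'I_n -> H -> H),
       hilbert_norm dot -> separable_hilbert H ->
       II1_factor dot F -> canonical_trace dot F tau ->
       (forall i, [/\ F (A i), adjoint_op dot (A i) (A i) & contraction_op (A i)]) ->
       0 <= tau (nceval A f))
   <-> (forall phi : {scalar ncpoly R n},
          tracial_contraction_state phi -> 0 <= phi f))
  /\
  ((forall phi : {scalar ncpoly R n},
      tracial_contraction_state phi -> 0 <= phi f)
   <-> (forall eps : R, 0 < eps ->
          exists2 g : ncpoly R n, @M_C R n g &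
            cyc_equiv (f + eps%:C%:A) g)).
Proof.
split; split.
- exact: states_ge0_of_factors.
- move=> h H dot F tau A hn _ [[Fvn _] _ _ _] Ftr AF.
  exact: (trace_ge0_of_states h hn Fvn Ftr AF).
- exact: certificates_of_states.
- exact: state_ge0_of_certificates.
Qed.
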